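(* Let $1,w_1,\dots,w_J$ be linearly independent in $L_2([0,1]^2)$, let $w^\star$ be a graphon, and let the data follow the independent-dyad design: $(U_s,V_s)$ i.i.d. uniform on $[0,1]^2$ and $Y_s\mid U_s,V_s\sim\mathrm{Bernoulli}(w^\star(U_s,V_s))$, independently for $s=1,\dots,m$. Fix $\nu,\tau>0$. As $m\to\infty$, $$\sqrt m(\hat\beta-\beta^\circ)\Rightarrow N(0,G^{-1}MG^{-1}),\qquad m\hat\Sigma\to\nu G^{-1}\ \text{a.s.},\qquad m\,\mathbb E\|\hat w-w^\circ\|^2\to c(w^\star).$$ For every linear functional $\ell^\top\beta$ ($\ell\ne0$), and in particular for every link probability $\beta^\top F(u,v)$, the frequentist coverage (of $\ell^\top\beta^\circ$) of the posterior $(1-\alpha)$ credible interval $\ell^\top\hat\beta\pm z_{1-\alpha/2}(\ell^\top\hat\Sigma\ell)^{1/2}$ converges to a limit, and this limit is at least $1-\alpha$ for all $\ell$ if and only if $M\preceq\nu G$; the condition $\nu\ge\bar\sigma^2$ is sufficient, and $\nu=1/4$ suffices whenever $w^\star\in\mathcal H$.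
   Context: A graphon is a measurable symmetric $w:[0,1]^2\to[0,1]$. $\|\cdot\|$ is the $L_2([0,1]^2)$ norm, $\|\cdot\|_\infty$ the essential supremum, $\preceq$ the positive semidefinite order. Agents are graphons $w_1,\dots,w_J$; $d=J+1$; $F=(1,w_1,\dots,w_J)^\top$; $\mathcal H=\{\beta^\top F:\beta\in\mathbb R^d\}$; $G=\int FF^\top$. For the truth $w^\star$: $\beta^\circ=G^{-1}\int Fw^\star$, $w^\circ=(\beta^\circ)^\top F$, $\sigma^2=w^\star(1-w^\star)+(w^\star-w^\circ)^2$, $c(w^\star)=\int\sigma^2F^\top G^{-1}F$, $M=\int\sigma^2FF^\top$, $\bar\sigma^2=\|\sigma^2\|_\infty$. With $F_s=F(U_s,V_s)$ and $\kappa=\nu/(m\tau^2)$: $\hat G=m^{-1}\sum_sF_sF_s^\top$, $\hat\beta=(\hat G+\kappa I_d)^{-1}m^{-1}\sum_sF_sY_s$, $\hat\Sigma=(\nu/m)(\hat G+\kappa I_d)^{-1}$, $\hat w=\hat\beta^\top F$ (unclipped). The working posterior for $\beta$ is $N(\hat\beta,\hat\Sigma)$. $z_{1-\alpha/2}$ is the standard normal quantile, $\alpha\in(0,1)$. *)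

(* Defs.v *)
From HB Require Import structures.
From mathcomp Require Import all_boot all_order all_algebra.
From mathcomp Require Import all_classical all_reals all_analysis.

Set Implicit Arguments.
Unset Strict Implicit.
Unset Printing Implicit Defensive.

Import Order.TTheory GRing.Theory Num.Theory.
Import numFieldNormedType.Exports.

Local Open Scope classical_set_scope.
Local Open Scope ring_scope.

(* Functions on [0,1]^2 are represented by total functions on R * R; only their
   restriction to unit_square is ever used. *)
Definition unit_square (R : realType) : set (R * R) := `[0, 1] `*` `[0, 1].
Arguments unit_square : clear implicits.

Notation lebesgue2 R := (@lebesgue_measure R \x @lebesgue_measure R)%E.

Section square.
Context {R : realType}.

Definition graphon (w : R * R -> R) : Prop :=
  [/\ measurable_fun (unit_square R) w,
      forall x, unit_square R x -> 0 <= w x <= 1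
    & forall u v, unit_square R (u, v) -> w (u, v) = w (v, u)].

Definition L2norm (f : R * R -> R) : R :=
  fine ('N[lebesgue2 R]_(2%:E) [patch (fun=> 0) (unit_square R) (EFin \o f)])%E.

Definition Linfty_norm (f : R * R -> R) : \bar R :=
  ('N[lebesgue2 R]_(+oo) [patch (fun=> 0) (unit_square R) (EFin \o f)])%E.

Definition ae_eq_square (f g : R * R -> R) : Prop :=
  {ae lebesgue2 R, forall x, unit_square R x -> f x = g x}.

End square.

Section matrices.
Context {R : realType} {d : nat}.

Definition dot (a b : 'cV[R]_d) : R := (a^T *m b) 0 0.

Definition quad (A : 'M[R]_d) (a : 'cV[R]_d) : R := (a^T *m A *m a) 0 0.

Definition psd (A : 'M[R]_d) : Prop := A^T = A /\ forall a, 0 <= quad A a.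

Definition loewner_le (A B : 'M[R]_d) : Prop := psd (B - A).

End matrices.

Section agents.
Context {R : realType} {J : nat}.
Variables (w : 'I_J -> R * R -> R) (wstar : R * R -> R).

Definition Fvec (x : R * R) : 'cV[R]_J.+1 :=
  col_mx (1%:M : 'M[R]_1) (\col_(j < J) w j x).

Definition comb (beta : 'cV[R]_J.+1) (x : R * R) : R := dot beta (Fvec x).

(* Equality in L_2([0,1]^2) is equality almost everywhere. *)
Definition lin_indep_L2 : Prop :=
  forall beta, ae_eq_square (comb beta) (fun=> 0) -> beta = 0.

Definition in_H (f : R * R -> R) : Prop :=
  exists beta, ae_eq_square f (comb beta).

Definition Gmat : 'M[R]_J.+1 :=
  \matrix_(i, j)
    \int[lebesgue2 R]_(x in unit_square R) (Fvec x i 0 * Fvec x j 0).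

Definition beta_circ : 'cV[R]_J.+1 :=
  invmx Gmat *m
    \col_i \int[lebesgue2 R]_(x in unit_square R) (Fvec x i 0 * wstar x).

Definition w_circ : R * R -> R := comb beta_circ.

Definition sigma2 (x : R * R) : R :=
  wstar x * (1 - wstar x) + (wstar x - w_circ x) ^+ 2.

Definition cstar : R :=
  \int[lebesgue2 R]_(x in unit_square R)
    (sigma2 x * quad (invmx Gmat) (Fvec x)).

Definition Mmat : 'M[R]_J.+1 :=
  \matrix_(i, j)
    \int[lebesgue2 R]_(x in unit_square R)
      (sigma2 x * (Fvec x i 0 * Fvec x j 0)).

End agents.

Section probability.
Context {R : realType} {disp : measure_display} {Omega : measurableType disp}.
Variable P : probability Omega R.

Definition mutually_independent {d' : measure_display}
    {T : measurableType d'} (Z : nat -> Omega -> T) : Prop :=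
  forall (I : seq nat) (A : nat -> set T), uniq I ->
    (forall s, measurable (A s)) ->
    fine (P (\bigcap_(s in [set` I]) (Z s @^-1` A s))) =
    \prod_(s <- I) fine (P (Z s @^-1` A s)).

(* The third clause is the defining property of the conditional law: since
   (U_s, V_s) has law lebesgue2 R on the square, it says that bernoulli_prob
   (wstar x) is the conditional law of Y_s given (U_s, V_s) = x. *)
Definition independent_dyad_design (wstar : R * R -> R)
    (U V : nat -> {RV P >-> R}) (Y : nat -> {RV P >-> bool}) : Prop :=
  [/\ forall s omega, unit_square R (U s omega, V s omega),
      forall s (A : set (R * R)), measurable A ->
        P [set omega | A (U s omega, V s omega)] =
        lebesgue2 R (A `&` unit_square R),
      forall s (A : set (R * R)) (B : set bool),
        measurable A -> measurable B ->
        P [set omega | A (U s omega, V s omega) /\ B (Y s omega)] =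
        (\int[lebesgue2 R]_(x in A `&` unit_square R)
           bernoulli_prob (wstar x) B)%E
    & mutually_independent
        (fun s omega => (U s omega, V s omega, Y s omega))].

Definition borel_cV (d : nat) := g_sigma_algebraType (@open 'cV[R]_d).

(* normal_prob m 0 is not the point mass at m, hence the case split. *)
Definition normal_law (m v : R) (A : set R) : \bar R :=
  if v == 0 then \d_m A else normal_prob m (Num.sqrt v) A.

(* N is the (possibly degenerate) normal law N(m, S): each linear functional is
   normal, with the corresponding mean and variance. *)
Definition is_mvnormal (d : nat) (N : probability (borel_cV d) R)
    (m : 'cV[R]_d) (S : 'M[R]_d) : Prop :=
  forall (a : 'cV[R]_d) (A : set R), measurable A ->
    N [set x : 'cV[R]_d | A (dot a x)] = normal_law (dot a m) (quad S a) A.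

Definition cvg_in_law (d : nat) (X : nat -> Omega -> 'cV[R]_d)
    (N : probability (borel_cV d) R) : Prop :=
  forall f : 'cV[R]_d -> R, continuous f -> (exists K, forall x, `|f x| <= K) ->
    'E_P[fun omega => f (X m omega)]%E @[m --> \oo] -->
    (\int[N]_x (f x)%:E)%E.

Definition normal_quantile (p : R) : R :=
  inf [set x : R | (p%:E <= normal_prob 0 1 `]-oo, x])%E].

End probability.

Section estimators.
Context {R : realType} {disp : measure_display} {Omega : measurableType disp}.
Context {P : probability Omega R} {J : nat}.
Variables (w : 'I_J -> R * R -> R).
Variables (U V : nat -> {RV P >-> R}) (Y : nat -> {RV P >-> bool}).
Variables (nu tau : R).

Definition Fs (s : nat) (omega : Omega) : 'cV[R]_J.+1 :=
  Fvec w (U s omega, V s omega).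

Definition kappa (m : nat) : R := nu / (m%:R * tau ^+ 2).

Definition Ghat (m : nat) (omega : Omega) : 'M[R]_J.+1 :=
  m%:R^-1 *: \sum_(s < m) (Fs s omega *m (Fs s omega)^T).

Definition betahat (m : nat) (omega : Omega) : 'cV[R]_J.+1 :=
  invmx (Ghat m omega + (kappa m)%:M) *m
    (m%:R^-1 *: \sum_(s < m) ((Y s omega)%:R *: Fs s omega)).

Definition Sigmahat (m : nat) (omega : Omega) : 'M[R]_J.+1 :=
  (nu / m%:R) *: invmx (Ghat m omega + (kappa m)%:M).

Definition what (m : nat) (omega : Omega) : R * R -> R :=
  comb w (betahat m omega).

(* The working posterior of beta is N(betahat, Sigmahat), so that of l^T beta is
   N(l^T betahat, l^T Sigmahat l). *)
Definition credible_interval (alpha : R) (l : 'cV[R]_J.+1)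
    (m : nat) (omega : Omega) : set R :=
  let center := dot l (betahat m omega) in
  let halfwidth := normal_quantile (1 - alpha / 2) *
                   Num.sqrt (quad (Sigmahat m omega) l) in
  `[center - halfwidth, center + halfwidth].

Definition coverage (wstar : R * R -> R) (alpha : R) (l : 'cV[R]_J.+1)
    (m : nat) : R :=
  fine (P [set omega |
    credible_interval alpha l m omega (dot l (beta_circ w wstar))]).

End estimators.

(* Main.v *)
Require Import Defs.
From HB Require Import structures.
From mathcomp Require Import all_boot all_order all_algebra.
From mathcomp Require Import all_classical all_reals all_analysis.
From mathcomp Require Import measurable_realfun ring lra zify.
Import Order.TTheory GRing.Theory Num.Theory.
Import numFieldNormedType.Exports.
Local Open Scope classical_set_scope.
Local Open Scope ring_scope.

(** Let G and M be the Gram matrix of the regressors F and the second moment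
    matrix of the scores F (Y - w_circ). The error of the estimator at scale
    sqrt m, [err], satisfies the normal equations

      err m = (Ghat + kappa I)^-1 (S_m - rho_m beta_circ),

    where S_m is the normalised sum of the scores and rho_m = nu / (sqrt m
    tau^2) is the bias due to shrinkage ([errE]). The scores are centred
    because beta_circ solves the population normal equations ([EX_score]), and
    their second moment matrix is M because, given (U, V) = x, the squared
    residual has mean sigma2 x ([MmatE]). By Hoeffding's inequality Ghat is
    within any given distance of G off an event of probability at most C / m^6
    ([bad_rare]). Off this event, for large m, err m differs from G^-1 S_m by
    at most e (|S_m| + 1) ([err_close]); on it, the ridge term alone bounds
    err m by a power of m ([err_le]). As S_m has bounded second moments, every
    quantity that is at most quadratic in the error has the same limiting mean
    for err m and for G^-1 S_m ([vanishing_mean]).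

    The consequences are as follows. The characteristic function of G^-1 S_m,
    a normalised sum of i.i.d. bounded vectors, converges to that of N(0, G^-1
    M G^-1) ([cf_clt], [cf_clt_sum]), so Levy's continuity theorem ([levy])
    gives convergence in law of err m ([clt_err]). The squared L2 distance
    between what and w_circ is the form G at err m, divided by m, and the mean
    of the form G at G^-1 S_m is the trace of G^-1 M, that is, c(wstar)
    ([risk_err]). The Borel-Cantelli lemma, applied to the bad events, and
    continuity of inversion ([invmx_perturb]) give the almost sure limit of m
    Sigmahat ([Sigmahat_cvg]). The coverage event says that (l, err m) is at
    most z times the square root of nu (l, (Ghat + kappa I)^-1 l) in absolute
    value, and this bound tends to z times the square root of nu (l, G^-1 l);
    hence the coverage tends to the probability that a normal variable of
    variance (l, G^-1 M G^-1 l) lies in the limiting interval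
    ([coverage_cvg]). By definition of the quantile this is at least 1 - alpha
    exactly when (l, G^-1 M G^-1 l) <= nu (l, G^-1 l)
    ([centred_prob_quantile]); with l = G a this reads (a, M a) <= nu (a, G
    a). Finally (a, (nu G - M) a) is the integral of (nu - sigma2) (a, F)^2,
    which is nonnegative when nu bounds sigma2 ([loewner_of_noise]); for wstar
    in H, sigma2 = wstar (1 - wstar) <= 1/4.

    Three classical results are proved on the way. Levy's theorem rests on the
    approximation of continuous functions on a cube by trigonometric
    polynomials, obtained as Bernstein polynomials in the variables (1 + sin
    (x_i / L)) / 2 ([trig_approx]). The characteristic function of the normal
    law follows from Stein's identity ([psi_stein]). Normal laws with a
    singular covariance are constructed by induction on its rank
    ([normal_cf_exists]), and their projections are identified by uniqueness
    of characteristic functions on the line ([probability_unique]). *)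

Set Implicit Arguments.
Unset Strict Implicit.
Unset Printing Implicit Defensive.

(** * Bounded measurable functions and their expectations *)

Section bounded_measurable.
Context {d} {T : measurableType d} {R : realType}.
Implicit Types (f g : T -> R).

(** For a fixed sample size every random variable of the proof is bounded; this
    class is closed under the algebraic operations and all its members are
    integrable. *)
Definition bmeas f : Prop :=
  measurable_fun setT f /\ exists K : R, forall x, `|f x| <= K.

Lemma bmeas_cst c : bmeas (fun=> c).
Proof. by split; [exact: measurable_cst|exists `|c|]. Qed.

Lemma bmeasD f g : bmeas f -> bmeas g -> bmeas (fun x => f x + g x).
Proof.
move=> [mf [K fK]] [mg [L gL]]; split; first exact: measurable_funD.
by exists (K + L) => x; rewrite (le_trans (ler_normD _ _))// lerD.
Qed.

Lemma bmeasM f g : bmeas f -> bmeas g -> bmeas (fun x => f x * g x).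
Proof.
move=> [mf [K fK]] [mg [L gL]]; split; first exact: measurable_funM.
by exists (K * L) => x; rewrite normrM ler_pM.
Qed.

Lemma bmeasZ c f : bmeas f -> bmeas (fun x => c * f x).
Proof. by move=> ?; apply: bmeasM => //; exact: bmeas_cst. Qed.

Lemma bmeasN f : bmeas f -> bmeas (fun x => - f x).
Proof.
move=> bf; rewrite (_ : (fun _ => _) = (fun x => -1 * f x)); first exact: bmeasZ.
by apply/funext => x; rewrite mulN1r.
Qed.

Lemma bmeasB f g : bmeas f -> bmeas g -> bmeas (fun x => f x - g x).
Proof. by move=> bf bg; apply: bmeasD => //; exact: bmeasN. Qed.

Lemma bmeas_norm f : bmeas f -> bmeas (fun x => `|f x|).
Proof.
move=> [mf [K fK]]; split; first exact: measurableT_comp.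
by exists K => x; rewrite normr_id.
Qed.

Lemma bmeasX n f : bmeas f -> bmeas (fun x => f x ^+ n).
Proof.
move=> bf; elim: n => [|n ih].
  by under eq_fun do rewrite expr0; exact: bmeas_cst.
by under eq_fun do rewrite exprS; exact: bmeasM.
Qed.

Lemma bmeas_sum (I : Type) (r : seq I) (P : pred I) (F : I -> T -> R) :
  (forall i, bmeas (F i)) -> bmeas (fun x => \sum_(i <- r | P i) F i x).
Proof.
move=> bF; elim: r => [|i r ih].
  by under eq_fun do rewrite big_nil; exact: bmeas_cst.
under eq_fun do rewrite big_cons.
by case: (P i) => //; exact: bmeasD.
Qed.

Lemma bmeas_prod (I : Type) (r : seq I) (P : pred I) (F : I -> T -> R) :
  (forall i, bmeas (F i)) -> bmeas (fun x => \prod_(i <- r | P i) F i x).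
Proof.
move=> bF; elim: r => [|i r ih].
  by under eq_fun do rewrite big_nil; exact: bmeas_cst.
under eq_fun do rewrite big_cons.
by case: (P i) => //; exact: bmeasM.
Qed.

Lemma bmeas_indic (A : set T) : measurable A -> bmeas (\1_A : T -> R).
Proof.
move=> mA; split; first exact: measurable_indic.
exists 1 => x; rewrite indicE; case: (x \in A) => /=; last by rewrite normr0.
by rewrite normr1.
Qed.

(** A continuous function is bounded on the compact interval that contains the
    range of f. *)
Lemma bmeas_comp_cont f (h : R -> R) :
  continuous h -> bmeas f -> bmeas (h \o f).
Proof.
move=> ch [mf [K fK]]; split.
  by apply: measurableT_comp => //; exact: continuous_measurable_fun.
have K0 : - `|K| <= `|K| by rewrite -subr_ge0 opprK addr_ge0.
have fK' x : - `|K| <= f x <= `|K|.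
  by rewrite -ler_norml (le_trans (fK x))// ler_norm.
have hc : {within `[- `|K|, `|K|], continuous h}.
  by apply: continuous_subspaceT.
have [a _ ha] := EVT_max K0 hc; have [b _ hb] := EVT_min K0 hc.
exists (`|h a| + `|h b|) => x.
have /ha h1 : f x \in `[- `|K|, `|K|] by rewrite in_itv/= fK'.
have /hb h2 : f x \in `[- `|K|, `|K|] by rewrite in_itv/= fK'.
rewrite ler_norml; apply/andP; split; rewrite /=.
  rewrite (le_trans _ h2)// opprD -[leRHS]add0r lerD//.
  by rewrite lerNl -normrN ler_norm.
by rewrite (le_trans h1)// -[leLHS]addr0 lerD// ler_norm.
Qed.

End bounded_measurable.

Lemma bmeas_comp d d' (T : measurableType d) (T' : measurableType d')
    (R : realType) (X : T' -> T) (f : T -> R) :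
  measurable_fun setT X -> bmeas f -> bmeas (f \o X).
Proof.
by move=> mX [mf [K fK]]; split; [exact: measurableT_comp|exists K => x /=].
Qed.

Lemma measurable_le_set d (T : measurableType d) (R : realType) (f g : T -> R) :
  measurable_fun setT f -> measurable_fun setT g -> measurable [set x | f x <= g x].
Proof.
move=> mf mg; have := measurable_fun_ler mf mg measurableT (Y := [set true]) I.
by rewrite setTI.
Qed.

(** The number of levels h, 2 h, ..., n h that are at most v, times h,
    approximates v from below to within h. *)
Lemma count_levels (R : realType) (h v : R) (n : nat) : 0 < h ->
  0 <= v <= n%:R * h ->
  v - h <= h * \sum_(j < n) ((j.+1%:R * h <= v)%R : nat)%:R <= v.
Proof.
move=> h0; elim: n => [|n ih] /andP[v0 vn].
  have -> : v = 0 by apply/eqP; rewrite eq_le v0 andbT (le_trans vn)// mul0r.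
  by rewrite big_ord0 mulr0 sub0r lexx oppr_le0 ltW.
rewrite big_ord_recr /=.
have [vlt|vge] := leP v (n%:R * h).
  have /andP[i1 i2] := ih (introT andP (conj v0 vlt)).
  have -> : (n.+1%:R * h <= v) = false.
    apply/negbTE; rewrite -ltNge (le_lt_trans vlt)// ltr_pM2r// ltr_nat//.
  by rewrite addr0 i1 i2.
have -> : \sum_(i < n) ((i.+1%:R * h <= v)%R : nat)%:R = n%:R :> R.
  rewrite (eq_bigr (fun=> 1)); first by rewrite sumr_const card_ord.
  move=> i _; have -> //= : i.+1%:R * h <= v.
  by rewrite (le_trans _ (ltW vge))// ler_pM2r// ler_nat.
rewrite -natr1 in vn *; have [le1|gt1] := leP _ v => /=.
  by apply/andP; split; nra.
by apply/andP; split; nra.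
Qed.

Section bounded_functional.
Context {d} {T : measurableType d} {R : realType}.

(** Integrals and expectations are treated as bounded linear functionals on
    bounded measurable functions, so that identities between them can be checked
    on indicators. *)
Record bfunctional (L : (T -> R) -> R) : Prop := BFunctional {
  bfD : forall f g, bmeas f -> bmeas g -> L (fun x => f x + g x) = L f + L g;
  bfZ : forall c f, bmeas f -> L (fun x => c * f x) = c * L f;
  bfC : exists C : R, forall f (K : R), bmeas f -> (forall x, `|f x| <= K) -> `|L f| <= C * K }.

Lemma bfsum L (I : Type) (r : seq I) (F : I -> T -> R) : bfunctional L ->
  (forall i, bmeas (F i)) ->
  L (fun x => \sum_(i <- r) F i x) = \sum_(i <- r) L (F i).
Proof.
move=> bL bF; elim: r => [|i r ih].
  rewrite big_nil; under eq_fun do rewrite big_nil.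
  have := bfZ bL 0 (bmeas_cst (T := T) 0); rewrite !mul0r => L0.
  by [].
rewrite big_cons -ih -(bfD bL)//; last exact: bmeas_sum.
by congr L; apply/funext => x; rewrite big_cons.
Qed.

(** By [count_levels], a bounded measurable function is a uniform limit of
    linear combinations of indicators of its superlevel sets. *)
Lemma bfunctional_ext L1 L2 : bfunctional L1 -> bfunctional L2 ->
  (forall A, measurable A -> L1 \1_A = L2 \1_A) ->
  forall f, bmeas f -> L1 f = L2 f.
Proof.
move=> b1 b2 L12 f bf; have [mf [K fK]] := bf.
have [C1 C1P] := bfC b1; have [C2 C2P] := bfC b2.
suff key : forall e : R, 0 < e -> `|L1 f - L2 f| <= (C1 + C2) * e.
  apply/eqP; rewrite -subr_eq0 -normr_le0; apply/ler_addgt0Pl => e e0.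
  rewrite addr0; pose D := `|C1 + C2| + 1.
  have D0 : 0 < D by rewrite ltr_wpDl.
  have e1 : 0 < e / D by rewrite divr_gt0.
  apply: (le_trans (key _ e1)).
  rewrite mulrCA ger_pMr// ler_pdivrMr// mul1r.
  by rewrite (le_trans (ler_norm _))// lerDl.
move=> e e0; set K' := `|K| + 1.
have K0 : 0 < K' by rewrite ltr_wpDl.
pose n := (Num.trunc (2 * K' / e)).+1.
(* n levels of height h <= e cover the range [0, 2 K'] of f + K' *)
pose h := 2 * K' / n%:R.
have n0 : 0 < n%:R :> R by rewrite ltr0n.
have h0 : 0 < h by rewrite divr_gt0// mulr_gt0.
have he : h <= e.
  rewrite /h ler_pdivrMr// [e * _]mulrC -ler_pdivrMr//.
  by apply: ltW; exact: truncnS_gt.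
pose A j := [set x | j.+1%:R * h <= f x + K'].
have mA j : measurable (A j).
  have := measurable_funD mf (@measurable_cst _ _ T R setT K').
  move=> /(_ measurableT `[j.+1%:R * h, +oo[%classic (measurable_itv _)).
  by rewrite setTI; congr measurable; apply/seteqP; split => x /=;
    rewrite in_itv/= andbT.
pose s x : R := - K' + h * \sum_(j < n) \1_(A j) x.
have bs0 : bmeas (fun x => \sum_(j < n) \1_(A j) x : R).
  by apply: bmeas_sum => j; exact: bmeas_indic.
have bs : bmeas s by apply: bmeasD; [exact: bmeas_cst|exact: bmeasZ].
have Ls : L1 s = L2 s.
  have bK : bmeas (fun _ : T => - K' * 1 : R) by exact: bmeas_cst.
  have sE : s = (fun x => (fun=> - K' * 1) x + (fun x => h * \sum_(j < n) \1_(A j) x) x).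
    by apply/funext => x; rewrite mulr1.
  rewrite sE (bfD b1)//; last exact: bmeasZ.
  rewrite (bfD b2)//; last exact: bmeasZ.
  have b1T : bmeas (fun _ : T => 1 : R) by exact: bmeas_cst.
  have I1 : (fun _ : T => 1 : R) = \1_setT by apply/funext => x; rewrite indicT.
  rewrite !(bfZ b1, bfZ b2)// I1 L12//; congr (_ + _ * _).
  rewrite bfsum; [|by []|by move=> j; exact: bmeas_indic].
  rewrite bfsum; [|by []|by move=> j; exact: bmeas_indic].
  by apply: eq_bigr => j _; rewrite L12.
have fs x : `|f x - s x| <= e.
  have bd : 0 <= f x + K' <= n%:R * h.
    have := le_trans (fK x) (ler_norm K); rewrite ler_norml => /andP[h1 h2].
    have -> : n%:R * h = 2 * K' by rewrite /h mulrC divfK ?lt0r_neq0.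
    by apply/andP; split; rewrite /K'; lra.
  have /andP[] := count_levels h0 bd.
  have -> : \sum_(j < n) ((j.+1%:R * h <= f x + K')%R : nat)%:R =
            \sum_(j < n) \1_(A j) x :> R.
    apply: eq_bigr => j _; rewrite indicE; congr (nat_of_bool _)%:R.
    by apply/idP/idP; rewrite inE.
  by move=> a1 a2; rewrite /s ler_norml; apply/andP; split; lra.
have bfs : bmeas (fun x => f x - s x) by exact: bmeasB.
have fE : f = (fun x => (f x - s x) + s x) by apply/funext => x; rewrite subrK.
rewrite {1}fE (bfD b1)// {2}fE (bfD b2)// Ls.
have -> : forall a b c : R, a + c - (b + c) = a - b by move=> *; ring.
by rewrite (le_trans (ler_normB _ _))// mulrDl lerD// ?C1P// ?C2P.
Qed.

End bounded_functional.

Section bounded_integral.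
Context {d} {T : measurableType d} {R : realType}.
Variable mu : {measure set T -> \bar R}.
Variable D : set T.
Hypotheses (mD : measurable D) (fD : (mu D < +oo)%E).

Lemma bmeas_integrable f : bmeas f -> mu.-integrable D (EFin \o f).
Proof.
move=> [mf [K fK]]; apply: measurable_bounded_integrable => //.
  exact: measurable_funTS.
exists K; split; first exact: num_real.
by move=> M KM x _ /=; rewrite (le_trans (fK x))// ltW.
Qed.

Lemma bfunctional_int q : bmeas q ->
  bfunctional (fun f => \int[mu]_(x in D) (f x * q x)).
Proof.
move=> bq; split.
- move=> f g bf bg; rewrite -RintegralD//; try exact/bmeas_integrable/bmeasM.
  by apply: eq_Rintegral => x _; rewrite mulrDl.
- move=> c f bf; rewrite -RintegralZl//; last exact/bmeas_integrable/bmeasM.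
  by apply: eq_Rintegral => x _; rewrite mulrA.
- have [_ [Q qQ]] := bq; exists (Q * fine (mu D)) => f K bf fK.
  have bfq := bmeasM bf bq.
  rewrite (le_trans (le_normr_Rintegral _ (bmeas_integrable bfq)))//.
  rewrite mulrAC -mulrA -(Rintegral_cst mu mD) -RintegralZl//; last first.
    exact/bmeas_integrable/bmeas_cst.
  apply: le_Rintegral => //.
  + exact/bmeas_integrable/bmeas_norm.
  + exact/bmeas_integrable/bmeas_cst.
  + by move=> x _; rewrite normrM mulrC ler_pM.
Qed.

End bounded_integral.

Section expectation.
Context {d} {T : measurableType d} {R : realType} (P : probability T R).
Implicit Types f g : T -> R.

Definition Ex f : R := \int[P]_x f x.

Let PT : (P setT < +oo)%E. Proof. by rewrite probability_setT ltry. Qed.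

Lemma bmeas_Pint f : bmeas f -> P.-integrable setT (EFin \o f).
Proof. by move=> bf; apply: bmeas_integrable. Qed.

Lemma expectationE f : bmeas f -> ('E_P[f] = (Ex f)%:E)%E.
Proof.
move=> bf; rewrite unlock /Ex /Rintegral fineK//.
exact: integrable_fin_num (bmeas_Pint bf).
Qed.

Lemma integralE_Ex f : bmeas f -> (\int[P]_x (f x)%:E = (Ex f)%:E)%E.
Proof.
move=> bf; rewrite /Ex /Rintegral fineK//.
exact: integrable_fin_num (bmeas_Pint bf).
Qed.

Lemma ExD f g : bmeas f -> bmeas g -> Ex (fun x => f x + g x) = Ex f + Ex g.
Proof. by move=> *; apply: RintegralD => //; exact: bmeas_Pint. Qed.

Lemma ExB f g : bmeas f -> bmeas g -> Ex (fun x => f x - g x) = Ex f - Ex g.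
Proof. by move=> *; apply: RintegralB => //; exact: bmeas_Pint. Qed.

Lemma ExZ c f : bmeas f -> Ex (fun x => c * f x) = c * Ex f.
Proof. by move=> *; apply: RintegralZl => //; exact: bmeas_Pint. Qed.

Lemma Ex_cst c : Ex (fun=> c) = c.
Proof.
rewrite /Ex Rintegral_cst//.
by rewrite -[LHS]/(c * fine (P setT)) probability_setT mulr1.
Qed.

Lemma Ex_le f g : bmeas f -> bmeas g -> (forall x, f x <= g x) -> Ex f <= Ex g.
Proof. by move=> *; apply: le_Rintegral => //; exact: bmeas_Pint. Qed.

Lemma Ex_ge0 f : (forall x, 0 <= f x) -> 0 <= Ex f.
Proof. by move=> f0; exact: Rintegral_ge0. Qed.

Lemma Ex_norm f : bmeas f -> `|Ex f| <= Ex (fun x => `|f x|).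
Proof. by move=> bf; apply: le_normr_Rintegral => //; exact: bmeas_Pint. Qed.

Lemma Ex_normle f K : bmeas f -> (forall x, `|f x| <= K) -> `|Ex f| <= K.
Proof.
move=> bf fK; rewrite (le_trans (Ex_norm bf))// -[leRHS]Ex_cst.
by apply: Ex_le => //; [exact: bmeas_norm|exact: bmeas_cst].
Qed.

Lemma Ex_indic A : measurable A -> Ex \1_A = fine (P A).
Proof. by move=> mA; rewrite /Ex /Rintegral integral_indic// setIT. Qed.

Lemma Ex_sum (I : Type) (r : seq I) (F : I -> T -> R) :
  (forall i, bmeas (F i)) ->
  Ex (fun x => \sum_(i <- r) F i x) = \sum_(i <- r) Ex (F i).
Proof.
move=> bF; elim: r => [|i r ih].
  by rewrite big_nil; under eq_fun do rewrite big_nil; exact: Ex_cst.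
rewrite big_cons -ih -ExD//; last exact: bmeas_sum.
by congr Ex; apply/funext => x; rewrite big_cons.
Qed.

Lemma bfunctional_Ex_weighted q : bmeas q -> bfunctional (fun f => Ex (fun x => f x * q x)).
Proof. by move=> bq; exact: bfunctional_int. Qed.

(** Markov's inequality, in a form that serves for union bounds and for tails. *)
Lemma probability_le_Ex (B : set T) f : measurable B -> bmeas f -> (forall x, 0 <= f x) ->
  (forall x, B x -> 1 <= f x) -> fine (P B) <= Ex f.
Proof.
move=> mB bf f0 f1; rewrite -Ex_indic//; apply: Ex_le => // [|x]; first exact: bmeas_indic.
by rewrite indicE; case: (boolP (x \in B)) => [/set_mem/f1//|_] /=; rewrite ?f0.
Qed.

Lemma fineP_indic A : measurable A -> (P A = (fine (P A))%:E)%E.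
Proof. by move=> mA; rewrite fineK// fin_num_measure. Qed.

Lemma fine_probability_le A B : measurable A -> measurable B -> A `<=` B ->
  fine (P A) <= fine (P B).
Proof.
by move=> mA mB AB; apply: fine_le; rewrite ?fin_num_measure// le_measure// inE.
Qed.

Lemma fine_probabilityU_le A B : measurable A -> measurable B ->
  fine (P (A `|` B)) <= fine (P A) + fine (P B).
Proof.
move=> mA mB; rewrite -fineD ?fin_num_measure//; apply: fine_le.
- by rewrite fin_num_measure//; exact: measurableU.
- by rewrite fin_numD !fin_num_measure.
- exact: measureU2.
Qed.

Lemma bfunctional_expectation : bfunctional Ex.
Proof.
split; [by move=> *; exact: ExD|by move=> *; exact: ExZ|].
by exists 1 => f K bf fK; rewrite mul1r; exact: Ex_normle.
Qed.

End expectation.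

Lemma bfunctional_comp d d' (T : measurableType d) (T' : measurableType d')
    (R : realType) (X : T -> T') (L : (T -> R) -> R) :
  measurable_fun setT X -> bfunctional L ->
  bfunctional (fun f : T' -> R => L (f \o X)).
Proof.
move=> mX bL; split.
- by move=> f g bf bg; apply: (bfD bL); exact: bmeas_comp.
- by move=> c f bf; apply: (bfZ bL); exact: bmeas_comp.
- have [C CP] := bfC bL; exists C => f K bf fK; apply: CP; first exact: bmeas_comp.
  by move=> x /=.
Qed.

(** * Independent families *)

Section independence.
Context {d} {Omega : measurableType d} {R : realType} (P : probability Omega R).
Context {d'} {T : measurableType d'}.
Variable X : nat -> Omega -> T.
Hypothesis mX : forall s, measurable_fun setT (X s).
Hypothesis indX : mutually_independent P X.

Lemma prod_indic (I : seq nat) (A : nat -> set T) omega :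
  \prod_(s <- I) (\1_(A s) (X s omega) : R) =
  \1_(\bigcap_(s in [set` I]) (X s @^-1` A s)) omega.
Proof.
elim: I => [|s I ih].
  rewrite big_nil indicE mem_set//.
rewrite big_cons ih !indicE -natrM mulnb; congr (nat_of_bool _)%:R.
apply/idP/idP.
  rewrite inE => /andP[/set_mem As /set_mem AI] k /=.
  by rewrite inE => /predU1P[->//|kI]; apply: AI.
rewrite inE => AI; apply/andP; split; apply/mem_set.
  by apply: (AI s) => /=; rewrite inE eqxx.
by move=> k kI; apply: (AI k) => /=; rewrite inE; apply/orP; right.
Qed.

(** Induction on I1: with the other factors fixed, both sides are bounded
    functionals of g s, so it is enough to compare them when g s is an
    indicator, and then s can be moved to I2. The base case is the product rule
    for events. *)
Lemma Ex_prod_cat (I1 I2 : seq nat) (g : nat -> T -> R) (A : nat -> set T) :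
  uniq (I1 ++ I2) -> (forall s, bmeas (g s)) -> (forall s, measurable (A s)) ->
  Ex P (fun omega => \prod_(s <- I1) g s (X s omega) *
                     \prod_(s <- I2) \1_(A s) (X s omega)) =
  \prod_(s <- I1) Ex P (fun omega => g s (X s omega)) *
  \prod_(s <- I2) Ex P (fun omega => \1_(A s) (X s omega)).
Proof.
have bcomp h s : bmeas h -> bmeas (fun omega => h (X s omega) : R).
  by move=> bh; apply: (bmeas_comp (mX s) bh).
elim: I1 I2 A => [|s I1 ih] I2 A uI bg mA.
  under eq_fun do rewrite big_nil mul1r prod_indic.
  rewrite big_nil mul1r Ex_indic; last first.
    by apply: bigcap_measurableType => // s _; rewrite -[X in measurable X]setTI; exact: mX.
  rewrite indX//; apply: eq_bigr => s _.
  by rewrite -Ex_indic// -[X in measurable X]setTI; exact: mX.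
pose q omega : R := \prod_(s <- I1) g s (X s omega) *
                     \prod_(s <- I2) \1_(A s) (X s omega).
have bq : bmeas q.
  apply: bmeasM; apply: bmeas_prod => i; apply: bcomp => //.
  exact: bmeas_indic.
pose c := \prod_(s <- I1) Ex P (fun omega => g s (X s omega)) *
  \prod_(s <- I2) Ex P (fun omega => \1_(A s) (X s omega)).
have := @bfunctional_ext _ _ _ _ _
  (bfunctional_comp (mX s) (bfunctional_Ex_weighted P bq))
  (bfunctional_comp (mX s) (bfunctional_Ex_weighted P (bmeas_cst c))) _ (g s) (bg s).
have sI1 : s \notin I1 by move: uI => /= /andP[]; rewrite mem_cat negb_or => /andP[].
have sI2 : s \notin I2 by move: uI => /= /andP[]; rewrite mem_cat negb_or => /andP[].
move=> key.
transitivity (Ex P (fun x => (g s \o X s) x * q x)).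
  by congr Ex; apply/funext => omega; rewrite big_cons /q /= mulrA.
rewrite key.
  rewrite big_cons -mulrA -/c mulrC -ExZ; last exact: (bcomp _ s (bg s)).
  by congr Ex; apply/funext => omega /=; rewrite mulrC.
move=> B mB /=.
pose A' k := if k == s then B else A k.
have mA' k : measurable (A' k) by rewrite /A'; case: ifP.
have uI' : uniq (I1 ++ s :: I2).
  by rewrite -cat1s uniq_catCA.
have AA' k : k \in I2 -> A' k = A k.
  by move=> kI2; rewrite /A'; case: eqP => // ks; rewrite -ks kI2 in sI2.
have A's : A' s = B by rewrite /A' eqxx.
have := ih (s :: I2) A' uI' bg mA'.
rewrite big_cons A's => e1.
transitivity (Ex P (fun omega => \prod_(s0 <- I1) g s0 (X s0 omega) *
         \prod_(s <- (s :: I2)) \1_(A' s) (X s omega))).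
  congr Ex; apply/funext => omega; rewrite big_cons A's /q mulrCA; congr (_ * (_ * _)).
  by apply: eq_big_seq => k kI; rewrite AA'.
rewrite e1 mulrCA.
transitivity (c * Ex P (fun omega => \1_B (X s omega))).
  rewrite mulrC; congr (_ * _ * _); apply: eq_big_seq => k kI; rewrite AA'//.
rewrite -ExZ; last by apply: bcomp; exact: bmeas_indic.
by congr Ex; apply/funext => omega /=; rewrite mulrC.
Qed.

Lemma Ex_prod_indep (I : seq nat) (g : nat -> T -> R) :
  uniq I -> (forall s, bmeas (g s)) ->
  Ex P (fun omega => \prod_(s <- I) g s (X s omega)) =
  \prod_(s <- I) Ex P (fun omega => g s (X s omega)).
Proof.
move=> uI bg.
have := @Ex_prod_cat I [::] g (fun=> setT); rewrite cats0 => /(_ uI bg).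
rewrite big_nil mulr1 => <- //.
by congr Ex; apply/funext => omega; rewrite big_nil mulr1.
Qed.

End independence.

(** * The independent-dyad design *)

Section design.
Context {R : realType} {disp : measure_display} {Omega : measurableType disp}.
Variable P : probability Omega R.
Variables (wstar : R * R -> R) (U V : nat -> {RV P >-> R}).
Variable Y : nat -> {RV P >-> bool}.
Hypothesis hwstar : graphon wstar.
Hypothesis hdesign : independent_dyad_design wstar U V Y.

Notation sq := (unit_square R).
Definition obs (s : nat) (omega : Omega) : R * R * bool :=
  (U s omega, V s omega, Y s omega).

Lemma measurable_unit_square : measurable sq.
Proof. exact: measurableX. Qed.

Lemma lebesgue2_unit_square : lebesgue2 R sq = 1%E.
Proof.
have [sqP UVlaw _ _] := hdesign.
rewrite -[sq]setTI -(UVlaw 0%N)// -[RHS](probability_setT P); congr (P _).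
Qed.

(** The measurable structures carried by R and by the Lebesgue measure on R
    differ only in their display, which is why the instances are rebuilt field
    by field. *)
Lemma bfunctional_square (q : R * R -> R) : bmeas q ->
  bfunctional (fun f : R * R -> R => \int[lebesgue2 R]_(x in sq) (f x * q x)).
Proof.
move=> bq.
have fsq : (lebesgue2 R sq < +oo)%E by rewrite lebesgue2_unit_square ltry.
have h := @bfunctional_int _ _ R (lebesgue2 R) sq.
by case: (h measurable_unit_square fsq _ bq) => ? ? ?; split.
Qed.

Lemma square_integrable (f : R * R -> R) : bmeas f ->
  (lebesgue2 R).-integrable sq (EFin \o f).
Proof.
move=> bf.
have fsq : (lebesgue2 R sq < +oo)%E by rewrite lebesgue2_unit_square ltry.
have h := @bmeas_integrable _ _ R (lebesgue2 R) sq.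
exact (h measurable_unit_square fsq _ bf).
Qed.

Lemma measurable_UV s : measurable_fun setT (fun omega => (U s omega, V s omega)).
Proof. by apply/measurable_fun_pairP; split; exact: measurable_funP. Qed.

Lemma measurable_obs s : measurable_fun setT (obs s).
Proof.
apply/measurable_fun_pairP; split => //=.
exact: measurable_UV.
Qed.

Lemma bernoulli_probE (p : R) b : 0 <= p <= 1 ->
  bernoulli_prob p [set b] = (bernoulli_pmf p b)%:E.
Proof. by move=> p01; rewrite /bernoulli_prob p01 fsbig_set1. Qed.

(** Functions given on the square become globally measurable when they are
    extended by zero. *)
Definition sqext (f : R * R -> R) : R * R -> R := patch (fun=> 0) sq f.

Lemma sqextE f x : sq x -> sqext f x = f x.
Proof. by move=> sx; rewrite /sqext patchE mem_set. Qed.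

Lemma bmeas_sqext (f : R * R -> R) (K : R) : measurable_fun sq f ->
  (forall x, sq x -> `|f x| <= K) -> bmeas (sqext f).
Proof.
move=> mf fK; split.
  exact/(measurable_restrictT _ measurable_unit_square).
exists `|K| => x; rewrite /sqext patchE; case: ifPn => [/set_mem sx|_].
  by rewrite (le_trans (fK x sx))// ler_norm.
by rewrite normr0.
Qed.

Lemma bmeas_graphon w : graphon w -> bmeas (sqext w).
Proof.
move=> [mw w01 _]; apply: (@bmeas_sqext _ 1) => // x /w01/andP[w0 w1].
by rewrite ger0_norm.
Qed.

(** Both sides are bounded functionals of g; on indicators the identity is the
    defining property of the conditional law of Y s. *)
Lemma Ex_UV_Y s b (g : R * R -> R) : bmeas g ->
  Ex P (fun omega => g (U s omega, V s omega) * (Y s omega == b)%:R) =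
  \int[lebesgue2 R]_(x in sq) (g x * bernoulli_pmf (wstar x) b).
Proof.
have [sqP UVlaw Ylaw _] := hdesign.
move=> bg.
have mYb : measurable [set omega | Y s omega = b].
  rewrite -[X in measurable X]setTI.
  by apply: (measurable_funP (Y s) measurableT [set b]).
have bY : bmeas (fun omega => (Y s omega == b)%:R : R).
  have := @bmeas_indic _ _ R _ mYb.
  rewrite (_ : \1__ = (fun omega => (Y s omega == b)%:R))//.
  apply/funext => omega; rewrite indicE; congr (nat_of_bool _)%:R.
  by apply/idP/eqP; rewrite inE.
have bp : bmeas (sqext (fun x => bernoulli_pmf (wstar x) b)).
  apply: (@bmeas_sqext _ 1).
    have [mw _ _] := hwstar.
    rewrite /bernoulli_pmf; case: (b) => //.
    by apply: measurable_funB => //; exact: measurable_cst.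
  case: hwstar => _ w01 _ x /w01 /andP[w0 w1].
  by rewrite /bernoulli_pmf; case: (b); rewrite ger0_norm ?subr_ge0// gerBl.
have b1 := bfunctional_comp (measurable_UV s) (bfunctional_Ex_weighted P bY).
have b2 := bfunctional_square bp.
have := bfunctional_ext b1 b2 _ bg; rewrite /comp => ->.
  by apply: eq_Rintegral => x /set_mem sx; rewrite sqextE.
move=> A mA.
transitivity (fine (P [set omega | A (U s omega, V s omega) /\ [set b] (Y s omega)])).
  rewrite -Ex_indic.
    congr Ex; apply/funext => omega; rewrite !indicE -natrM mulnb.
    congr (nat_of_bool _)%:R; apply/idP/idP.
      by move=> /andP[/set_mem Ao /eqP Yb]; apply/mem_set.
    by move=> /set_mem/= [Ao Yb]; apply/andP; split; [exact/mem_set|exact/eqP].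
  apply: measurableI => //; rewrite -[X in measurable X]setTI.
  exact: measurable_UV.
rewrite Ylaw//; congr fine.
transitivity (\int[lebesgue2 R]_(x in A `&` sq) (bernoulli_pmf (wstar x) b)%:E)%E.
  apply: eq_integral => x /set_mem[_ sx]; rewrite bernoulli_probE//.
  by case: hwstar => _ w01 _; exact: w01.
rewrite setIC integral_mkcondr; apply: eq_integral => x /set_mem sx.
rewrite sqextE// patchE indicE; case: ifPn => _; first by rewrite mul1r.
by rewrite mul0r.
Qed.

(** Splitting along the value of Y s integrates it out: given (U s, V s) = x, it
    is 1 with probability wstar x. *)
Lemma Ex_obs s (g : R * R * bool -> R) : bmeas g ->
  Ex P (fun omega => g (obs s omega)) =
  \int[lebesgue2 R]_(x in sq)
    (wstar x * g (x, true) + (1 - wstar x) * g (x, false)).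
Proof.
move=> bg.
have bgb b : bmeas (fun x : R * R => g (x, b)).
  by apply: (bmeas_comp (X := fun x => (x, b))) bg; exact: measurable_pair2.
have mYb b : measurable [set omega | Y s omega = b].
  rewrite -[X in measurable X]setTI.
  by apply: (measurable_funP (Y s) measurableT [set b]).
have bY b : bmeas (fun omega => (Y s omega == b)%:R : R).
  have := @bmeas_indic _ _ R _ (mYb b).
  rewrite (_ : \1__ = (fun omega => (Y s omega == b)%:R))//.
  apply/funext => omega; rewrite indicE; congr (nat_of_bool _)%:R.
  by apply/idP/eqP; rewrite inE.
transitivity (Ex P (fun omega =>
  g (U s omega, V s omega, true) * (Y s omega == true)%:R +
  g (U s omega, V s omega, false) * (Y s omega == false)%:R)).
  congr Ex; apply/funext => omega; rewrite /obs.
  by case: (Y s omega); rewrite /= mulr1 mulr0 ?addr0 ?add0r.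
have bg' b : bmeas (fun omega => g (U s omega, V s omega, b)).
  exact: (bmeas_comp (measurable_UV s) (bgb b)).
rewrite ExD; try (by apply: bmeasM).
rewrite !(@Ex_UV_Y s _ (fun x => g (x, _)))//.
have bw b : bmeas (sqext (fun x => g (x, b) * bernoulli_pmf (wstar x) b)).
  have [mw w01 _] := hwstar.
  have [mgb [K gK]] := bgb b.
  apply: (@bmeas_sqext _ K).
    apply: measurable_funM; first exact: measurable_funTS.
    rewrite /bernoulli_pmf; case: (b) => //.
    by apply: measurable_funB => //; exact: measurable_cst.
  move=> x /w01 /andP[w0 w1]; rewrite normrM -[leRHS]mulr1 ler_pM//.
  by rewrite /bernoulli_pmf; case: (b); rewrite ger0_norm ?subr_ge0// gerBl.
have wE b : \int[lebesgue2 R]_(x in sq) (g (x, b) * bernoulli_pmf (wstar x) b) =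
   \int[lebesgue2 R]_(x in sq) (sqext (fun x => g (x, b) * bernoulli_pmf (wstar x) b) x).
  by apply: eq_Rintegral => x /set_mem sx; rewrite sqextE.
have iw b : (lebesgue2 R).-integrable sq (EFin \o
    sqext (fun x => g (x, b) * bernoulli_pmf (wstar x) b)).
  exact: square_integrable.
rewrite !wE -RintegralD//; last exact measurable_unit_square.
by apply: eq_Rintegral => x /set_mem sx; rewrite !sqextE//= mulrC [_ * (1 - _)]mulrC.
Qed.

Lemma Ex_UV s (g : R * R -> R) : bmeas g ->
  Ex P (fun omega => g (U s omega, V s omega)) =
  \int[lebesgue2 R]_(x in sq) g x.
Proof.
move=> bg.
have := @Ex_obs s (fun z => g z.1); rewrite /obs /= => ->; last first.
  exact: (bmeas_comp measurable_fst).
by apply: eq_Rintegral => x _; rewrite -mulrDl addrC subrK mul1r.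
Qed.

Lemma mutually_independent_obs : mutually_independent P obs.
Proof. by case: hdesign. Qed.

Lemma Ex_obs_id s (g : R * R * bool -> R) : bmeas g ->
  Ex P (fun omega => g (obs s omega)) = Ex P (fun omega => g (obs 0%N omega)).
Proof. by move=> bg; rewrite !Ex_obs. Qed.

End design.

(** * Sums of independent identically distributed bounded variables *)

Section elementary_bounds.
Context {R : realType}.
Implicit Types x y : R.

(** The derivative has to be bounded only on the symmetric interval spanned by x
    and y, so the bound C may depend on them, as it does in [sin_taylor]. *)
Lemma mvt_norm (f df : R -> R) (C : R) x y :
  (forall z, is_derive z (1 : R) f (df z)) -> (forall z, `|z| <= Num.max `|x| `|y| -> `|df z| <= C) ->
  `|f x - f y| <= C * `|x - y|.
Proof.
move=> fd dfC.
wlog xy : x y dfC / x <= y.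
  move=> h; have [|yx] := leP x y; first exact: h.
  by rewrite distrC [`|x - y|]distrC; apply: h; [rewrite maxC|exact: ltW].
have [c] := @MVT_segment R f df x y xy (fun z _ => fd z)
  (derivable_within_continuous (fun z _ => @ex_derive _ _ _ _ _ _ _ (fd z))).
rewrite in_itv/= => /andP[xc cy] fE.
rewrite distrC [`|x - y|]distrC fE normrM ler_wpM2r// dfC//.
rewrite le_max; have [c0|c0] := leP 0 c.
  by rewrite (ger0_norm c0) (le_trans cy (ler_norm _)) orbT.
have xc' : - c <= - x by rewrite lerN2.
by rewrite (ltr0_norm c0) -(normrN x) (le_trans xc' (ler_norm _)).
Qed.

Lemma sin_norm_le x : `|sin x| <= `|x|.
Proof.
have := @mvt_norm (@sin R) cos 1 x 0; rewrite sin0 !subr0 mul1r; apply.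
by move=> z _; exact: cos_max.
Qed.

Lemma cos_double x : cos x = 1 - 2 * sin (x / 2) ^+ 2.
Proof.
have {1}-> : x = x / 2 + x / 2 by field.
by rewrite cosD -!expr2 cos2sin2; ring.
Qed.

Lemma onem_cos_le x : 0 <= 1 - cos x <= x ^+ 2 / 2.
Proof.
rewrite cos_double; have := sin_norm_le (x / 2).
rewrite -ler_sqr ?nnegrE// !real_normK ?num_real// => h.
have := sqr_ge0 (sin (x / 2)).
by move=> h2; apply/andP; split; lra.
Qed.

Lemma sin_taylor x : `|sin x - x| <= `|x| ^+ 3.
Proof.
have := @mvt_norm (fun z => sin z - z) (fun z => cos z - 1) (`|x| ^+ 2) x 0.
rewrite sin0 subr0 !subr0 -exprSr; apply.
move=> z; rewrite normr0 (max_idPl (normr_ge0 x)) => zx.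
have /andP[c0 c1] := onem_cos_le z.
rewrite distrC ger0_norm// (le_trans c1)//.
have : z ^+ 2 <= `|x| ^+ 2.
  by rewrite -(real_normK (num_real z)) ler_sqr ?nnegrE.
have := sqr_ge0 z; lra.
Qed.

Lemma cos_taylor x : `|cos x - (1 - x ^+ 2 / 2)| <= `|x| ^+ 4.
Proof.
rewrite cos_double.
have -> : 1 - 2 * sin (x / 2) ^+ 2 - (1 - x ^+ 2 / 2) =
  - 2 * ((sin (x / 2) - x / 2) * (sin (x / 2) + x / 2)) by field.
have h1 := sin_taylor (x / 2).
have h2 : `|sin (x / 2) + x / 2| <= `|x|.
  rewrite (le_trans (ler_normD _ _))//.
  have := sin_norm_le (x / 2); rewrite normrM (@ger0_norm _ 2^-1)//; lra.
rewrite !normrM normrN (@ger0_norm _ 2)//.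
apply: (@le_trans _ _ (2 * (`|x / 2| ^+ 3 * `|x|))).
  by rewrite ler_wpM2l// ler_pM.
rewrite normrM (@ger0_norm _ 2^-1)// [_ ^+ 4]exprSr.
set a := `|x|; have a0 : 0 <= a by exact: normr_ge0.
have : 0 <= a ^+ 3 * a by rewrite mulr_ge0// exprn_ge0.
by rewrite exprMn; set t := a ^+ 3; nra.
Qed.

(** Multiply by 1 - x and use (1 - x) exp x <= 1. *)
Lemma expR_quadratic x : x <= 2^-1 -> expR x <= 1 + x + 2 * x ^+ 2.
Proof.
move=> x2; have x1 : 0 < 1 - x by lra.
have := expR_ge1Dx (- x); rewrite expRN => h.
have e0 := expR_gt0 x.
have h' : (1 - x) * expR x <= 1.
  by rewrite -ler_pdivlMr// mul1r.
rewrite -(ler_pM2l x1) (le_trans h')//.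
have : 0 <= x ^+ 2 * (1 - 2 * x) by rewrite mulr_ge0 ?sqr_ge0//; lra.
by rewrite !expr2; nra.
Qed.

End elementary_bounds.

Section iid_sums.
Context {d} {Omega : measurableType d} {R : realType} (P : probability Omega R).
Context {d'} {T : measurableType d'}.
Variable X : nat -> Omega -> T.
Hypothesis mX : forall s, measurable_fun setT (X s).
Hypothesis indX : mutually_independent P X.
Hypothesis idX : forall s (g : T -> R), bmeas g ->
  Ex P (fun omega => g (X s omega)) = Ex P (fun omega => g (X 0%N omega)).

Definition EX (g : T -> R) : R := Ex P (fun omega => g (X 0%N omega)).

Definition Sum (b : T -> R) (m : nat) (omega : Omega) : R :=
  \sum_(s < m) b (X s omega).

Lemma bmeas_X g s : bmeas g -> bmeas (fun omega => g (X s omega) : R).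
Proof. by move=> bg; apply: (bmeas_comp (mX s) bg). Qed.

Lemma bmeas_Sum b m : bmeas b -> bmeas (Sum b m).
Proof. by move=> bb; apply: bmeas_sum => s; exact: bmeas_X. Qed.

Lemma EX_le f g : bmeas f -> bmeas g -> (forall x, f x <= g x) -> EX f <= EX g.
Proof. by move=> bf bg fg; apply: Ex_le => //; exact: bmeas_X. Qed.

Lemma Ex_expR_Sum b m : bmeas b ->
  Ex P (fun omega => expR (Sum b m omega)) = EX (fun x => expR (b x)) ^+ m.
Proof.
move=> bb; have be : bmeas (fun x => expR (b x)).
  by apply: bmeas_comp_cont => //; exact: continuous_expR.
have := Ex_prod_indep mX indX (iota_uniq 0 m) (fun=> be).
rewrite (eq_bigr (fun=> EX (fun x => expR (b x)))); last by move=> s _; exact: idX.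
rewrite big_const_seq count_predT size_iota iter_mulr_1 => <-.
congr Ex; apply/funext => omega.
by rewrite expR_sum -(big_mkord xpredT (fun s => expR (b (X s omega)))) /index_iota subn0.
Qed.

(** Chernoff's method with the exponent l below; exp y <= 1 + y + 2 y^2 bounds
    the moment generating function of a centred variable by exp (2 (l K)^2). *)
Lemma hoeffding b (K delta : R) m : bmeas b -> EX b = 0 -> 0 < delta <= K ->
  (forall x, `|b x| <= K) ->
  fine (P [set omega | m%:R * delta <= Sum b m omega]) <=
  expR (- (delta ^+ 2 / (8 * K ^+ 2))) ^+ m.
Proof.
move=> bb b0 /andP[delta0 deltaK] bK; have K0 := lt_le_trans delta0 deltaK.
(* this l minimises the exponent - l delta + 2 (l K)^2 *)
pose l := delta / (4 * K ^+ 2).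
have l0 : 0 < l by rewrite divr_gt0// mulr_gt0// exprn_gt0.
have lK : l * K <= 4^-1.
  rewrite /l mulrAC ler_pdivrMr ?mulr_gt0 ?exprn_gt0// mulKf//.
  by rewrite expr2 ler_wpM2r// ltW.
have blb : bmeas (fun x => l * b x) by exact: bmeasZ.
have be : bmeas (fun x => expR (l * b x)).
  by apply: (bmeas_comp_cont (h := expR)) => //; exact: continuous_expR.
have mset : measurable [set omega | m%:R * delta <= Sum b m omega].
  have := (bmeas_Sum m bb).1 measurableT `[m%:R * delta, +oo[%classic (measurable_itv _).
  rewrite setTI; congr measurable; apply/seteqP; split => x /=;
    by rewrite in_itv/= andbT.
have E1 : EX (fun x => expR (l * b x)) <= expR (2 * (l * K) ^+ 2).
  apply: (@le_trans _ _ (1 + 2 * (l * K) ^+ 2)); last exact: expR_ge1Dx.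
  have bq : bmeas (fun x => l * b x + (1 + 2 * (l * K) ^+ 2)).
    by apply: bmeasD => //; exact: bmeas_cst.
  apply: (@le_trans _ _ (EX (fun x => l * b x + (1 + 2 * (l * K) ^+ 2)))).
    apply: EX_le => // x.
    have lb : `|l * b x| <= l * K by rewrite normrM (gtr0_norm l0) ler_wpM2l// ltW.
    have lb2 : (l * b x) ^+ 2 <= (l * K) ^+ 2.
      by rewrite -(real_normK (num_real (l * b x))) ler_sqr ?nnegrE// mulr_ge0// ltW.
    have := ler_norm (l * b x) => lb3.
    have := @expR_quadratic R (l * b x) => /(_ ltac:(lra)) h.
    lra.
  rewrite /EX ExD; [|exact: (bmeas_X 0%N blb)|exact: bmeas_cst].
  by rewrite ExZ ?Ex_cst -/(EX b) ?b0 ?mulr0 ?add0r//; exact: bmeas_X.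
rewrite -Ex_indic//.
apply: (@le_trans _ _ (Ex P (fun omega => expR (- (l * (m%:R * delta))) *
                                        expR (Sum (fun x => l * b x) m omega)))).
  apply: Ex_le; first exact: bmeas_indic.
    apply: bmeasZ; apply: (bmeas_comp_cont (h := expR)); first exact: continuous_expR.
    exact: bmeas_Sum.
  move=> omega; rewrite indicE -expRD; case: (boolP (omega \in _)) => [|_]; last exact: expR_ge0.
  move=> /set_mem/= h; have -> : (true%:R : R) = expR 0 by rewrite expR0.
  rewrite ler_expR.
  have -> : Sum (fun x => l * b x) m omega = l * Sum b m omega by rewrite mulr_sumr.
  by rewrite addrC subr_ge0 ler_wpM2l// ltW.
rewrite ExZ; last first.
  by apply: (bmeas_comp_cont (h := expR)); [exact: continuous_expR|exact: bmeas_Sum].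
rewrite Ex_expR_Sum//.
apply: (@le_trans _ _ (expR (- (l * (m%:R * delta))) * expR (2 * (l * K) ^+ 2) ^+ m)).
  by rewrite ler_wpM2l ?expR_ge0// lerXn2r// nnegrE ?expR_ge0//; apply: Ex_ge0 => ?; exact: expR_ge0.
rewrite -!expRM_natl -expRD ler_expR le_eqVlt; apply/orP; left; apply/eqP.
by rewrite /l; field; rewrite gt_eqF.
Qed.

Lemma hoeffding_abs b (delta : R) : bmeas b -> EX b = 0 -> 0 < delta ->
  exists2 q : R, 0 < q < 1 & forall m,
    fine (P [set omega | m%:R * delta <= `|Sum b m omega|]) <= 2 * q ^+ m.
Proof.
move=> bb b0 delta0; have [mb [K0 bK0]] := bb.
pose K := `|K0| + delta.
have dK : 0 < delta <= K by rewrite delta0 /K lerDr normr_ge0.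
have bK x : `|b x| <= K.
  by rewrite (le_trans (bK0 x))// (le_trans (ler_norm _))// lerDl ltW.
have K_gt0 : 0 < K by rewrite ltr_wpDl.
exists (expR (- (delta ^+ 2 / (8 * K ^+ 2)))).
  rewrite expR_gt0/= expR_lt1 oppr_lt0 divr_gt0 ?mulr_gt0 ?exprn_gt0//.
move=> m; have bN := bmeasN bb.
have bN0 : EX (fun x => - b x) = 0.
  rewrite -[RHS](mulr0 (-1)) -b0 /EX -ExZ; last exact: bmeas_X.
  by congr Ex; apply/funext => omega; rewrite mulN1r.
have NbK x : `|- b x| <= K by rewrite normrN.
have h1 := hoeffding m bb b0 dK bK.
have h2 := hoeffding m bN bN0 dK NbK.
have SN omega : Sum (fun x => - b x) m omega = - Sum b m omega by rewrite /Sum sumrN.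
have -> : [set omega | m%:R * delta <= `|Sum b m omega|] =
  [set omega | m%:R * delta <= Sum b m omega] `|`
  [set omega | m%:R * delta <= Sum (fun x => - b x) m omega].
  apply/seteqP; split => omega /=; rewrite SN lerNr.
    by rewrite ler_normr => /orP[]; [left|right; rewrite lerNr].
  by rewrite ler_normr => -[->//|h]; rewrite lerNr h orbT.
have mset (c : T -> R) : bmeas c -> measurable [set omega | m%:R * delta <= Sum c m omega].
  by move=> bc; apply: measurable_le_set; [exact: measurable_cst|exact: (bmeas_Sum m bc).1].
rewrite (le_trans (fine_probabilityU_le P (mset _ bb) (mset _ bN)))//.
by move: h1 h2; lra.
Qed.

(** The off-diagonal terms vanish because independent centred variables are
    uncorrelated. *)
Lemma Ex_SumM b c m : bmeas b -> bmeas c -> EX b = 0 -> EX c = 0 ->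
  Ex P (fun omega => Sum b m omega * Sum c m omega) = m%:R * EX (fun x => b x * c x).
Proof.
move=> bb bc b0 c0.
have bbc s t : bmeas (fun omega => b (X s omega) * c (X t omega)).
  by apply: bmeasM; exact: bmeas_X.
transitivity (\sum_(s < m) \sum_(t < m) Ex P (fun omega => b (X s omega) * c (X t omega))).
  transitivity (Ex P (fun omega => \sum_(s < m) \sum_(t < m) b (X s omega) * c (X t omega))).
    congr Ex; apply/funext => omega; rewrite mulr_suml; apply: eq_bigr => s _.
    by rewrite mulr_sumr.
  rewrite Ex_sum; last by move=> s; apply: bmeas_sum => t.
  by apply: eq_bigr => s _; rewrite Ex_sum.
transitivity (\sum_(s < m) EX (fun x => b x * c x)); last first.
  by rewrite sumr_const card_ord mulr_natl.
apply: eq_bigr => s _; rewrite (bigD1 s)//= big1 ?addr0; last first.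
  move=> t ts.
  pose g k := if k == s :> nat then b else c.
  have bg k : bmeas (g k) by rewrite /g; case: ifP.
  have u : uniq [:: s : nat; t : nat] by rewrite /= inE andbT eq_sym.
  have := Ex_prod_indep mX indX u bg.
  rewrite !big_cons !big_nil /g eqxx.
  have tsF : (t == s :> nat) = false by apply/negbTE.
  rewrite tsF (idX s bb) -/(EX b) b0 mul0r => <-.
  by congr Ex; apply/funext => omega; rewrite !big_cons big_nil mulr1 eqxx tsF.
exact: (idX s (bmeasM bb bc)).
Qed.

(** Real and imaginary parts of (u + i v)^k; characteristic functions are
    handled as pairs of real numbers. *)
Fixpoint cpow (u v : R) (k : nat) : R * R :=
  if k is k'.+1 then
    ((cpow u v k').1 * u - (cpow u v k').2 * v,
     (cpow u v k').2 * u + (cpow u v k').1 * v)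
  else (1, 0).

Lemma bmeas_cos {dd} {TT : measurableType dd} (f : TT -> R) : bmeas f -> bmeas (fun x => cos (f x)).
Proof. by move=> bf; apply: (bmeas_comp_cont (h := cos)) => //; exact: continuous_cos. Qed.

Lemma bmeas_sin {dd} {TT : measurableType dd} (f : TT -> R) : bmeas f -> bmeas (fun x => sin (f x)).
Proof. by move=> bf; apply: (bmeas_comp_cont (h := sin)) => //; exact: continuous_sin. Qed.

(** The extra factors at indices not yet summed make the induction on k
    possible: the addition formulas for cos and sin of Sum b k + b (X k) move
    the last summand into that product. *)
Lemma cf_Sum_prod b k (I : seq nat) (g : nat -> T -> R) : bmeas b ->
  uniq I -> all (fun i => k <= i)%N I -> (forall s, bmeas (g s)) ->
  let z := cpow (EX (fun x => cos (b x))) (EX (fun x => sin (b x))) k in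
  Ex P (fun omega => cos (Sum b k omega) * \prod_(s <- I) g s (X s omega)) =
    z.1 * \prod_(s <- I) EX (g s) /\
  Ex P (fun omega => sin (Sum b k omega) * \prod_(s <- I) g s (X s omega)) =
    z.2 * \prod_(s <- I) EX (g s).
Proof.
move=> bb; elim: k I g => [|k ih] I g uI aI bg /=.
  split.
    rewrite mul1r -(eq_bigr _ (fun s _ => idX s (bg s))) -Ex_prod_indep//.
    by congr Ex; apply/funext => omega; rewrite /Sum big_ord0 cos0 mul1r.
  rewrite mul0r -[RHS](Ex_cst P 0).
  by congr Ex; apply/funext => omega; rewrite /Sum big_ord0 sin0 mul0r.
have bc := bmeas_cos bb; have bs := bmeas_sin bb.
pose gk (h : T -> R) i := if i == k then h else g i.
have bgk h : bmeas h -> forall i, bmeas (gk h i).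
  by move=> bh i; rewrite /gk; case: ifP.
have kI : k \notin I.
  by apply/negP => kI; have := allP aI k kI; rewrite ltnn.
have uI' : uniq (k :: I) by rewrite /= kI.
have aI' : all (fun i => k <= i)%N (k :: I).
  by rewrite /= leqnn/=; apply/allP => i /(allP aI)/ltnW.
have gkI h i : i \in I -> gk h i = g i.
  by move=> iI; rewrite /gk; case: eqP => // ik; rewrite -ik iI in kI.
have gkk h : gk h k = h by rewrite /gk eqxx.
have [c1 s1] := ih _ _ uI' aI' (bgk _ bc).
have [c2 s2] := ih _ _ uI' aI' (bgk _ bs).
have EI h : \prod_(s <- I) EX (gk h s) = \prod_(s <- I) EX (g s).
  by apply: eq_big_seq => i iI; rewrite gkI.
have PI h omega : \prod_(s <- I) gk h s (X s omega) = \prod_(s <- I) g s (X s omega).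
  by apply: eq_big_seq => i iI; rewrite gkI.
have bprod h : bmeas h -> bmeas (fun omega => \prod_(s <- (k :: I)) gk h s (X s omega)).
  by move=> bh; apply: bmeas_prod => i; apply: bmeas_X; exact: bgk.
have SS omega : Sum b k.+1 omega = Sum b k omega + b (X k omega).
  by rewrite /Sum big_ord_recr.
have bS := bmeas_Sum k bb; have bcS := bmeas_cos bS; have bsS := bmeas_sin bS.
rewrite !big_cons !gkk !EI in c1 c2 s1 s2; split.
  transitivity (Ex P (fun omega =>
    cos (Sum b k omega) * \prod_(s <- (k :: I)) gk (fun x => cos (b x)) s (X s omega)
    - sin (Sum b k omega) * \prod_(s <- (k :: I)) gk (fun x => sin (b x)) s (X s omega))).
    congr Ex; apply/funext => omega; rewrite !big_cons !gkk !PI SS cosD; ring.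
  rewrite ExB ?c1 ?s2; [ring| |]; apply: bmeasM => //; exact: bprod.
transitivity (Ex P (fun omega =>
    sin (Sum b k omega) * \prod_(s <- (k :: I)) gk (fun x => cos (b x)) s (X s omega)
    + cos (Sum b k omega) * \prod_(s <- (k :: I)) gk (fun x => sin (b x)) s (X s omega))).
  congr Ex; apply/funext => omega; rewrite !big_cons !gkk !PI SS sinD; ring.
rewrite ExD ?c2 ?s1; [ring| |]; apply: bmeasM => //; exact: bprod.
Qed.

Lemma cf_Sum b k : bmeas b ->
  let z := cpow (EX (fun x => cos (b x))) (EX (fun x => sin (b x))) k in
  Ex P (fun omega => cos (Sum b k omega)) = z.1 /\
  Ex P (fun omega => sin (Sum b k omega)) = z.2.
Proof.
move=> bb; have := @cf_Sum_prod b k [::] (fun=> b) bb isT isT (fun=> bb).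
rewrite /= big_nil !mulr1 => -[<- <-].
by split; congr Ex; apply/funext => omega; rewrite big_nil mulr1.
Qed.

(** The telescoping bound for |z^k - w^k|, where the powers of z stay bounded
    because they are expectations of cosines and sines. *)
Lemma cf_Sum_close b (w : R) k : bmeas b -> 0 <= w <= 1 ->
  `|Ex P (fun omega => cos (Sum b k omega)) - w ^+ k| +
  `|Ex P (fun omega => sin (Sum b k omega))| <=
  k%:R * (`|EX (fun x => cos (b x)) - w| + 2 * `|EX (fun x => sin (b x))|).
Proof.
move=> bb /andP[w0 w1].
set u := EX (fun x => cos (b x)); set v := EX (fun x => sin (b x)).
have uE : `|u| <= 1.
  by apply: Ex_normle => [|x]; [exact: (bmeas_X 0%N (bmeas_cos bb))|exact: cos_max].
have cE : forall k, `|(cpow u v k).1| <= 1 /\ `|(cpow u v k).2| <= 1.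
  move=> j; have [<- <-] := cf_Sum j bb; split; apply: Ex_normle => [|x].
  - exact/bmeas_cos/bmeas_Sum.
  - exact: cos_max.
  - exact/bmeas_sin/bmeas_Sum.
  - exact: sin_max.
have [-> ->] := cf_Sum k bb; rewrite -/u -/v.
elim: k => [|k ih].
  by rewrite /= expr0 subrr normr0 mul0r addr0.
have [cE1 cE2] := cE k; rewrite /=.
move: ih cE1 cE2; set C := (cpow u v k).1; set S := (cpow u v k).2 => ih C1 S1.
have -> : C * u - S * v - w ^+ k.+1 = w * (C - w ^+ k) + (C * (u - w) - S * v).
  by rewrite exprS; ring.
have t1 : `|w * (C - w ^+ k) + (C * (u - w) - S * v)| <= `|C - w ^+ k| + (`|u - w| + `|v|).
  rewrite (le_trans (ler_normD _ _))// lerD//.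
    by rewrite normrM ger0_norm// ler_piMl.
  by rewrite (le_trans (ler_normB _ _))// !normrM lerD// ler_piMl.
have t2 : `|S * u + C * v| <= `|S| + `|v|.
  by rewrite (le_trans (ler_normD _ _))// !normrM lerD// ?ler_piMl// ler_piMr.
rewrite -natr1 mulrDl mul1r; lra.
Qed.

(** At scale 1 / sqrt m the Taylor expansions of cos, sin and exp agree up to an
    error of order m^(-3/2), which [cf_Sum_close] multiplies by m. *)
Lemma cf_clt b : bmeas b -> EX b = 0 ->
  exists C : R, forall m, (0 < m)%N ->
    `|Ex P (fun omega => cos (Sum b m omega / Num.sqrt m%:R)) -
      expR (- (EX (fun x => b x ^+ 2) / 2))| <= C / Num.sqrt m%:R /\
    `|Ex P (fun omega => sin (Sum b m omega / Num.sqrt m%:R))| <= C / Num.sqrt m%:R.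
Proof.
move=> bb b0; have [mb [K0 bK0]] := bb; pose K := `|K0|.
have K0_ge0 : 0 <= K by exact: normr_ge0.
have bK x : `|b x| <= K by rewrite (le_trans (bK0 x))// ler_norm.
have bsq : bmeas (fun x => b x ^+ 2) by exact: bmeasX.
set v := EX _; have v0 : 0 <= v by apply: Ex_ge0 => x; exact: sqr_ge0.
exists (K ^+ 4 + v ^+ 2 / 2 + 2 * K ^+ 3) => m m0.
have m0' : 0 < m%:R :> R by rewrite ltr0n.
pose r := (Num.sqrt (m%:R : R))^-1.
have r0 : 0 < r by rewrite invr_gt0 sqrtr_gt0.
have r2 : m%:R * r ^+ 2 = 1.
  by rewrite /r exprVn sqr_sqrtr ?ler0n// divff// gt_eqF.
have r1 : r <= 1.
  by rewrite invf_le1 ?sqrtr_gt0// -[leLHS]sqrtr1 ler_wsqrtr// ler1n.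
have bbr : bmeas (fun x => b x * r) by apply: bmeasM => //; exact: bmeas_cst.
have brK x : `|b x * r| <= K * r by rewrite normrM (gtr0_norm r0) ler_pM2r.
have SE omega : Sum b m omega / Num.sqrt m%:R = Sum (fun x => b x * r) m omega.
  by rewrite /Sum mulr_suml.
have bX g : bmeas g -> bmeas (fun omega => g (X 0%N omega) : R) by exact: bmeas_X.
have Ebr : EX (fun x => b x * r) = 0.
  have -> : (fun x => b x * r) = (fun x => r * b x) by apply/funext => x; rewrite mulrC.
  rewrite /EX ExZ; last exact: (bX b bb).
  by move: b0; rewrite /EX => ->; rewrite mulr0.
have e1 : `|EX (fun x => cos (b x * r)) - (1 - v * r ^+ 2 / 2)| <= K ^+ 4 * r ^+ 4.
  have -> : 1 - v * r ^+ 2 / 2 = EX (fun x => 1 - r ^+ 2 / 2 * b x ^+ 2).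
    rewrite /EX ExB; [|exact: bmeas_cst|exact: bmeasZ (bX _ bsq)].
    by rewrite Ex_cst ExZ; [rewrite -[Ex P _]/v; ring|exact: (bX _ bsq)].
  rewrite /EX -ExB; [|exact: (bX _ (bmeas_cos bbr))|]; last first.
    apply: (bX (fun x => 1 - r ^+ 2 / 2 * b x ^+ 2)).
    by apply: bmeasB; [exact: bmeas_cst|exact: bmeasZ].
  apply: Ex_normle => [|omega].
    apply: (bX (fun x => cos (b x * r) - (1 - r ^+ 2 / 2 * b x ^+ 2))).
    apply: bmeasB; first exact: bmeas_cos.
    by apply: bmeasB; [exact: bmeas_cst|exact: bmeasZ].
  have -> : r ^+ 2 / 2 * b (X 0%N omega) ^+ 2 = (b (X 0%N omega) * r) ^+ 2 / 2 by ring.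
  rewrite (le_trans (cos_taylor _))// -exprMn lerXn2r// nnegrE//.
  by rewrite mulr_ge0// ltW.
have e2 : `|EX (fun x => sin (b x * r))| <= K ^+ 3 * r ^+ 3.
  rewrite -[EX _]subr0 -Ebr /EX -ExB; [|exact: (bX _ (bmeas_sin bbr))|exact: (bX _ bbr)].
  apply: Ex_normle => [|omega].
    by apply: (bX (fun x => sin (b x * r) - b x * r)); apply: bmeasB => //; exact: bmeas_sin.
  rewrite (le_trans (sin_taylor _))// -exprMn lerXn2r// nnegrE//.
  by rewrite mulr_ge0// ltW.
pose w := expR (- (v * r ^+ 2 / 2)).
have vr0 : 0 <= v * r ^+ 2 / 2 by rewrite divr_ge0// mulr_ge0// exprn_ge0// ltW.
have w01 : 0 <= w <= 1 by rewrite expR_ge0 expR_le1 oppr_le0.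
have e3 : `|(1 - v * r ^+ 2 / 2) - w| <= v ^+ 2 / 2 * r ^+ 4.
  rewrite distrC ger0_norm; last by rewrite subr_ge0; exact: expR_ge1Dx.
  have h : - (v * r ^+ 2 / 2) <= 2^-1 by lra.
  have := expR_quadratic h; rewrite -/w => h'.
  rewrite lerBlDl (le_trans h')// lerD2l le_eqVlt; apply/orP; left; apply/eqP.
  by field.
have wm : w ^+ m = expR (- (v / 2)).
  rewrite -expRM_natl; congr expR.
  have -> : m%:R * - (v * r ^+ 2 / 2) = - ((m%:R * r ^+ 2) * v / 2) by ring.
  by rewrite r2 mul1r.
have := cf_Sum_close m bbr w01; rewrite wm => h.
have tot : m%:R * (`|EX (fun x => cos (b x * r)) - w| + 2 * `|EX (fun x => sin (b x * r))|)
  <= (K ^+ 4 + v ^+ 2 / 2 + 2 * K ^+ 3) * r.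
  have e13 : `|EX (fun x => cos (b x * r)) - w| <= (K ^+ 4 + v ^+ 2 / 2) * r ^+ 4.
    rewrite mulrDl (le_trans _ (lerD e1 e3))//.
    by rewrite (le_trans _ (ler_normD _ _))// addrA subrK.
  apply: (@le_trans _ _ (m%:R * ((K ^+ 4 + v ^+ 2 / 2) * r ^+ 4 + 2 * (K ^+ 3 * r ^+ 3)))).
    by rewrite ler_wpM2l ?ler0n// lerD// ler_wpM2l.
  have -> : m%:R * ((K ^+ 4 + v ^+ 2 / 2) * r ^+ 4 + 2 * (K ^+ 3 * r ^+ 3)) =
     (K ^+ 4 + v ^+ 2 / 2) * ((m%:R * r ^+ 2) * (r * r)) +
     2 * K ^+ 3 * ((m%:R * r ^+ 2) * r) by ring.
  rewrite r2 !mul1r [leRHS]mulrDl lerD2r ler_wpM2l//.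
    by rewrite addr_ge0// ?exprn_ge0// divr_ge0// exprn_ge0.
  by rewrite ler_piMl// ltW.
have -> : Ex P (fun omega => cos (Sum b m omega / Num.sqrt m%:R)) =
          Ex P (fun omega => cos (Sum (fun x => b x * r) m omega)).
  by congr Ex; apply/funext => omega; rewrite SE.
have -> : Ex P (fun omega => sin (Sum b m omega / Num.sqrt m%:R)) =
          Ex P (fun omega => sin (Sum (fun x => b x * r) m omega)).
  by congr Ex; apply/funext => omega; rewrite SE.
rewrite -/r; split; rewrite (le_trans _ tot)// (le_trans _ h)//.
  by rewrite lerDl.
by rewrite lerDr.
Qed.

End iid_sums.

(** * Inner products, trigonometric and Bernstein polynomials *)

Section trigonometric_polynomials.
Context {R : realType} {d : nat}.
Implicit Types (t x : 'cV[R]_d).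

Lemma dotDl t1 t2 x : dot (t1 + t2) x = dot t1 x + dot t2 x.
Proof. by rewrite /dot linearD/= mulmxDl mxE. Qed.

Lemma dotZl (c : R) t x : dot (c *: t) x = c * dot t x.
Proof. by rewrite /dot linearZ/= -scalemxAl mxE. Qed.

Lemma dot0l x : dot 0 x = 0.
Proof. by rewrite /dot trmx0 mul0mx mxE. Qed.

Lemma dotNl t x : dot (- t) x = - dot t x.
Proof. by rewrite -scaleN1r dotZl mulN1r. Qed.

Lemma dotC t x : dot t x = dot x t.
Proof. by rewrite /dot -[in LHS](trmxK x) -trmx_mul mxE. Qed.

Lemma dotDr t x y : dot t (x + y) = dot t x + dot t y.
Proof. by rewrite dotC dotDl !(dotC _ t). Qed.

Lemma dotZr (c : R) t x : dot t (c *: x) = c * dot t x.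
Proof. by rewrite dotC dotZl dotC. Qed.

Lemma dotE t x : dot t x = \sum_i t i 0 * x i 0.
Proof. by rewrite /dot mxE; apply: eq_bigr => i _; rewrite mxE. Qed.

Lemma dot_delta i x : dot (delta_mx i 0) x = x i 0.
Proof.
rewrite dotE (bigD1 i)//= mxE !eqxx mul1r big1 ?addr0// => j ji.
by rewrite mxE (negbTE ji) mul0r.
Qed.

(** The phase th makes the class closed under products and lets it contain the
    sines. *)
Inductive trigpoly : ('cV[R]_d -> R) -> Prop :=
| trigpoly_cos c t th : trigpoly (fun x => c * cos (dot t x + th))
| trigpolyD f g : trigpoly f -> trigpoly g -> trigpoly (fun x => f x + g x).

Lemma trigpoly_cst c : trigpoly (fun=> c).
Proof.
have := trigpoly_cos c 0 0; congr trigpoly; apply/funext => x.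
by rewrite dot0l addr0 cos0 mulr1.
Qed.

Lemma trigpolyZ c f : trigpoly f -> trigpoly (fun x => c * f x).
Proof.
elim => [c' t th|g h _ ig _ ih].
  by under eq_fun do rewrite mulrA; exact: trigpoly_cos.
by under eq_fun do rewrite mulrDr; exact: trigpolyD.
Qed.

Lemma trigpolyM f g : trigpoly f -> trigpoly g -> trigpoly (fun x => f x * g x).
Proof.
move=> + tg; elim => [c t th|f1 f2 _ i1 _ i2]; last first.
  by under eq_fun do rewrite mulrDl; exact: trigpolyD.
elim: tg => [c' t' th'|g1 g2 _ i1 _ i2]; last first.
  by under eq_fun do rewrite mulrDr; exact: trigpolyD.
have := trigpolyD (trigpoly_cos (c * c' / 2) (t + t') (th + th'))
                  (trigpoly_cos (c * c' / 2) (t - t') (th - th')).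
congr trigpoly; apply/funext => x.
rewrite !dotDl dotNl.
have -> : dot t x + dot t' x + (th + th') = (dot t x + th) + (dot t' x + th') by ring.
have -> : dot t x - dot t' x + (th - th') = (dot t x + th) - (dot t' x + th') by ring.
by rewrite cosD cosB; field.
Qed.

Lemma trigpoly_sin (t : 'cV[R]_d) : trigpoly (fun x => sin (dot t x)).
Proof.
have := trigpoly_cos 1 t (- (pi / 2)); congr trigpoly; apply/funext => x.
by rewrite mul1r cosBpihalf.
Qed.

End trigonometric_polynomials.

Section bernstein.
Context {R : realType}.

(** The Bernstein polynomial of g at u, that is, the expectation of g over a
    binomial variable with parameters n and u; the recursion conditions on one
    trial. *)
Fixpoint bern (n : nat) (g : nat -> R) (u : R) : R :=
  if n is n'.+1 then u * bern n' (g \o S) u + (1 - u) * bern n' g u else g 0%N.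

Lemma bern_le n g h u : 0 <= u <= 1 -> (forall k, g k <= h k) ->
  bern n g u <= bern n h u.
Proof.
move=> /andP[u0 u1]; elim: n g h => [|n ih] g h gh /=; first exact: gh.
by rewrite lerD// ler_wpM2l// ?subr_ge0// ih// => k /=.
Qed.

Lemma bern_lin n a g h u :
  bern n (fun k => a * g k + h k) u = a * bern n g u + bern n h u.
Proof.
elim: n g h => [//|n ih] g h /=.
by rewrite [bern n (_ \o S) u](ih (g \o S) (h \o S)) ih; ring.
Qed.

Lemma bern_cst n c u : bern n (fun=> c) u = c.
Proof. elim: n => [//|n /= ih].
by have -> : (fun=> c) \o S = (fun=> c) by []; rewrite ih; ring. Qed.

Lemma bern_sq n c u :
  bern n (fun k => (k%:R - c) ^+ 2) u = (n%:R * u - c) ^+ 2 + n%:R * u * (1 - u).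
Proof.
elim: n c => [|n ih] c /=; first by ring.
have -> : (fun k => (k%:R - c) ^+ 2) \o S = (fun k => (k%:R - (c - 1)) ^+ 2).
  by apply/funext => k /=; rewrite -natr1; ring.
by rewrite !ih -natr1; ring.
Qed.

(** The multivariate version: the entries of the argument of h are independent
    binomial variables with success probabilities us. *)
Fixpoint mbern (n : nat) (us : seq R) (h : seq nat -> R) : R :=
  if us is u :: us' then bern n (fun k => mbern n us' (fun v => h (k :: v))) u
  else h [::].

Lemma mbern_le n us g h : all (fun u => 0 <= u <= 1) us ->
  (forall v, g v <= h v) -> mbern n us g <= mbern n us h.
Proof.
elim: us g h => [|u us ih] g h /=; first by move=> _; exact.
by move=> /andP[u01 us01] gh; apply: bern_le => // k; apply: ih => // v.
Qed.

Lemma mbern_lin n us a g h :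
  mbern n us (fun v => a * g v + h v) = a * mbern n us g + mbern n us h.
Proof.
elim: us g h => [//|u us ih] g h /=.
by rewrite -bern_lin; congr bern; apply/funext => k; rewrite -ih.
Qed.

Lemma mbern_cst n us c : mbern n us (fun=> c) = c.
Proof.
elim: us => [//|u us ih] /=; rewrite -[RHS](bern_cst n c u).
by congr bern; apply/funext => k.
Qed.

(** The total variance of the binomial counts, for Chebyshev's inequality in
    [trig_approx]. *)
Lemma mbern_sq n us :
  mbern n us (fun v => \sum_(j < size us) ((nth 0%N v j)%:R - n%:R * us`_j) ^+ 2) =
  \sum_(j < size us) (n%:R * us`_j * (1 - us`_j)).
Proof.
elim: us => [|u us ih]; first by rewrite /= !big_ord0.
rewrite /= big_ord_recl /= -ih.
have -> : (fun k => mbern n us (fun v => \sum_(j < (size us).+1)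
      ((nth 0%N (k :: v) j)%:R - n%:R * (u :: us)`_j) ^+ 2)) =
  (fun k : nat => 1 * (k%:R - n%:R * u) ^+ 2 + mbern n us (fun v =>
      \sum_(j < size us) ((nth 0%N v j)%:R - n%:R * us`_j) ^+ 2)).
  apply/funext => k; rewrite mul1r -[X in X + _](mbern_cst n us) -[X in X + _]mul1r -mbern_lin.
  by congr mbern; apply/funext => v; rewrite big_ord_recl/= mul1r.
by rewrite bern_lin bern_sq bern_cst subrr expr0n/= add0r mul1r.
Qed.

Lemma trigpoly_bern d n (G : nat -> 'cV[R]_d -> R) (u : 'cV[R]_d -> R) :
  (forall k, trigpoly (G k)) -> trigpoly u ->
  trigpoly (fun x => bern n (G ^~ x) (u x)).
Proof.
move=> tG tu; elim: n G tG => [|n ih] G tG /=; first exact: tG.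
apply: trigpolyD; apply: trigpolyM => //.
- exact: (ih (G \o S) (fun k => tG k.+1)).
- apply: trigpolyD; first exact: trigpoly_cst.
  by have := trigpolyZ (-1) tu; under eq_fun do rewrite mulN1r.
- exact: ih.
Qed.

Lemma trigpoly_mbern d n (us : seq ('cV[R]_d -> R)) h :
  (forall u, List.In u us -> trigpoly u) ->
  trigpoly (fun x => mbern n [seq u x | u <- us] h).
Proof.
elim: us h => [|u us ih] h tu /=; first exact: trigpoly_cst.
apply: (@trigpoly_bern d n (fun k x => mbern n [seq u x | u <- us] (fun v => h (k :: v)))).
  by move=> k; apply: ih => u' u'us; apply: tu; right.
by apply: tu; left.
Qed.

End bernstein.

Section approximation.
Context {R : realType} {d : nat}.

Definition box (L : R) : set 'cV[R]_d := [set x | forall i, `|x i 0| <= L].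

Lemma continuous_trmx m n : continuous (trmx : 'M[R]_(m, n) -> 'M[R]_(n, m)).
Proof.
move=> x A /nbhs_ballP[e /= e0 xA]; apply/nbhs_ballP; exists e => //= y xy.
by apply: xA; split => // i j; rewrite !mxE; exact: xy.2.
Qed.

Lemma compact_box (L : R) : compact (box L).
Proof.
have c : compact [set v : 'rV[R]_d | forall i, `[- L, L]%classic (v ord0 i)].
  by apply: (@rV_compact R d (fun=> `[- L, L]%classic)) => i; exact: segment_compact.
have := continuous_compact (continuous_subspaceT (@continuous_trmx 1 d)) c.
congr compact; apply/seteqP; split => x /=.
  move=> [v vL <-] i; rewrite mxE ler_norml.
  by have := vL i; rewrite /= in_itv.
move=> xL; exists x^T; last exact: trmxK.
by move=> i; rewrite /= mxE in_itv/= -ler_norml.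
Qed.

(** Only x is confined to the box: the nodes of the approximation may fall
    outside. *)
Lemma uniform_continuity_box (f : 'cV[R]_d -> R) (L e : R) : continuous f -> 0 < e ->
  exists2 dl : R, 0 < dl & forall x y : 'cV[R]_d, box L x -> (forall i, `|x i 0 - y i 0| < dl) ->
    `|f x - f y| <= e.
Proof.
move=> cf e0.
have /compact_near_coveringP := compact_box (L := L).
move=> /(_ R (0^'+)%R (fun (dl : R) (x : 'cV[R]_d) =>
  forall y : 'cV[R]_d, (forall i, `|x i 0 - y i 0| < dl) -> `|f x - f y| <= e)).
move=> /(_ _)[].
  move=> x _; have /cvgrPdist_lt/(_ (e / 2)) := cf x.
  rewrite divr_gt0// => /(_ isT)/nbhs_ballP[r /= r0 xr].
  exists (ball x (r / 2), [set dl | 0 < dl < r / 2]) => /=.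
    split; first by apply: nbhsx_ballx; rewrite divr_gt0.
    exists (r / 2) => /=; first by rewrite divr_gt0.
    by move=> z /=; rewrite sub0r normrN => zr z0; rewrite z0 (le_lt_trans (ler_norm z)).
  move=> [x' dl] /= [xx' /andP[dl0 dlr]] y x'y.
  have h1 : ball x r x'.
    by apply: le_ball xx'; rewrite ler_pdivrMr// mulr_natr mulr2n lerDl ltW.
  have h2 : ball x r y.
    rewrite (splitr r); apply: (ball_triangle xx'); split => [|i j]; first by rewrite divr_gt0.
    by rewrite ord1 /ball/= (lt_trans (x'y i)).
  have := xr _ h1; have := xr _ h2; rewrite /= => a1 a2.
  have -> : f x' - f y = (f x - f y) - (f x - f x') by ring.
  by rewrite (le_trans (ler_normB _ _))//; lra.
move=> dl0 /= dlP H.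
exists (dl0 / 2); first by rewrite divr_gt0.
move=> x y xL xy; apply: (H (dl0 / 2)) xL _ xy => /=.
  by rewrite sub0r normrN gtr0_norm ?divr_gt0// ltr_pdivrMr// mulr_natr mulr2n ltrDl.
by rewrite divr_gt0.
Qed.

End approximation.

(** * Uniform approximation by trigonometric polynomials *)

Section trig_approximation.
Context {R : realType}.

Lemma sin1_gt0 : 0 < sin (1 : R).
Proof. by apply: sin2_gt0; rewrite ltr01 ltr1n. Qed.

Lemma cos1_le (c : R) : `|c| <= 1 -> cos 1 <= cos c.
Proof.
move=> c1; rewrite -(cos_norm c); have pi2 := @pi_ge2 R.
move: c1; rewrite le_eqVlt => /predU1P[->//|c1].
rewrite ltW// ltr_cos// in_itv/=; last first.
  by rewrite ler01/= (le_trans _ pi2)// ler1n.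
by rewrite normr_ge0/= (le_trans (ltW c1))// (le_trans _ pi2)// ler1n.
Qed.

(** On [-1, 1] the derivative of sin is at least cos 1. *)
Lemma sin_expand (x y : R) : `|x| <= 1 -> `|y| <= 1 ->
  cos 1 * `|x - y| <= `|sin x - sin y|.
Proof.
wlog xy : x y / x <= y.
  move=> h hx hy; have [|yx] := leP x y; first by move=> /h; exact.
  by rewrite distrC [`|sin x - _|]distrC; apply: h => //; exact: ltW.
rewrite !ler_norml => /andP[x1 x2] /andP[y1 y2].
have [c] := @MVT_segment R sin cos x y xy (fun z _ => is_derive_sin z)
  (continuous_subspaceT (@continuous_sin R)).
rewrite in_itv/= => /andP[xc cy] sE.
rewrite distrC [`|sin x - _|]distrC sE normrM ler_wpM2r//.
rewrite (le_trans _ (ler_norm _))// cos1_le// ler_norml.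
by rewrite (le_trans x1 xc) (le_trans cy y2).
Qed.

Definition clip (s a : R) : R := Num.max (- s) (Num.min s a).

Lemma clip_norm s a : 0 < s -> `|clip s a| <= s.
Proof.
move=> s0; have sN : - s <= s by lra.
rewrite /clip ler_norml le_max lexx/= ge_max sN/=.
by rewrite ge_min lexx.
Qed.

Lemma clip_contract s a b : 0 < s -> `|b| <= s -> `|clip s a - b| <= `|a - b|.
Proof.
move=> s0; rewrite /clip ler_norml => /andP[b1 b2].
have sN : - s <= s by lra.
have [sa|sa] := leP s a.
  by rewrite (max_idPr sN) !ger0_norm; lra.
have [sa2|sa2] := leP (- s) a; first exact: lexx.
by rewrite !ler0_norm; lra.
Qed.

(** The inverse of sin on [-1, 1]; clipping gives a value also to frequencies
    outside the range of sin on [-1, 1]. *)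
Definition sin_node (v : R) : R := asin (clip (sin 1) v).

Lemma sin_nodeK v : sin (sin_node v) = clip (sin 1) v.
Proof.
have := clip_norm v sin1_gt0; rewrite /sin_node => h.
by rewrite asinK// in_itv/= -ler_norml (le_trans h)// sin_le1.
Qed.

Lemma sin_node_norm v : `|sin_node v| <= 1.
Proof.
have cn := clip_norm v sin1_gt0.
have c11 : -1 <= clip (sin 1) v <= 1 by rewrite -ler_norml (le_trans cn)// sin_le1.
have h1 := asin_geNpi2 c11; have h2 := asin_lepi2 c11.
have p1 := @pihalf_ge1 R.
move: cn; rewrite -sin_nodeK !ler_norml => /andP[n1 n2].
rewrite -/(sin_node v) in h1 h2.
apply/andP; split; rewrite leNgt; apply/negP => h.
  have : sin (sin_node v) < sin (- 1).
    by rewrite ltr_sin// in_itv/=; apply/andP; split; lra.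
  by rewrite sinN ltNge n1.
have : sin 1 < sin (sin_node v).
  by rewrite ltr_sin// in_itv/=; apply/andP; split; lra.
by rewrite ltNge n2.
Qed.

Lemma sin_node_close v x : `|x| <= 1 ->
  cos 1 * `|sin_node v - x| <= `|v - sin x|.
Proof.
move=> x1; apply: (le_trans (sin_expand (sin_node_norm v) x1)).
rewrite sin_nodeK clip_contract//; first exact: sin1_gt0.
have sN1 : - sin 1 = sin (- 1) :> R by rewrite sinN.
have p1 := @pihalf_ge1 R.
move: x1; rewrite !ler_norml sN1 => /andP[x1 x2].
have mono (a b : R) : -1 <= a -> b <= 1 -> a <= b -> sin a <= sin b.
  move=> a1 b1; rewrite le_eqVlt => /predU1P[->//|ab].
  by rewrite ltW// ltr_sin// in_itv/=; apply/andP; split; lra.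
by rewrite !mono//; lra.
Qed.

(** The Bernstein polynomial of f o node in the variables u_i = (1 + sin (x_i /
    L)) / 2 is a trigonometric polynomial in x, where node inverts u. Being an
    average of values of f it keeps the bound K on the whole space, and on the
    box it is close to f because the binomial frequencies concentrate around the
    u_i. *)
Lemma trig_approx d (f : 'cV[R]_d -> R) (K L e : R) : continuous f ->
  (forall x, `|f x| <= K) -> 0 < L -> 0 < e ->
  exists T : 'cV[R]_d -> R, [/\ trigpoly T, forall x, `|T x| <= K &
    forall x, box L x -> `|T x - f x| <= e].
Proof.
move=> cf fK L0 e0.
have K0 : 0 <= K by rewrite (le_trans _ (fK 0)).
have e20 : 0 < e / 2 by rewrite divr_gt0.
have [dl dl0 dlP] := uniform_continuity_box L cf e20.
have c0 := @cos1_gt0 R.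
(* frequencies within eta of u give nodes within dl of x, as sin expands by cos 1 *)
pose eta := cos 1 * dl / (2 * L).
have eta0 : 0 < eta by rewrite divr_gt0 ?mulr_gt0.
(* this n makes the Chebyshev term at most e / 2 *)
pose n := (Num.trunc (2 * K * d%:R / eta ^+ 2 / (e / 2))).+1.
have n0 : 0 < n%:R :> R by rewrite ltr0n.
have nP : 2 * K * d%:R / eta ^+ 2 / n%:R <= e / 2.
  by rewrite ler_pdivrMr// [e / 2 * _]mulrC -ler_pdivrMr//; exact/ltW/truncnS_gt.
pose uf (i : 'I_d) (x : 'cV[R]_d) := (1 + sin (dot (L^-1 *: delta_mx i 0) x)) / 2.
have ufE i x : uf i x = (1 + sin (x i 0 / L)) / 2.
  by rewrite /uf dotZl dot_delta [L^-1 * _]mulrC.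
pose us := [seq uf i | i <- enum 'I_d].
pose node (v : seq nat) : 'cV[R]_d :=
  \col_i (L * sin_node (2 * ((nth 0%N v i)%:R / n%:R) - 1)).
pose T x := mbern n [seq u x | u <- us] (fun v => f (node v)).
have us01 x : all (fun u => 0 <= u <= 1) [seq u x | u <- us].
  apply/allP => u /mapP[g /mapP[i _ ->] ->]; rewrite ufE.
  have h1 := sin_geN1 (x i 0 / L); have h2 := sin_le1 (x i 0 / L).
  by apply/andP; split; lra.
exists T; split.
- apply: trigpoly_mbern => u.
  have uus : forall (l : seq 'I_d), List.In u [seq uf i | i <- l] -> exists i, u = uf i.
    by elim=> [//|i l ih] /= [<-|/ih//]; exists i.
  move=> /uus[i ->]; rewrite /uf.
  have := trigpolyZ 2^-1 (trigpolyD (trigpoly_cst 1) (trigpoly_sin (L^-1 *: delta_mx i 0))).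
  by congr trigpoly; apply/funext => x; rewrite mulrC.
- move=> x; rewrite ler_norml; apply/andP; split.
    rewrite -(mbern_cst n [seq u x | u <- us] (- K)); apply: mbern_le => // v.
    by have := fK (node v); rewrite ler_norml => /andP[].
  rewrite -[leRHS](mbern_cst n [seq u x | u <- us] K); apply: mbern_le => // v.
  by have := fK (node v); rewrite ler_norml => /andP[].
- move=> x xL; set ux := [seq u x | u <- us].
  have szE : size ux = d by rewrite /ux /us 2!size_map size_enum_ord.
  have uxE (i : 'I_d) : ux`_i = uf i x.
    rewrite /ux /us -map_comp (nth_map i) ?size_enum_ord//=.
    by rewrite nth_ord_enum.
  pose Q v := \sum_(j < size ux) ((nth 0%N v j)%:R - n%:R * ux`_j) ^+ 2.
  pose C := 2 * K / (eta ^+ 2 * n%:R ^+ 2).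
  have C0 : 0 <= C.
    by apply: divr_ge0; apply: mulr_ge0 => //; apply: exprn_ge0; exact: ltW.
  (* uniform continuity at near nodes; at far ones C * Q v exceeds 2 K *)
  have pw v : `|f (node v) - f x| <= e / 2 + C * Q v.
    have Q0 : 0 <= Q v by apply: sumr_ge0 => j _; exact: sqr_ge0.
    have [close|] := pselect (forall i : 'I_d, `|(nth 0%N v i)%:R / n%:R - uf i x| < eta).
      rewrite distrC (le_trans (dlP _ _ xL _))//; last by rewrite lerDl mulr_ge0.
      move=> i; rewrite mxE distrC.
      have -> : L * sin_node (2 * ((nth 0%N v i)%:R / n%:R) - 1) - x i 0 =
        L * (sin_node (2 * ((nth 0%N v i)%:R / n%:R) - 1) - x i 0 / L).
        by field; rewrite gt_eqF.
      rewrite normrM (gtr0_norm L0).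
      have xi1 : `|x i 0 / L| <= 1.
        by rewrite normrM normfV (gtr0_norm L0) ler_pdivrMr// mul1r; exact: xL.
      have h1 := sin_node_close (2 * ((nth 0%N v i)%:R / n%:R) - 1) xi1.
      have -> : (dl : R) = L * (dl / L) by field; rewrite gt_eqF.
      rewrite ltr_pM2l// -(ltr_pM2l c0) (le_lt_trans h1)//.
      have -> : 2 * ((nth 0%N v i)%:R / n%:R) - 1 - sin (x i 0 / L) =
        2 * ((nth 0%N v i)%:R / n%:R - uf i x) by rewrite ufE; field; rewrite gt_eqF.
      rewrite normrM gtr0_norm//.
      have -> : cos 1 * (dl / L) = 2 * eta by rewrite /eta; field; rewrite gt_eqF.
      by rewrite ltr_pM2l.
    move=> /existsNP[i /negP]; rewrite -leNgt => far.
    have Qi : (n%:R * eta) ^+ 2 <= Q v.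
      have i' : (i < size ux)%N by rewrite szE.
      rewrite /Q (bigD1 (Ordinal i'))//= ler_wpDr//; first by apply: sumr_ge0 => j _; exact: sqr_ge0.
      rewrite uxE -(real_normK (num_real (_ - _))) ler_sqr ?nnegrE//; last first.
        by rewrite mulr_ge0// ltW.
      have -> : (nth 0%N v i)%:R - n%:R * uf i x = n%:R * ((nth 0%N v i)%:R / n%:R - uf i x).
        by field; rewrite gt_eqF.
      by rewrite normrM (gtr0_norm n0) ler_pM2l.
    apply: (@le_trans _ _ (2 * K)).
      by rewrite (le_trans (ler_normB _ _))// mulr_natl mulr2n lerD.
    have : C * (n%:R * eta) ^+ 2 <= C * Q v by rewrite ler_wpM2l.
    have -> : C * (n%:R * eta) ^+ 2 = 2 * K by rewrite /C; field; rewrite !gt_eqF.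
    lra.
  have Tf : `|T x - f x| <= mbern n ux (fun v => C * Q v + e / 2).
    rewrite ler_norml; apply/andP; split.
      rewrite lerNl opprB lerBlDr -[leLHS](mbern_cst n ux).
      rewrite -[X in _ + X]mul1r addrC -[T x]/(mbern n ux (fun v => f (node v))).
      rewrite mulrC mulr1 -[X in X + _]mul1r -mbern_lin.
      apply: mbern_le; first exact: us01.
      by move=> v; have := pw v; rewrite ler_norml => /andP[]; lra.
    rewrite lerBlDr -[X in _ + X](mbern_cst n ux) -[X in X + _]mul1r -mbern_lin.
    apply: mbern_le; first exact: us01.
    by move=> v; have := pw v; rewrite ler_norml => /andP[]; lra.
  rewrite (le_trans Tf)// mbern_lin mbern_cst /Q mbern_sq.
  have S1 : \sum_(j < size ux) (n%:R * ux`_j * (1 - ux`_j)) <= d%:R * n%:R.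
    apply: (@le_trans _ _ (\sum_(j < size ux) n%:R)); last first.
      by rewrite sumr_const card_ord szE mulr_natl.
    apply: ler_sum => j _.
    have /andP[a1 a2] := allP (us01 x) _ (mem_nth 0 (ltn_ord j)).
    rewrite -mulrA ler_piMr ?ler0n// mulr_ile1//; lra.
  have : C * \sum_(j < size ux) (n%:R * ux`_j * (1 - ux`_j)) <= C * (d%:R * n%:R).
    by rewrite ler_wpM2l.
  have -> : C * (d%:R * n%:R) = 2 * K * d%:R / eta ^+ 2 / n%:R.
    by rewrite /C; field; rewrite !gt_eqF.
  lra.
Qed.

End trig_approximation.

Section borel_cV.
Context {R : realType} {d : nat}.

Lemma continuous_measurable_cV (f : 'cV[R]_d -> R) : continuous f ->
  measurable_fun setT (f : @borel_cV R d -> R).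
Proof.
move=> cf; apply: (measurability _ (RGenOpens.measurableE R)).
move=> _ [_ [a [b ->] <-]]; rewrite setTI; apply: sub_sigma_algebra.
by apply: open_comp; [move=> x _; exact: cf|exact: interval_open].
Qed.

Lemma continuous_sumr (T : topologicalType) (I : Type) (r : seq I) (F : I -> T -> R) :
  (forall i, continuous (F i)) -> continuous (fun x => \sum_(i <- r) F i x).
Proof.
move=> cF; elim: r => [|i r ih].
  by under eq_fun do rewrite big_nil; move=> x; exact: cvg_cst.
under eq_fun do rewrite big_cons.
by move=> x; apply: cvgD; [exact: cF|exact: ih].
Qed.

Lemma continuous_dot (t : 'cV[R]_d) : continuous (dot t).
Proof.
have -> : dot t = (fun x : 'cV[R]_d => \sum_i t i 0 * x i 0).
  by apply/funext => x; exact: dotE.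
apply: continuous_sumr => i x.
exact: (cvgM (f := cst _) (g := fun M : 'cV[R]_d => M i 0) (cvg_cst _) (@coord_continuous _ _ _ _ _ x)).
Qed.

(** An open set is a countable union of cubes with rational centres, and the
    preimage of a cube is determined by the coordinates. *)
Lemma measurable_cV dO (Omega : measurableType dO) (X : Omega -> 'cV[R]_d) :
  (forall i, measurable_fun setT (fun omega => X omega i 0)) ->
  measurable_fun setT (X : Omega -> @borel_cV R d).
Proof.
move=> mX; apply: (@measurability _ _ _ (@borel_cV R d) setT X (@open _)) => //.
move=> _ [B openB <-]; rewrite setTI.
pose rb (q : 'cV[rat]_d * nat) : set 'cV[R]_d :=
  [set x | forall i, `|x i 0 - ratr (q.1 i 0)| < q.2.+1%:R^-1].
have -> : X @^-1` B = \bigcup_(q : 'cV[rat]_d * nat)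
    (if `[< rb q `<=` B >] then X @^-1` (rb q) else set0).
  apply/seteqP; split => omega /=; last first.
    by move=> [q _]; case: asboolP => // rbO; exact: rbO.
  move=> OX; have /nbhs_ballP[r /= r0 rO] := open_nbhs_nbhs (conj openB OX).
  pose n := Num.trunc (2 / r).
  have nr : n.+1%:R^-1 < r / 2.
    rewrite -[ltRHS]invrK ltf_pV2 ?posrE ?invr_gt0 ?divr_gt0//.
    by rewrite invf_div truncnS_gt.
  have n0 : 0 < n.+1%:R^-1 :> R by rewrite invr_gt0.
  have ex i : exists q : rat, `|X omega i 0 - ratr q| < n.+1%:R^-1.
    have [|q] := @rat_in_itvoo R (X omega i 0 - n.+1%:R^-1) (X omega i 0 + n.+1%:R^-1).
      by rewrite ltrD2l gtrN.
    rewrite in_itv/= => /andP[q1 q2]; exists q; rewrite ltr_norml.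
    by move: q1 q2; set a := _^-1; set b := ratr q => q1 q2; apply/andP; split; lra.
  have [q qP] := choice ex.
  exists (\col_i q i, n) => //=; case: asboolP => [_|]; first by move=> i /=; rewrite mxE.
  case=> y yrb; apply: rO; split => // i j; rewrite ord1 /ball/=.
  have := yrb i; have := qP i; rewrite /= mxE => a1 a2.
  have -> : X omega i 0 - y i 0 = (X omega i 0 - ratr (q i)) - (y i 0 - ratr (q i)) by ring.
  rewrite (le_lt_trans (ler_normB _ _))//.
  by move: nr a1 a2; set h := _^-1; set b := `|_|; set c := `|_|; lra.
apply: countable_bigcupT_measurable => [|q]; first exact: countableP.
case: asboolP => // _.
have -> : X @^-1` rb q = \bigcap_(i in [set: 'I_d])
    ((fun omega => X omega i 0) @^-1` (ball (ratr (q.1 i 0) : R) q.2.+1%:R^-1)).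
  apply/seteqP; split => omega /=.
    by move=> h i _; rewrite /ball/= distrC; exact: h.
  by move=> h i; rewrite distrC; exact: h.
apply: fin_bigcap_measurable => // i _; rewrite -[X in measurable X]setTI.
by apply: mX => //; exact: measurable_ball.
Qed.

Lemma measurable_coord dO (Omega : measurableType dO) (X : Omega -> 'cV[R]_d) i :
  measurable_fun setT (X : Omega -> @borel_cV R d) ->
  measurable_fun setT (fun omega => X omega i 0).
Proof.
move=> mX; apply: (measurableT_comp (f := fun x : @borel_cV R d => (x : 'cV[R]_d) i 0)) => //.
by apply: continuous_measurable_cV; exact: coord_continuous.
Qed.

Lemma bmeas_cV (f : 'cV[R]_d -> R) : continuous f ->
  (exists K, forall x, `|f x| <= K) -> bmeas (f : @borel_cV R d -> R).
Proof. by move=> cf fK; split => //; exact: continuous_measurable_cV. Qed.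

Lemma bmeas_cos_dot (t : 'cV[R]_d) : bmeas (fun x : @borel_cV R d => cos (dot t x)).
Proof.
apply: bmeas_cV; last by exists 1 => x; exact: cos_max.
by move=> x; exact: (continuous_comp (@continuous_dot t x) (@continuous_cos R _)).
Qed.

Lemma bmeas_sin_dot (t : 'cV[R]_d) : bmeas (fun x : @borel_cV R d => sin (dot t x)).
Proof.
apply: bmeas_cV; last by exists 1 => x; exact: sin_max.
by move=> x; exact: (continuous_comp (@continuous_dot t x) (@continuous_sin R _)).
Qed.

End borel_cV.

(** * Levy's continuity theorem *)

Section levy.
Context {R : realType} {d : nat}.

Lemma trigpoly_continuous (T : 'cV[R]_d -> R) : trigpoly T -> continuous T.
Proof.
elim => [c t th x|f g _ cf _ cg x]; last exact: (cvgD (cf x) (cg x)).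
have cth : continuous (fun x : 'cV[R]_d => dot t x + th).
  by move=> y; exact: (cvgD (@continuous_dot _ _ t y) (cvg_cst th)).
have ccos : continuous (fun x : 'cV[R]_d => cos (dot t x + th)).
  by move=> y; exact: (continuous_comp (cth y) (@continuous_cos R _)).
exact: (cvgM (cvg_cst c) (ccos x)).
Qed.

Lemma trigpoly_bounded (T : 'cV[R]_d -> R) : trigpoly T ->
  exists K, forall x, `|T x| <= K.
Proof.
elim => [c t th|f g _ [K fK] _ [L gL]].
  by exists `|c| => x; rewrite normrM ler_piMr// cos_max.
by exists (K + L) => x; rewrite (le_trans (ler_normD _ _))// lerD.
Qed.

Lemma continuous_coord_norm (i : 'I_d) : continuous (fun x : 'cV[R]_d => `|x i 0|).
Proof. by move=> x; exact: (cvg_norm (@coord_continuous _ _ _ i 0 x)). Qed.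

Lemma measurable_box (L : R) : measurable (box L : set (@borel_cV R d)).
Proof.
rewrite (_ : box L = \bigcap_(i in [set: 'I_d])
    ((fun x : @borel_cV R d => `|(x : 'cV[R]_d) i 0|) @^-1` `]-oo, L])); last first.
  apply/seteqP; split => x /= h i; first by move=> _; rewrite /= in_itv/=; exact: h.
  by have := h i Logic.I; rewrite /= in_itv.
apply: fin_bigcap_measurable => // i _; rewrite -[X in measurable X]setTI.
exact: (continuous_measurable_cV (@continuous_coord_norm i)).
Qed.

Lemma box_tight (N : probability (@borel_cV R d) R) (e : R) : 0 < e ->
  exists2 L : R, 0 < L & fine (N (~` box L)) <= e.
Proof.
move=> e0.
have mB n : measurable (~` box n.+1%:R : set (@borel_cV R d)).
  by apply: measurableC; exact: measurable_box.
have cap0 : \bigcap_n (~` box n.+1%:R : set (@borel_cV R d)) = set0.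
  apply/seteqP; split => // x /= h.
  pose M := \sum_i `|x i 0|.
  have := h (Num.trunc M) Logic.I; apply => i /=.
  apply: (@le_trans _ _ M); last exact/ltW/truncnS_gt.
  by rewrite /M (bigD1 i)//= lerDl; apply: sumr_ge0.
have h1 : (N (~` box (0%N.+1%:R)) < +oo)%E.
  exact: (le_lt_trans (probability_le1 _ (mB 0%N)) (ltry _)).
have mc : measurable (\bigcap_n (~` box n.+1%:R : set (@borel_cV R d))).
  by rewrite cap0.
have ni : nonincreasing_seq (fun n => ~` box n.+1%:R : set (@borel_cV R d)).
  apply/nonincreasing_seqP => n; rewrite subsetEset; apply: subsetC => x xn i.
  by rewrite (le_trans (xn i))// ler_nat.
have := nonincreasing_cvg_mu h1 mB mc ni; rewrite cap0 measure0.
move/fine_cvgP => [_ /cvgrPdist_le/(_ _ e0)[n _ /(_ n (leqnn n))]].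
rewrite /= sub0r normrN => h; exists n.+1%:R; first by rewrite ltr0n.
by rewrite (le_trans (ler_norm _) h).
Qed.

(** The functions are close on the box and bounded by K off it. *)
Lemma Ex_close_box dO (Omega : measurableType dO) (Q : probability Omega R)
    (Z : Omega -> 'cV[R]_d) (f T : 'cV[R]_d -> R) (K L e : R) :
  measurable_fun setT (Z : Omega -> @borel_cV R d) -> continuous f -> continuous T ->
  (forall x, `|f x| <= K) -> (forall x, `|T x| <= K) ->
  0 <= e -> (forall x, box L x -> `|T x - f x| <= e) ->
  `|Ex Q (fun x => f (Z x)) - Ex Q (fun x => T (Z x))| <=
    e + 2 * K * fine (Q [set x | ~ box L (Z x)]).
Proof.
move=> mZ cf cT fK TK e0 Tf.
have bZ g : continuous g -> (forall x, `|g x| <= K) -> bmeas (fun x => g (Z x)).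
  move=> cg gK; apply: (bmeas_comp mZ (f := g : @borel_cV R d -> R)).
  by apply: bmeas_cV => //; exists K.
have mB : measurable [set x | ~ box L (Z x)].
  rewrite -[X in measurable X]setTI.
  by apply: (mZ measurableT (~` box L)); apply: measurableC; exact: measurable_box.
have bi : bmeas (\1_[set x | ~ box L (Z x)] : Omega -> R) by exact: bmeas_indic.
have [bf bT] := (bZ _ cf fK, bZ _ cT TK).
rewrite -ExB// (le_trans (Ex_norm _ (bmeasB bf bT)))// -(Ex_indic Q mB).
rewrite -[in leRHS](Ex_cst Q e) -ExZ// -ExD; [|exact: bmeas_cst|exact: bmeasZ].
apply: Ex_le; first exact/bmeas_norm/bmeasB.
  by apply: bmeasD; [exact: bmeas_cst|exact: bmeasZ].
move=> x; rewrite indicE; case: (boolP (x \in _)) => [_|nb] /=.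
  rewrite mulr1 (le_trans (ler_normB _ _))//.
  by have := fK (Z x); have := TK (Z x); lra.
rewrite mulr0 addr0 distrC; apply: Tf; apply: contrapT => h.
by move/negP: nb; apply; exact/mem_set.
Qed.

Context {dO : measure_display} {Omega : measurableType dO}.
Variable P : probability Omega R.

Lemma Ex_trigpoly_cvg (X : nat -> Omega -> 'cV[R]_d) (N : probability (@borel_cV R d) R) T :
  (forall m, measurable_fun setT (X m : Omega -> @borel_cV R d)) ->
  (forall t, Ex P (fun omega => cos (dot t (X m omega))) @[m --> \oo] -->
             Ex N (fun x => cos (dot t x))) ->
  (forall t, Ex P (fun omega => sin (dot t (X m omega))) @[m --> \oo] -->
             Ex N (fun x => sin (dot t x))) ->
  trigpoly T ->
  Ex P (fun omega => T (X m omega)) @[m --> \oo] --> Ex N T.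
Proof.
move=> mX hc hs.
have bT f : trigpoly f -> bmeas (f : @borel_cV R d -> R).
  by move=> tf; apply: bmeas_cV; [exact: trigpoly_continuous|exact: trigpoly_bounded].
have bTX f m : trigpoly f -> bmeas (fun omega => f (X m omega)).
  by move=> tf; exact: (bmeas_comp (mX m) (bT f tf)).
have tc t : trigpoly (fun x : 'cV[R]_d => cos (dot t x)).
  have := trigpoly_cos 1 t 0; congr trigpoly; apply/funext => x.
  by rewrite mul1r addr0.
have ts (t : 'cV[R]_d) := trigpoly_sin t.
elim => [c t th|f g tf cf tg cg]; last first.
  under eq_fun do rewrite (ExD P (bTX _ _ tf) (bTX _ _ tg)).
  by rewrite (ExD N (bT _ tf) (bT _ tg)); exact: cvgD.
have E : (fun x : 'cV[R]_d => c * cos (dot t x + th)) =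
  (fun x => (c * cos th) * cos (dot t x) + (- (c * sin th)) * sin (dot t x)).
  by apply/funext => x; rewrite cosD; ring.
have EN : Ex N (fun x => c * cos (dot t x + th)) =
  (c * cos th) * Ex N (fun x => cos (dot t x)) + (- (c * sin th)) * Ex N (fun x => sin (dot t x)).
  rewrite E ExD ?ExZ//; try exact: bT.
  - by apply: bmeasZ; exact: (bT _ (tc t)).
  - by apply: bmeasZ; exact: (bT _ (ts t)).
have EP m : Ex P (fun omega => c * cos (dot t (X m omega) + th)) =
  (c * cos th) * Ex P (fun omega => cos (dot t (X m omega))) +
  (- (c * sin th)) * Ex P (fun omega => sin (dot t (X m omega))).
  rewrite -(ExZ _ _ (bTX _ m (tc t))) -(ExZ _ _ (bTX _ m (ts t))) -ExD.
  - by congr Ex; apply/funext => omega; exact: (congr1 (fun h => h (X m omega)) E).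
  - by apply: bmeasZ; exact: (bTX _ m (tc t)).
  - by apply: bmeasZ; exact: (bTX _ m (ts t)).
under eq_fun do rewrite EP; rewrite EN.
apply: cvgD; apply: cvgM; [exact: cvg_cst|exact: hc|exact: cvg_cst|exact: hs].
Qed.

(** On a large box f is close to a trigonometric polynomial T with the same
    bound; Ex P (T (X m)) converges because T is a combination of cosines and
    sines, and tightness controls what happens off the box. *)
Theorem levy (X : nat -> Omega -> 'cV[R]_d) (N : probability (@borel_cV R d) R) :
  (forall m, measurable_fun setT (X m : Omega -> @borel_cV R d)) ->
  (forall t, Ex P (fun omega => cos (dot t (X m omega))) @[m --> \oo] -->
             Ex N (fun x => cos (dot t x))) ->
  (forall t, Ex P (fun omega => sin (dot t (X m omega))) @[m --> \oo] -->
             Ex N (fun x => sin (dot t x))) ->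
  (forall e : R, 0 < e -> exists L : R,
     \forall m \near \oo, fine (P [set omega | ~ box L (X m omega)]) <= e) ->
  forall f : 'cV[R]_d -> R, continuous f -> (exists K, forall x, `|f x| <= K) ->
    Ex P (fun omega => f (X m omega)) @[m --> \oo] --> Ex N f.
Proof.
move=> mX hc hs tight f cf [K0 fK0].
pose K := `|K0| + 1; have K_gt0 : 0 < K by rewrite ltr_wpDl.
have fK x : `|f x| <= K.
  by rewrite (le_trans (fK0 x))// (le_trans (ler_norm _))// lerDl.
apply/cvgrPdist_le => e e0.
pose e1 := e / (3 + 4 * K).
have D0 : 0 < 3 + 4 * K by rewrite addr_gt0// mulr_gt0.
have e10 : 0 < e1 by rewrite divr_gt0.
have [L1 L1P] := tight _ e10; have [L2 L20 L2P] := box_tight N e10.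
pose L := `|L1| + L2.
have L_gt0 : 0 < L by rewrite ltr_wpDl.
have boxL1 x : box L1 x -> box L (x : 'cV[R]_d).
  move=> h i; rewrite (le_trans (h i))// (le_trans (ler_norm _))// lerDl ltW//.
have boxL2 x : box L2 x -> box L (x : 'cV[R]_d).
  by move=> h i; rewrite (le_trans (h i))// lerDr.
have [T [tT TK Tf]] := trig_approx cf fK L_gt0 e10.
have cT := trigpoly_continuous tT.
have eN := Ex_close_box N (@measurable_id _ (@borel_cV R d) setT) cf cT fK TK (ltW e10) Tf.
have eP m := Ex_close_box P (mX m) cf cT fK TK (ltW e10) Tf.
have mB L' : measurable (~` box L' : set (@borel_cV R d)).
  by apply: measurableC; exact: measurable_box.
have tN : fine (N (~` box L)) <= e1.
  by rewrite (le_trans _ L2P)//; apply: fine_probability_le => // x; exact: contra_not (@boxL2 x).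
have mP m L' : measurable [set omega | ~ box L' (X m omega)].
  by rewrite -[X in measurable X]setTI; exact: (mX m measurableT _ (mB L')).
have tP m : fine (P [set omega | ~ box L (X m omega)]) <=
    fine (P [set omega | ~ box L1 (X m omega)]).
  by apply: fine_probability_le => // omega; exact: contra_not (@boxL1 _).
have /cvgrPdist_le/(_ _ e10) limT := Ex_trigpoly_cvg mX hc hs tT.
near=> m.
have h1 : `|Ex N T - Ex P (fun omega => T (X m omega))| <= e1 by near: m.
have h2 : fine (P [set omega | ~ box L1 (X m omega)]) <= e1 by near: m.
have K20 : 0 <= 2 * K by rewrite mulr_ge0// ltW.
have h3 : 2 * K * fine (P [set omega | ~ box L (X m omega)]) <= 2 * K * e1.
  by rewrite ler_wpM2l// (le_trans (tP m)).
have h4 : 2 * K * fine (N (~` box L)) <= 2 * K * e1 by rewrite ler_wpM2l.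
have -> : e = e1 * (3 + 4 * K) by rewrite /e1 divfK ?gt_eqF.
set EPf := Ex P (fun omega => f (X m omega)); set EPT := Ex P (fun omega => T (X m omega)).
have -> : Ex N f - EPf = (Ex N f - Ex N T) + (Ex N T - EPT) - (EPf - EPT) by ring.
rewrite (le_trans (ler_normB _ _))//.
have := ler_normD (Ex N f - Ex N T) (Ex N T - EPT).
move: eN (eP m) h1; rewrite -/EPf -/EPT; lra.
Unshelve. all: by end_near. Qed.

End levy.

(** * The characteristic function of the normal law *)

Section normal_characteristic_function.
Context {R : realType}.
Notation mu := (@lebesgue_measure R).
Implicit Types (x t th : R).

Lemma is_derive_gauss (k : R) x :
  is_derive x (1 : R) (fun y => expR (k * y ^+ 2)) (2 * k * x * expR (k * x ^+ 2)).
Proof.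
have h : is_derive x (1 : R) (fun y => k * y ^+ 2) (k * (2 * x)).
  have h2 : is_derive x (1 : R) (fun y => y ^+ 2) (2 * x).
    apply: is_derive_eq.
    by rewrite /GRing.scale /= mulr1 mulr_natl mulr2n.
  exact: (is_deriveZ k h2).
have := @is_derive1_comp R expR (fun y => k * y ^+ 2) x _ _ (is_derive_expR _) h.
by move=> H; apply: is_derive_eq H _; ring.
Qed.

Lemma is_derive_cos_affine (a b t : R) :
  is_derive t (1 : R) (fun t => cos (t * a + b)) (- a * sin (t * a + b)).
Proof.
have h : is_derive t (1 : R) (fun t => t * a + b) a.
  apply: is_derive_eq.
  by rewrite /GRing.scale/= mulr1 addr0 ?mulr0 ?add0r ?addr0.
have := @is_derive1_comp R cos (fun t => t * a + b) t _ _ (is_derive_cos _) h.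
by move=> H; apply: is_derive_eq H _; ring.
Qed.

Lemma is_derive_sin_affine (a b t : R) :
  is_derive t (1 : R) (fun t => sin (t * a + b)) (a * cos (t * a + b)).
Proof.
have h : is_derive t (1 : R) (fun t => t * a + b) a.
  apply: is_derive_eq.
  by rewrite /GRing.scale/= mulr1 addr0 ?mulr0 ?add0r ?addr0.
have := @is_derive1_comp R sin (fun t => t * a + b) t _ _ (is_derive_sin _) h.
by move=> H; apply: is_derive_eq H _; ring.
Qed.

Variable s : R.
Hypothesis s0 : 0 < s.
Notation phi := (normal_pdf 0 s).

Lemma normal_pdf_expR : phi = (fun x => normal_peak s * expR (- (2 * s ^+ 2)^-1 * x ^+ 2)).
Proof.
rewrite normal_pdfE ?gt_eqF//; apply/funext => x; rewrite /normal_fun subr0.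
by congr (_ * expR _); rewrite -mulr_natl !mulNr mulrC.
Qed.

Lemma is_derive_phi x : is_derive x (1 : R) phi (- x / s ^+ 2 * phi x).
Proof.
rewrite normal_pdf_expR.
have h := is_deriveZ (normal_peak s) (is_derive_gauss (- (2 * s ^+ 2)^-1) x).
apply: is_derive_eq h _; rewrite /GRing.scale/=.
by field; rewrite gt_eqF.
Qed.

(** Integrability of |x| phi x: the linear factor costs one half of the
    exponent, hence the normal density with doubled variance. *)
Lemma normx_phi_le x : `|x| * phi x <=
  s * normal_peak s / normal_peak (s * Num.sqrt 2) * normal_pdf 0 (s * Num.sqrt 2) x.
Proof.
have s2 : s * Num.sqrt 2 != 0 by rewrite gt_eqF// mulr_gt0// sqrtr_gt0.
rewrite normal_pdf_expR (normal_pdfE 0 s2) /normal_fun subr0.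
have np : normal_peak (s * Num.sqrt 2) != 0 by rewrite gt_eqF// normal_peak_gt0.
set A := normal_peak (s * _) in np *; set ex := expR (_ / _).
have -> : s * normal_peak s / A * (A * ex) = s * normal_peak s * ex by field.
rewrite /ex.
have c0 : 0 < normal_peak s by rewrite normal_peak_gt0// gt_eqF.
rewrite [`|x| * _]mulrC [s * _]mulrC -!mulrA ler_pM2l//.
rewrite exprMn sqr_sqrtr//.
set k := (4 * s ^+ 2)^-1.
have -> : expR (- (2 * s ^+ 2)^-1 * x ^+ 2) = expR (- k * x ^+ 2) * expR (- k * x ^+ 2).
  by rewrite -expRD /k; congr expR; field; rewrite gt_eqF.
have -> : - x ^+ 2 / ((s ^+ 2 * 2) *+ 2) = - k * x ^+ 2.
  by rewrite -mulr_natl /k; field; rewrite gt_eqF.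
rewrite mulrAC ler_pM2r ?expR_gt0// mulNr expRN mulrC ler_pdivrMr ?expR_gt0//.
apply: (@le_trans _ _ (s * (1 + k * x ^+ 2))); last first.
  by rewrite ler_pM2l//; exact: expR_ge1Dx.
rewrite -subr_ge0.
have -> : s * (1 + k * x ^+ 2) - `|x| = (2 * s - `|x|) ^+ 2 / (4 * s).
  by rewrite -(real_normK (num_real x)) /k; field; rewrite gt_eqF.
by rewrite divr_ge0 ?sqr_ge0// mulr_ge0// ltW.
Qed.

Lemma measurable_phi : measurable_fun setT phi.
Proof. exact: measurable_normal_pdf. Qed.

Lemma integrable_normx_phi : mu.-integrable setT (EFin \o (fun x => `|x| * phi x)).
Proof.
pose C := s * normal_peak s / normal_peak (s * Num.sqrt 2).
have := integrable_normal_pdf 0 (s * Num.sqrt 2).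
move=> /(integrableZl measurableT C).
apply: le_integrable => //.
  apply/measurable_EFinP; apply: measurable_funM; last exact: measurable_phi.
  exact: normr_measurable.
move=> x _ /=; rewrite lee_fin ger0_norm; last first.
  by rewrite mulr_ge0// normal_pdf_ge0.
by rewrite (le_trans (normx_phi_le x))// ler_norm.
Qed.

Lemma integrable_bounded_phi (g : R -> R) : bmeas g ->
  mu.-integrable setT (EFin \o (fun x => g x * phi x)).
Proof.
move=> [mg [K gK]].
have bg : [bounded g x | x in [set: R]].
  exists K; split; first exact: num_real.
  by move=> M KM x _ /=; rewrite (le_trans (gK x))// ltW.
exact: (integrableMr (mu := mu) measurableT mg bg (integrable_normal_pdf 0 s)).
Qed.

Lemma bfunctional_phi : bfunctional (fun g : R -> R => \int[mu]_x (g x * phi x)).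
Proof.
split.
- move=> f g bf bg; rewrite -RintegralD//; try exact: integrable_bounded_phi.
  by apply: eq_Rintegral => x _; rewrite mulrDl.
- move=> c f bf; rewrite -RintegralZl//; last exact: integrable_bounded_phi.
  by apply: eq_Rintegral => x _; rewrite mulrA.
- exists 1 => f K bf fK.
  have ip := integrable_normal_pdf 0 s.
  rewrite (le_trans (le_normr_Rintegral _ (integrable_bounded_phi bf)))// mul1r.
  apply: (@le_trans _ _ (\int[mu]_x (K * phi x))).
    apply: le_Rintegral => //.
    - have := integrable_bounded_phi (bmeas_norm bf).
      congr (_.-integrable _ _); apply/funext => x /=.
      by rewrite normrM (ger0_norm (normal_pdf_ge0 _ _ _)).
    - by have := integrable_bounded_phi (bmeas_cst K).
    - move=> x _; rewrite normrM (ger0_norm (normal_pdf_ge0 _ _ _)).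
      by rewrite ler_wpM2r// normal_pdf_ge0.
  by rewrite RintegralZl// /Rintegral integral_normal_pdf mulr1.
Qed.

Lemma Ex_normal (g : R -> R) : bmeas g ->
  Ex (normal_prob 0 s) g = \int[mu]_x (g x * phi x).
Proof.
move=> bg.
have b1 : bfunctional (fun f : R -> R => Ex (normal_prob 0 s) f).
  split; [by move=> *; exact: ExD|by move=> *; exact: ExZ|].
  by exists 1 => f K bf fK; rewrite mul1r; exact: Ex_normle.
apply: (bfunctional_ext b1 bfunctional_phi _ bg) => A mA.
rewrite Ex_indic// /normal_prob /Rintegral; congr fine.
rewrite [LHS]integral_mkcond.
apply: eq_integral => x _; rewrite patchE indicE; case: ifPn => _; first by rewrite mul1r.
by rewrite mul0r.
Qed.

Variable th : R.

(** The phase th gives the real part of the characteristic function for th = 0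
    and its imaginary part for th = - pi / 2. *)
Definition psi (t : R) : R := \int[mu]_x (cos (t * x + th) * phi x).

Lemma bmeas_cos_affine t : bmeas (fun x : R => cos (t * x + th)).
Proof.
split; last by exists 1 => x; exact: cos_max.
apply: continuous_measurable_fun => x; apply: continuous_comp; last exact: continuous_cos.
by apply: cvgD; [apply: cvgM; [exact: cvg_cst|exact: cvg_id]|exact: cvg_cst].
Qed.

Lemma bmeas_sin_affine t : bmeas (fun x : R => sin (t * x + th)).
Proof.
split; last by exists 1 => x; exact: sin_max.
apply: continuous_measurable_fun => x; apply: continuous_comp; last exact: continuous_sin.
by apply: cvgD; [apply: cvgM; [exact: cvg_cst|exact: cvg_id]|exact: cvg_cst].
Qed.

Lemma is_derive_cos_phi x t :
  is_derive t (1 : R) (fun t => cos (t * x + th) * phi x) (- x * sin (t * x + th) * phi x).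
Proof.
have := is_deriveZ (phi x) (is_derive_cos_affine x th t).
move=> h; rewrite (_ : (fun t => _) = phi x \*: (fun t => cos (t * x + th))).
  by apply: is_derive_eq h _; rewrite /GRing.scale/=; ring.
by apply/funext => y; rewrite /GRing.scale/= mulrC.
Qed.

Lemma is_derive_psi t : is_derive t (1 : R) psi (\int[mu]_x (- x * sin (t * x + th) * phi x)).
Proof.
have It : (`](t - 1), (t + 1)[%classic : set R) t.
  by rewrite /= in_itv/= ltrBlDr !ltrDl ltr01.
have d1E y x : (partial1of2 (fun t x => cos (t * x + th) * phi x)) y x = - x * sin (y * x + th) * phi x.
  by rewrite partial1of2E; apply: derive_val; exact: is_derive_cos_phi.
have h1 : forall y, `](t - 1), (t + 1)[%classic y ->
    mu.-integrable setT (EFin \o (fun x => cos (y * x + th) * phi x)).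
  by move=> y _; exact: integrable_bounded_phi (bmeas_cos_affine y).
have h2 : forall y x, `](t - 1), (t + 1)[%classic y -> [set: R] x ->
    derivable ((fun t x => cos (t * x + th) * phi x) ^~ x) y 1.
  by move=> y x _ _; exact: (@ex_derive _ _ _ _ _ _ _ (is_derive_cos_phi x y)).
have h3 : forall x, 0 <= `|x| * phi x.
  by move=> x; rewrite mulr_ge0// normal_pdf_ge0.
have h4 : forall y x, `](t - 1), (t + 1)[%classic y -> [set: R] x ->
    `|partial1of2 (fun t x => cos (t * x + th) * phi x) y x| <= `|x| * phi x.
  move=> y x _ _; rewrite d1E !normrM normrN (ger0_norm (normal_pdf_ge0 _ _ _)).
  by rewrite ler_wpM2r ?normal_pdf_ge0// ler_piMr// sin_max.
have D := derivable_under_integral measurableT It h1 h2 h3 integrable_normx_phi h4.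
have E := differentiation_under_integral measurableT It h1 h2 h3 integrable_normx_phi h4.
apply: DeriveDef; first exact: D.
rewrite -derive1E E; apply: eq_Rintegral => x _; exact: d1E.
Qed.

Lemma normal_pdfN x : phi (- x) = phi x.
Proof. by rewrite normal_pdf_expR sqrrN. Qed.

Lemma normal_pdf_le (n : nat) : phi n.+1%:R <= normal_peak s * (2 * s ^+ 2) * n.+1%:R^-1.
Proof.
rewrite normal_pdf_expR -mulrA ler_wpM2l ?normal_peak_ge0//.
have k0 : 0 < 2 * s ^+ 2 by rewrite mulr_gt0// exprn_gt0.
set N : R := n.+1%:R; have N0 : 0 < N by rewrite ltr0n.
have N1 : 1 <= N by rewrite ler1n.
rewrite mulNr expRN -[X in _ <= X * _]invrK -invfM lef_pV2 ?posrE ?expR_gt0//; last first.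
  by rewrite mulr_gt0// invr_gt0.
apply: (le_trans _ (expR_ge1Dx _)).
apply: (@le_trans _ _ ((2 * s ^+ 2)^-1 * N ^+ 2)); last by rewrite lerDr.
by rewrite ler_pM2l ?invr_gt0// expr2 ler_peMl// ltW.
Qed.

Lemma is_derive_sin_phi t x : is_derive x (1 : R) (fun x => sin (t * x + th) * phi x)
  (t * (cos (t * x + th) * phi x) + (s ^+ 2)^-1 * (- x * sin (t * x + th) * phi x)).
Proof.
have h1 : is_derive x (1 : R) (fun x => sin (t * x + th)) (t * cos (t * x + th)).
  by have := is_derive_sin_affine t th x; under eq_fun do rewrite mulrC; rewrite (mulrC x t).
have := is_deriveM h1 (is_derive_phi x).
by move=> h; apply: is_derive_eq h _; rewrite /GRing.scale/=; ring.
Qed.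

Lemma continuous_phi : continuous phi.
Proof. by apply: continuous_normal_pdf; rewrite gt_eqF. Qed.

(** Stein's identity: the derivative of sin (t x + th) phi x in x has integral
    zero over the line. *)
Lemma psi_stein t : \int[mu]_x (- x * sin (t * x + th) * phi x) = - s ^+ 2 * t * psi t.
Proof.
pose g1 x := cos (t * x + th) * phi x.
pose g2 x := - x * sin (t * x + th) * phi x.
pose h x := t * g1 x + (s ^+ 2)^-1 * g2 x.
have s20 : s ^+ 2 != 0 by rewrite gt_eqF// exprn_gt0.
have caff : continuous (fun x : R => t * x + th).
  by move=> x; apply: cvgD; [apply: cvgM; [exact: cvg_cst|exact: cvg_id]|exact: cvg_cst].
have ccos : continuous (fun x : R => cos (t * x + th)).
  by move=> x; exact: (continuous_comp (caff x) (@continuous_cos R _)).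
have csin : continuous (fun x : R => sin (t * x + th)).
  by move=> x; exact: (continuous_comp (caff x) (@continuous_sin R _)).
have cg1 : continuous g1 by move=> x; exact: (cvgM (ccos x) (@continuous_phi x)).
have cg2 : continuous g2.
  move=> x; apply: (@cvgM _ _ _ _ (fun x => - x * sin (t * x + th)) phi); last exact: continuous_phi.
  by apply: cvgM; [apply: cvgN; exact: cvg_id|exact: csin].
have ch : continuous h.
  move=> x; apply: (@cvgD _ _ _ _ _ (fun x => t * g1 x) (fun x => (s ^+ 2)^-1 * g2 x)).
    by apply: (@cvgM _ _ _ _ (cst t) g1); [exact: cvg_cst|exact: cg1].
  by apply: (@cvgM _ _ _ _ (cst (s ^+ 2)^-1) g2); [exact: cvg_cst|exact: cg2].
have ig1 : mu.-integrable setT (EFin \o g1).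
  exact: integrable_bounded_phi (bmeas_cos_affine t).
have ig2 : mu.-integrable setT (EFin \o g2).
  apply: le_integrable integrable_normx_phi => //.
    by apply/measurable_EFinP; exact: continuous_measurable_fun.
  move=> x _ /=; rewrite lee_fin /g2 !normrM normrN normr_id.
  by rewrite ler_wpM2r// ler_piMr// sin_max.
have ih : mu.-integrable setT (EFin \o h).
  have := integrableD measurableT (integrableZl measurableT t ig1)
            (integrableZl measurableT (s ^+ 2)^-1 ig2).
  by congr (_.-integrable _ _); apply/funext => x.
have hE : \int[mu]_x h x = t * psi t + (s ^+ 2)^-1 * \int[mu]_x g2 x.
  rewrite /h RintegralD//; last 2 first.
  - by have := integrableZl measurableT t ig1.
  - by have := integrableZl measurableT (s ^+ 2)^-1 ig2.
  by rewrite !RintegralZl.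
suff h0 : \int[mu]_x h x = 0.
  move: hE; rewrite h0 -/(\int[mu]_x g2 x) => /esym/eqP.
  rewrite addr_eq0 => /eqP hE'; rewrite !mulNr -mulrA hE' mulrN opprK.
  by rewrite mulrA divff// mul1r.
pose H x := sin (t * x + th) * phi x.
pose I n := `[(- n.+1%:R)%R, n.+1%:R%R : R]%classic.
have FTC n : (\int[mu]_(x in I n) (h x)%:E = (H n.+1%:R - H (- n.+1%:R))%:E)%E.
  rewrite EFinB.
  apply: continuous_FTC2.
  - by rewrite gtrN// ltr0n.
  - exact: continuous_subspaceT.
  - have dH x : derivable H x 1 by exact: (@ex_derive _ _ _ _ _ _ _ (is_derive_sin_phi t x)).
    have cH x : {for x, continuous H}.
      by apply/differentiable_continuous/derivable1_diffP.
    by split=> //; [apply: cvg_at_right_filter|apply: cvg_at_left_filter]; exact: cH.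
  - by move=> x _; rewrite derive1E; apply: derive_val; exact: is_derive_sin_phi.
have Hle n : `|H n.+1%:R - H (- n.+1%:R)| <= 2 * (normal_peak s * (2 * s ^+ 2)) * n.+1%:R^-1.
  rewrite (le_trans (ler_normB _ _))// /H normal_pdfN !normrM (ger0_norm (normal_pdf_ge0 _ _ _)).
  have p0 := normal_pdf_ge0 0 s n.+1%:R; have := normal_pdf_le n.
  have := ler_piMl p0 (sin_max (t * n.+1%:R + th)).
  have := ler_piMl p0 (sin_max (t * - n.+1%:R + th)).
  move=> a1 a2 a3; rewrite -[leRHS]mulrA mulr_natl mulr2n.
  by apply: lerD; [exact: le_trans a2 a3|exact: le_trans a1 a3].
have mI n : measurable (I n) by exact: measurable_itv.
pose f_ n x := ((h \_ (I n)) x)%:E.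
have mh : measurable_fun setT h by exact: continuous_measurable_fun.
have mf n : measurable_fun setT (f_ n).
  by apply/measurable_EFinP; apply/(measurable_restrictT _ (mI n)); exact: measurable_funTS.
have mhE : measurable_fun setT (EFin \o h) by exact/measurable_EFinP.
have cf : {ae mu, forall x, [set: R] x -> f_ ^~ x @ \oo --> (EFin \o h) x}.
  apply: aeW => x _; apply: cvg_near_cst; near=> n.
  have xn : `|x| <= n.+1%:R.
    rewrite (@le_trans _ _ n%:R)//; last by rewrite ler_nat.
    by near: n; exact: nbhs_infty_ger.
  by rewrite /f_ patchE mem_set// /I/= in_itv/= -ler_norml.
have ig : mu.-integrable setT (EFin \o (fun x => `|h x|)) by exact: (integrable_abse ih).
have bf : {ae mu, forall x n, [set: R] x -> (`|f_ n x| <= (EFin \o (fun x => `|h x|%R)) x)%E}.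
  apply: aeW => x n _; rewrite /f_ /= lee_fin patchE; case: ifPn => _ //.
  by rewrite normr0.
have DC := dominated_convergence (mu := mu) measurableT.
have [_ _ C] := DC _ _ _ mf mhE cf ig bf.
have fE n : (\int[mu]_x f_ n x = (H n.+1%:R - H (- n.+1%:R))%:E)%E.
  by rewrite -FTC [RHS]integral_mkcond; apply: eq_integral => x _; rewrite /f_ restrict_EFin.
have C0 : (fun n => \int[mu]_x f_ n x)%E @ \oo --> (0%R)%:E.
  under eq_fun do rewrite fE.
  apply: cvg_EFin; first exact: nearW.
  apply: norm_cvg0.
  apply: (@squeeze_cvgr _ _ _ _ (cst 0)
    (fun n => 2 * (normal_peak s * (2 * s ^+ 2)) * harmonic n)).
  - by apply: nearW => n; rewrite normr_ge0/=; exact: Hle.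
  - exact: cvg_cst.
  - by rewrite -[X in _ --> X](mulr0 (2 * (normal_peak s * (2 * s ^+ 2)))); apply: cvgM; [exact: cvg_cst|exact: cvg_harmonic].
by rewrite /Rintegral (cvg_unique _ C C0).
Unshelve. all: by end_near. Qed.

Lemma psi0 : psi 0 = cos th.
Proof.
rewrite /psi; under eq_Rintegral do rewrite mul0r add0r.
rewrite RintegralZl//; last exact: integrable_normal_pdf.
by rewrite /Rintegral integral_normal_pdf mulr1.
Qed.

(** By [psi_stein], psi' t = - s^2 t psi t, so psi t exp (s^2 t^2 / 2) is
    constant. *)
Lemma psi_closed_form t : psi t = cos th * expR (- (s ^+ 2 * t ^+ 2 / 2)).
Proof.
pose g t := psi t * expR (2^-1 * s ^+ 2 * t ^+ 2).
have dg x : is_derive x (1 : R) g 0.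
  have h := is_deriveM (is_derive_psi x) (is_derive_gauss (2^-1 * s ^+ 2) x).
  by apply: is_derive_eq h _; rewrite psi_stein /GRing.scale/=; field.
have := @is_derive_0_is_cst R g t 0 dg.
rewrite /g expr0n/= mulr0 expR0 mulr1 psi0 => <-.
rewrite -mulrA -expRD.
have -> : 2^-1 * s ^+ 2 * t ^+ 2 + - (s ^+ 2 * t ^+ 2 / 2) = 0 by field.
by rewrite expR0 mulr1.
Qed.

End normal_characteristic_function.

Lemma bmeas_cosM (R : realType) (c : R) : bmeas (fun x : measurableTypeR R => cos (c * x)).
Proof. by have := bmeas_cos_affine 0 c; under eq_fun do rewrite addr0. Qed.

Lemma bmeas_sinM (R : realType) (c : R) : bmeas (fun x : measurableTypeR R => sin (c * x)).
Proof. by have := bmeas_sin_affine 0 c; under eq_fun do rewrite addr0. Qed.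

Lemma normal_cf (R : realType) (s t : R) : 0 < s ->
  Ex (normal_prob 0 s) (fun x => cos (t * x)) = expR (- (s ^+ 2 * t ^+ 2 / 2)) /\
  Ex (normal_prob 0 s) (fun x => sin (t * x)) = 0.
Proof.
move=> s0; split.
  have := psi_closed_form s0 0 t; rewrite cos0 mul1r /psi -Ex_normal//; last exact: bmeas_cos_affine.
  by under eq_fun do rewrite addr0.
have := psi_closed_form s0 (- (pi / 2)) t; rewrite cosN cos_pihalf mul0r /psi -Ex_normal//; last exact: bmeas_cos_affine.
by under eq_fun do rewrite cosBpihalf.
Qed.

(** * Laws on the line are determined by their characteristic functions *)

Lemma law_exists d d' (T : measurableType d) (T' : measurableType d') (R : realType)
    (P : probability T R) (X : T -> T') : measurable_fun setT X ->
  exists N : probability T' R, (forall A, N A = P (X @^-1` A)) /\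
    (forall f, bmeas f -> Ex N f = Ex P (fun x => f (X x))).
Proof.
move=> mX; pose X' : {mfun T >-> T'} := HB.pack X (isMeasurableFun.Build _ _ _ _ X mX).
exists (distribution P X'); split=> // f bf.
apply: (bfunctional_ext (bfunctional_expectation _)
  (bfunctional_comp mX (bfunctional_expectation P)) _ bf) => A mA.
rewrite Ex_indic//= (_ : \1_A \o X = \1_(X @^-1` A)); last first.
  by apply/funext => x /=; rewrite !indicE; congr (nat_of_bool _)%:R; apply/idP/idP; rewrite !inE.
by rewrite Ex_indic//= -[X in measurable X]setTI; exact (mX measurableT A mA).
Qed.

Section normal_law.
Context {R : realType}.

(** The centred normal law bundled as a probability measure, including the
    degenerate case v = 0. *)
Definition normal_dist (v : R) : probability (measurableTypeR R) R :=
  if v == 0 then [the probability (measurableTypeR R) R of \d_(0 : measurableTypeR R)]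
  else [the probability (measurableTypeR R) R of normal_prob 0 (Num.sqrt v)].

Lemma normal_distE v A : normal_dist v A = normal_law 0 v A.
Proof. by rewrite /normal_dist /normal_law; case: ifP. Qed.

Lemma normal_dist_cf (v t : R) : 0 <= v ->
  Ex (normal_dist v) (fun x => cos (t * x)) = expR (- (v * t ^+ 2 / 2)) /\
  Ex (normal_dist v) (fun x => sin (t * x)) = 0.
Proof.
rewrite le_eqVlt => /predU1P[<-|v0].
  rewrite /normal_dist eqxx /Ex /Rintegral !integral_dirac//; last 2 first.
    by apply/measurable_EFinP; exact: (bmeas_sinM t).1.
    by apply/measurable_EFinP; exact: (bmeas_cosM t).1.
  by rewrite diracT !mul1e /= mulr0 cos0 sin0 mul0r mul0r oppr0 expR0.
rewrite /normal_dist gt_eqF//.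
have s0 : 0 < Num.sqrt v by rewrite sqrtr_gt0.
have [-> ->] := normal_cf t s0.
by rewrite sqr_sqrtr// ltW.
Qed.

End normal_law.

Section cf_uniqueness.
Context {R : realType}.

(** A continuous function that is 1 up to a, 0 from a + e on and affine in
    between; it replaces the indicator of a half-line. *)
Definition ramp (a e x : R) : R := Num.max 0 (Num.min 1 (1 + (a - x) / e)).

Lemma ramp_continuous a e : continuous (ramp a e).
Proof.
move=> x; apply: (@continuous_max _ _ (cst 0) (fun x => Num.min 1 (1 + (a - x) / e))).
  exact: cst_continuous.
apply: (@continuous_min _ _ (cst 1) (fun x => 1 + (a - x) / e)).
  exact: cst_continuous.
apply: cvgD; first exact: cvg_cst.
by apply: cvgM; [apply: cvgB; [exact: cvg_cst|exact: cvg_id]|exact: cvg_cst].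
Qed.

Lemma ramp01 a e x : 0 <= ramp a e x <= 1.
Proof. by rewrite /ramp le_max lexx/= ge_max ler01/= ge_min lexx. Qed.

Lemma ramp_ge a e x : 0 < e -> (x <= a) -> ramp a e x = 1.
Proof.
move=> e0 xa; rewrite /ramp.
have h : 0 <= (a - x) / e by rewrite divr_ge0 ?subr_ge0// ltW.
by rewrite (min_idPl _) ?lerDl// (max_idPr ler01).
Qed.

Lemma ramp_le a e x : 0 < e -> (a + e <= x) -> ramp a e x = 0.
Proof.
move=> e0 ax; rewrite /ramp.
have h : 1 + (a - x) / e <= 0.
  rewrite -(ler_pM2r e0) mul0r mulrDl mul1r divfK ?gt_eqF//; lra.
rewrite (max_idPl _)// (le_trans _ h)// ge_min lexx orbT//.
Qed.

Lemma bmeas_ramp a e : bmeas (ramp a e).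
Proof.
split; first by apply: continuous_measurable_fun; exact: ramp_continuous.
by exists 1 => x; have /andP[r0 r1] := ramp01 a e x; rewrite ger0_norm.
Qed.

Variables (mu nu : probability (measurableTypeR R) R).
Hypothesis hcos : forall t, Ex mu (fun x => cos (t * x)) = Ex nu (fun x => cos (t * x)).
Hypothesis hsin : forall t, Ex mu (fun x => sin (t * x)) = Ex nu (fun x => sin (t * x)).

Definition const_cV (x : measurableTypeR R) : @borel_cV R 1 := const_mx x.

Lemma measurable_const_cV : measurable_fun setT const_cV.
Proof.
apply: measurable_cV => i; rewrite (_ : (fun omega => _) = id); first exact: measurable_id.
by apply/funext => x; rewrite /const_cV mxE.
Qed.

Lemma dot_const_cV t x : dot t (const_cV x) = t 0 0 * x.
Proof. by rewrite dotE big_ord1 /const_cV mxE. Qed.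

(** Levy's theorem for a constant sequence of vectors of dimension one. *)
Lemma Ex_continuous_unique (f : R -> R) : continuous f -> (exists K, forall x, `|f x| <= K) ->
  Ex mu f = Ex nu f.
Proof.
move=> cf [K fK].
have [M [MA ME]] := law_exists mu measurable_const_cV.
have [N [_ NE]] := law_exists nu measurable_const_cV.
pose f1 (x : 'cV[R]_1) := f (x 0 0).
have cf1 : continuous f1.
  by move=> x; exact: (continuous_comp (@coord_continuous _ _ _ 0 0 x) (cf _)).
have bf1 : bmeas (f1 : @borel_cV R 1 -> R).
  by apply: bmeas_cV => //; exists K => x; exact: fK.
have f1E x : f1 (const_cV x) = f x by rewrite /f1 mxE.
have hc (t : 'cV[R]_1) : Ex mu (fun x => cos (dot t (const_cV x))) @[_ --> \oo] -->
    Ex N (fun x => cos (dot t x)).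
  have E : (fun x => cos (dot t (const_cV x))) = (fun x => cos (t 0 0 * x)).
    by apply/funext => x; rewrite dot_const_cV.
  by rewrite (NE _ (bmeas_cos_dot t)) E hcos; exact: cvg_cst.
have hs (t : 'cV[R]_1) : Ex mu (fun x => sin (dot t (const_cV x))) @[_ --> \oo] -->
    Ex N (fun x => sin (dot t x)).
  have E : (fun x => sin (dot t (const_cV x))) = (fun x => sin (t 0 0 * x)).
    by apply/funext => x; rewrite dot_const_cV.
  by rewrite (NE _ (bmeas_sin_dot t)) E hsin; exact: cvg_cst.
have ht (e : R) : 0 < e -> exists L : R,
    \forall m \near \oo, fine (mu [set omega | ~ box L (const_cV omega)]) <= e.
  move=> e0; have [L L0 LP] := box_tight M e0; exists L; near=> m.
  by rewrite (le_trans _ LP)// MA.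
have hf : exists K : R, forall x, `|f1 x| <= K by exists K => x; exact: fK.
have := levy (fun=> measurable_const_cV) hc hs ht cf1 hf; rewrite NE//.
rewrite (_ : (fun x => f1 (const_cV x)) = f); last by apply/funext => x; exact: f1E.
by move/(cvg_lim (@Rhausdorff R)); rewrite (cvg_lim (@Rhausdorff R) (cvg_cst _)).
Unshelve. all: by end_near. Qed.

End cf_uniqueness.

Section cf_uniqueness_sets.
Context {R : realType}.

Lemma measurable_ray (a : R) : measurable (`]-oo, a]%classic : set (measurableTypeR R)).
Proof. exact: measurable_itv. Qed.

Lemma ray_le (mu nu : probability (measurableTypeR R) R) (a e : R) :
  (forall f : R -> R, continuous f -> (exists K, forall x, `|f x| <= K) -> Ex mu f = Ex nu f) ->
  0 < e -> fine (mu `]-oo, a]%classic) <= fine (nu `]-oo, (a + e)]%classic).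
Proof.
move=> h e0; rewrite -!Ex_indic//.
apply: (@le_trans _ _ (Ex mu (ramp a e))).
  apply: Ex_le; [exact: bmeas_indic|exact: bmeas_ramp|].
  move=> x; rewrite indicE; case: (boolP (x \in _)) => [|_].
    by rewrite inE/= in_itv/= => xa; rewrite ramp_ge.
  by have /andP[] := ramp01 a e x.
rewrite h; [|exact: ramp_continuous|]; last by have [_] := bmeas_ramp a e.
apply: Ex_le; [exact: bmeas_ramp|exact: bmeas_indic|].
move=> x; rewrite indicE; case: (boolP (x \in _)) => [_|].
  by have /andP[] := ramp01 a e x.
rewrite notin_setE/= in_itv/= => /negP; rewrite -ltNge => /ltW xa.
by rewrite ramp_le.
Qed.

(** Let e tend to 0 in [ray_le], by continuity from above. *)
Lemma ray_le0 (mu nu : probability (measurableTypeR R) R) (a : R) :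
  (forall f : R -> R, continuous f -> (exists K, forall x, `|f x| <= K) -> Ex mu f = Ex nu f) ->
  fine (mu `]-oo, a]%classic) <= fine (nu `]-oo, a]%classic).
Proof.
move=> h; pose F n := `]-oo, (a + n.+1%:R^-1)]%classic : set (measurableTypeR R).
have mF n : measurable (F n) by exact: measurable_itv.
have capF : \bigcap_n F n = `]-oo, a]%classic by rewrite -itvNycEbigcap.
have h1 : (nu (F 0%N) < +oo)%E.
  exact: (le_lt_trans (probability_le1 _ (mF 0%N)) (ltry _)).
have ni : nonincreasing_seq F.
  move=> m n mn; apply/subsetPset; apply: subset_itvl.
  by rewrite bnd_simp lerD2l lef_pV2 ?posrE// ler_nat.
have mc : measurable (\bigcap_n F n) by rewrite capF; exact: measurable_itv.
have := nonincreasing_cvg_mu h1 mF mc ni; rewrite capF.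
have fn : nu `]-oo, a]%classic \is a fin_num.
  by apply: fin_num_measure; exact: measurable_ray.
rewrite -[X in _ --> X](fineK fn) => /fine_cvgP[_ C].
rewrite -(cvg_lim (@Rhausdorff R) C); apply: limr_ge; first exact: (cvgP _ C).
by apply: nearW => n; exact: ray_le.
Qed.

(** Half-lines have equal mass by approximation with ramps, and half-open
    intervals generate the Borel sets. *)
Theorem probability_unique (mu nu : probability (measurableTypeR R) R) :
  (forall t, Ex mu (fun x => cos (t * x)) = Ex nu (fun x => cos (t * x))) ->
  (forall t, Ex mu (fun x => sin (t * x)) = Ex nu (fun x => sin (t * x))) ->
  forall A, measurable A -> mu A = nu A.
Proof.
move=> hc hs A mA.
have h12 := Ex_continuous_unique hc hs.
have h21 f cf bf := esym (h12 f cf bf).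
have rayE a : fine (mu `]-oo, a]%classic) = fine (nu `]-oo, a]%classic).
  by apply/eqP; rewrite eq_le !ray_le0.
have rayE' a : mu `]-oo, a]%classic = nu `]-oo, a]%classic.
  by rewrite (fineP_indic mu (measurable_ray a)) rayE -fineP_indic//; exact: measurable_ray.
have ocE a b : mu `]a, b]%classic = nu `]a, b]%classic.
  have [ab|ba] := leP a b; last by rewrite set_itv_ge ?measure0// bnd_simp -leNgt ltW.
  have -> : `]a, b]%classic = `]-oo, b] `\` `]-oo, a].
    by rewrite -[RHS]setCK setCD setCitvl setUC -[LHS]setCK setCitv.
  rewrite !measureD ?setIidr//; try exact: subset_itvl.
  - by congr (_ - _)%E; exact: rayE'.
  - by rewrite -ge0_fin_numE// fin_num_measure//; exact: measurable_ray.
  - by rewrite -ge0_fin_numE// fin_num_measure//; exact: measurable_ray.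
apply: (@measure_unique _ _ (measurableTypeR R) (R.-ocitv).-measurable
  (fun n => `](- n%:R)%R, n%:R]%classic)) => //.
- exact: ocitvI.
- by move=> n; exact: is_ocitv.
- apply/seteqP; split => // x _; exists (Num.trunc `|x|).+1 => //=.
  rewrite in_itv/=; have := truncnS_gt `|x|; set k := _.+1%:R => xk.
  have := ler_norm x; have := ler_norm (- x); rewrite normrN => x1 x2.
  by apply/andP; split; lra.
- by move=> _ [[a b] _ <-]; exact: ocE.
- by move=> n; rewrite (le_lt_trans (probability_le1 _ _)) ?ltry//; exact: measurable_itv.
Qed.

End cf_uniqueness_sets.

(** * Multivariate normal laws *)

Section product_probability.
Context {d1 d2 : measure_display} {T1 : measurableType d1} {T2 : measurableType d2}.
Context {R : realType} (P1 : probability T1 R) (P2 : probability T2 R).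

(** Two applications of [bfunctional_ext], one for each factor, reduce the claim
    to rectangles. *)
Lemma product_probability_exists : exists Q : probability (T1 * T2)%type R,
  forall (f : T1 -> R) (g : T2 -> R), bmeas f -> bmeas g ->
    Ex Q (fun p => f p.1 * g p.2) = Ex P1 f * Ex P2 g.
Proof.
pose Q := [the probability (T1 * T2)%type R of (P1 \x P2)%E].
exists Q => f g bf bg.
have b1 h : bmeas h -> bmeas (fun p : T1 * T2 => h p.1 : R).
  by move=> bh; apply: (bmeas_comp measurable_fst bh).
have b2 h : bmeas h -> bmeas (fun p : T1 * T2 => h p.2 : R).
  by move=> bh; apply: (bmeas_comp measurable_snd bh).
have L1 := bfunctional_comp measurable_fst (bfunctional_Ex_weighted Q (b2 _ bg)).
have L2 := bfunctional_Ex_weighted P1 (bmeas_cst (Ex P2 g)).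
have := bfunctional_ext L1 L2 _ bf; rewrite /comp => ->.
  by rewrite mulrC -ExZ//; congr Ex; apply/funext => x; rewrite mulrC.
move=> A mA; have bA : bmeas (\1_A : T1 -> R) by exact: bmeas_indic.
have L3 := bfunctional_comp measurable_snd (bfunctional_Ex_weighted Q (b1 _ bA)).
have L4 := bfunctional_Ex_weighted P2 (bmeas_cst (Ex P1 \1_A)).
have key := bfunctional_ext L3 L4 _ bg.
transitivity (Ex Q (fun p => (g \o snd) p * \1_A p.1)).
  by congr Ex; apply/funext => p /=; rewrite mulrC.
rewrite key.
  transitivity (Ex P1 \1_A * Ex P2 g).
    by rewrite -ExZ//; congr Ex; apply/funext => x; rewrite mulrC.
  by rewrite mulrC -ExZ//; congr Ex; apply/funext => x; rewrite mulrC.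
move=> B mB.
have bB : bmeas (\1_B : T2 -> R) by exact: bmeas_indic.
transitivity (Ex Q \1_(A `*` B)).
  congr Ex; apply/funext => p /=; rewrite !indicE -natrM mulnb andbC.
  by congr (nat_of_bool _)%:R; apply/andP/idP; rewrite !inE/=; [case|move=> []].
rewrite (Ex_indic Q (measurableX mA mB)).
transitivity (Ex P1 \1_A * Ex P2 \1_B).
  by rewrite !Ex_indic//= product_measure1E// fineM ?fin_num_measure.
by rewrite -ExZ//; congr Ex; apply/funext => x; rewrite mulrC.
Qed.

End product_probability.

Section multivariate_normal.
Context {R : realType} {d : nat}.
Implicit Types (S : 'M[R]_d) (a t : 'cV[R]_d).

Lemma dotNr (a b : 'cV[R]_d) : dot a (- b) = - dot a b.
Proof. by rewrite dotC dotNl dotC. Qed.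

Lemma quadE S a : quad S a = dot a (S *m a).
Proof. by rewrite /quad /dot mulmxA. Qed.

Lemma dot_mul_sym S a b : S^T = S -> dot a (S *m b) = dot b (S *m a).
Proof. by move=> sS; rewrite dotC /dot trmx_mul sS mulmxA. Qed.

Lemma quadB S a b : S^T = S ->
  quad S (a - b) = quad S a - 2 * dot a (S *m b) + quad S b.
Proof.
move=> sS; rewrite !quadE mulmxBr -[a - b]addrC !dotDl dotNl !dotDr.
by rewrite !dotNr (dot_mul_sym b a sS); ring.
Qed.

Lemma quadZ S (c : R) a : quad S (c *: a) = c ^+ 2 * quad S a.
Proof. by rewrite !quadE -scalemxAr dotZl dotZr mulrA expr2. Qed.

(** A step of Gaussian elimination: subtracting the rank-one part of S in the
    direction a kills a. Positivity is preserved since the new form at t is the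
    old one at t - (dot t v / quad S a) a. *)
Lemma psd_deflate S a : psd S -> 0 < quad S a ->
  let v := S *m a in let S' := S - (quad S a)^-1 *: (v *m v^T) in
  [/\ psd S', (\rank S' < \rank S)%N &
      forall t, quad S' t = quad S t - dot t v ^+ 2 / quad S a].
Proof.
move=> [sS S0] q0 v S'; set q := quad S a in q0 S' *.
have qn : q != 0 by rewrite gt_eqF.
have qS' t : quad S' t = quad S t - dot t v ^+ 2 / q.
  rewrite !quadE /S' mulmxBl dotDr dotNr; congr (_ - _).
  rewrite -scalemxAl dotZr -mulmxA.
  have -> : v^T *m t = (dot v t)%:M by rewrite /dot -mx11_scalar.
  by rewrite mul_mx_scalar dotZr (dotC v t) expr2 mulrC.
split => //.
  split.
    by rewrite /S' linearB linearZ/= trmx_mul trmxK sS.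
  move=> t; rewrite qS'.
  have := S0 (t - (dot t v / q) *: a).
  rewrite quadB// quadZ -scalemxAr dotZr -/v -/q.
  by have -> : quad S t - 2 * (dot t v / q * dot t v) + (dot t v / q) ^+ 2 * q =
    quad S t - dot t v ^+ 2 / q by field.
have vT : v^T = a^T *m S by rewrite /v trmx_mul sS.
have aS'0 : a^T *m S' = 0.
  rewrite /S' mulmxBr -scalemxAr mulmxA.
  have -> : a^T *m v = q%:M by rewrite /v mulmxA /q /quad -mx11_scalar.
  by rewrite mul_scalar_mx scalerA mulVf// scale1r vT subrr.
have kerS : (kermx S <= kermx S')%MS.
  apply/sub_kermxP; rewrite /S' mulmxBr mulmx_ker -scalemxAr mulmxA /v mulmxA.
  by rewrite mulmx_ker !mul0mx scaler0 subr0.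
have ltker : (kermx S < kermx S')%MS.
  rewrite /ltmx kerS/=; apply/negP => h.
  have : (a^T <= kermx S)%MS by apply: submx_trans h; apply/sub_kermxP.
  move/sub_kermxP => aS0; move: q0; rewrite /q /quad aS0 mul0mx mxE ltxx//.
have := rank_ltmx ltker; rewrite !mxrank_ker => h.
by have := rank_leq_row S'; lia.
Qed.

Definition normal_cf_of (S : 'M[R]_d) (N : probability (@borel_cV R d) R) : Prop :=
  forall t, Ex N (fun x => cos (dot t x)) = expR (- (quad S t / 2)) /\
            Ex N (fun x => sin (dot t x)) = 0.

(** Induction on the rank of S: if y has the law for the deflated matrix and z
    is an independent standard normal variable, then y + z S a / sqrt (quad S a)
    has the law for S. *)
Lemma normal_cf_exists S : psd S -> exists N, normal_cf_of S N.
Proof.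
move: {2}(\rank S).+1 (ltnSn (\rank S)) => n; elim: n S => [//|n ih] S rS pS.
have [[a qa]|nq] := pselect (exists a, quad S a != 0); last first.
  exists [the probability (@borel_cV R d) R of \d_(0 : @borel_cV R d)] => t.
  have -> : quad S t = 0.
    by apply/eqP; apply: contra_notT nq => h; exists t.
  rewrite mul0r oppr0 expR0 /Ex /Rintegral !integral_dirac//; last 2 first.
    by apply/measurable_EFinP; exact: (bmeas_sin_dot t).1.
    by apply/measurable_EFinP; exact: (bmeas_cos_dot t).1.
  have d0 : dot t (0 : 'cV[R]_d) = 0 by rewrite dotC dot0l.
  by rewrite diracT !mul1e /= d0 cos0 sin0.
have q0 : 0 < quad S a by rewrite lt_neqAle eq_sym qa; case: pS => _; apply.
have [pS' rS' qS'] := psd_deflate pS q0.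
set v := S *m a in qS' *; set S' := S - _ in pS' rS' qS'.
have [N' N'E] := ih S' (leq_trans rS' rS) pS'.
have [Q QE] := product_probability_exists (normal_dist 1) N'.
pose w := (Num.sqrt (quad S a))^-1 *: v.
pose X (p : measurableTypeR R * @borel_cV R d) : 'cV[R]_d := p.2 + p.1 *: w.
have mX : measurable_fun setT (X : _ -> @borel_cV R d).
  apply: measurable_cV => i.
  rewrite (_ : (fun p => X p i 0) = (fun p => (p.2 : 'cV[R]_d) i 0 + p.1 * w i 0)); last first.
    by apply/funext => p; rewrite /X !mxE.
  apply: measurable_funD.
    by apply: measurable_coord; exact: measurable_snd.
  apply: measurable_funM; last exact: measurable_cst.
  exact: measurable_fst.
have [N [_ NE]] := law_exists Q mX; exists N => t.
have dX p : dot t (X p) = dot t (p.2 : 'cV[R]_d) + dot t w * p.1.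
  by rewrite /X dotDr dotZr mulrC.
have bc2 := bmeas_cos_dot t; have bs2 := bmeas_sin_dot t.
have b12 (f : measurableTypeR R -> R) (g : @borel_cV R d -> R) : bmeas f -> bmeas g ->
    bmeas (fun p : measurableTypeR R * @borel_cV R d => f p.1 * g p.2).
  move=> bf bg; apply: bmeasM.
    by apply: (bmeas_comp measurable_fst bf).
  by apply: (bmeas_comp measurable_snd bg).
have [n1 n2] := normal_dist_cf (dot t w) ler01.
have [c1 c2] := N'E t.
have qE : expR (- (quad S t / 2)) = expR (- (1 * dot t w ^+ 2 / 2)) * expR (- (quad S' t / 2)).
  rewrite -expRD qS' /w dotZr exprMn exprVn sqr_sqrtr ?ltW//; congr expR.
  by field; rewrite gt_eqF.
split; rewrite NE//.
- transitivity (Ex Q (fun p => cos (dot t w * p.1) * cos (dot t (p.2 : 'cV[R]_d)) -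
      sin (dot t w * p.1) * sin (dot t (p.2 : 'cV[R]_d)))).
    by congr Ex; apply/funext => p; rewrite dX cosD; ring.
  rewrite ExB; [|exact: b12 (bmeas_cosM _) bc2|exact: b12 (bmeas_sinM _) bs2].
  rewrite (QE _ _ (bmeas_cosM _) bc2) (QE _ _ (bmeas_sinM _) bs2) n2 mul0r subr0.
  by rewrite n1 c1 qE.
- transitivity (Ex Q (fun p => cos (dot t w * p.1) * sin (dot t (p.2 : 'cV[R]_d)) +
      sin (dot t w * p.1) * cos (dot t (p.2 : 'cV[R]_d)))).
    by congr Ex; apply/funext => p; rewrite dX sinD; ring.
  rewrite ExD; [|exact: b12 (bmeas_cosM _) bs2|exact: b12 (bmeas_sinM _) bc2].
  by rewrite (QE _ _ (bmeas_cosM _) bs2) (QE _ _ (bmeas_sinM _) bc2) n2 mul0r addr0 c2 mulr0.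
Qed.

Lemma normal_cf_mvnormal S N : psd S -> normal_cf_of S N -> is_mvnormal N 0 S.
Proof.
move=> [_ S0] NE a A mA.
have mdot : measurable_fun setT (dot a : @borel_cV R d -> measurableTypeR R).
  exact: (continuous_measurable_cV (@continuous_dot _ _ a)).
have [L [LA LE]] := law_exists N mdot.
have -> : dot a 0 = 0 :> R by rewrite dotC dot0l.
rewrite -normal_distE -[LHS]LA.
have [h1 h2] : (forall t : R, Ex L (fun x => cos (t * x)) = Ex (normal_dist (quad S a)) (fun x => cos (t * x))) /\
               (forall t : R, Ex L (fun x => sin (t * x)) = Ex (normal_dist (quad S a)) (fun x => sin (t * x))).
  split=> t; have [n1 n2] := normal_dist_cf t (S0 a); have [c1 c2] := NE (t *: a).
  - rewrite (LE _ (bmeas_cosM t)) n1.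
    under eq_fun do rewrite -dotZl; rewrite c1 quadZ; congr expR; ring.
  - rewrite (LE _ (bmeas_sinM t)) n2.
    by under eq_fun do rewrite -dotZl.
exact: (probability_unique h1 h2).
Qed.

End multivariate_normal.

(** * Perturbation of matrices *)

Lemma sum_sq_le (R : realType) (I : Type) (r : seq I) (a : I -> R) :
  (\sum_(i <- r) a i) ^+ 2 <= (size r)%:R * \sum_(i <- r) a i ^+ 2.
Proof.
elim: r => [|i r ih]; first by rewrite !big_nil expr0n mulr0.
rewrite !big_cons /= -natr1; move: ih.
set s := \sum_(j <- r) a j; set q := \sum_(j <- r) _ ^+ 2; set b := a i.
have q0 : 0 <= q by apply: sumr_ge0 => j _; exact: sqr_ge0.
have [->|n0] := posnP (size r).
  rewrite mul0r => s2; have /eqP : s ^+ 2 == 0 by rewrite eq_le s2 sqr_ge0.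
  by move/eqP; rewrite sqrf_eq0 => /eqP ->; rewrite addr0 add0r mul1r lerDl.
set n : R := (size r)%:R; have n0' : 0 < n by rewrite ltr0n.
move=> h; have h2 : 2 * b * s <= n * b ^+ 2 + q.
  rewrite -(ler_pM2l n0').
  have : 0 <= (n * b - s) ^+ 2 by exact: sqr_ge0.
  rewrite !expr2 in h *; nra.
rewrite !expr2 in h h2 *; nra.
Qed.

Section matrix_bounds.
Context {R : realType} {d : nat}.
Implicit Types (x y a : 'cV[R]_d) (A B : 'M[R]_d).

Definition l1 x : R := \sum_i `|x i 0|.

Lemma l1_ge0 x : 0 <= l1 x.
Proof. exact: sumr_ge0. Qed.

Lemma coord_le_l1 x i : `|x i 0| <= l1 x.
Proof. by rewrite /l1 (bigD1 i)//= lerDl; apply: sumr_ge0. Qed.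

Lemma l1D x y : l1 (x + y) <= l1 x + l1 y.
Proof. by rewrite -big_split/=; apply: ler_sum => i _; rewrite mxE ler_normD. Qed.

Lemma l1Z (c : R) x : l1 (c *: x) = `|c| * l1 x.
Proof. by rewrite /l1 mulr_sumr; apply: eq_bigr => i _; rewrite mxE normrM. Qed.

Lemma l1N x : l1 (- x) = l1 x.
Proof. by apply: eq_bigr => i _; rewrite mxE normrN. Qed.

Lemma l1B x y : l1 (x - y) <= l1 x + l1 y.
Proof. by rewrite (le_trans (l1D _ _))// l1N. Qed.

Lemma l1_eq0 x : l1 x <= 0 -> x = 0.
Proof.
move=> x0; apply/matrixP => i j; rewrite ord1 mxE; apply/eqP.
by rewrite -normr_le0 (le_trans (coord_le_l1 x i)).
Qed.

Lemma dot_l1 a x : `|dot a x| <= l1 a * l1 x.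
Proof.
rewrite dotE (le_trans (ler_norm_sum _ _ _))// /l1 mulr_suml.
apply: ler_sum => i _; rewrite normrM ler_wpM2l//; exact: coord_le_l1.
Qed.

Lemma l1_sq_le x : l1 x ^+ 2 <= d%:R * \sum_i x i 0 ^+ 2.
Proof.
have := sum_sq_le (index_enum 'I_d) (fun i => `|x i 0|).
under [X in _ <= _ * X]eq_bigr do rewrite real_normK ?num_real//.
have -> : size (index_enum 'I_d) = d by rewrite -[RHS]card_ord cardT enumT.
exact.
Qed.

Lemma l1_mulmx A (e : R) x : (forall i j, `|A i j| <= e) ->
  l1 (A *m x) <= d%:R * e * l1 x.
Proof.
move=> Ae; rewrite /l1 -mulrA mulr_natl -[X in _ *+ X]card_ord -sumr_const.
apply: ler_sum => i _; rewrite mxE (le_trans (ler_norm_sum _ _ _))// mulr_sumr.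
by apply: ler_sum => j _; rewrite normrM ler_wpM2r.
Qed.

Lemma unitmx_ker0 A : (forall x, A *m x = 0 -> x = 0) -> A \in unitmx.
Proof.
move=> h; rewrite -unitmx_tr -row_free_unit -kermx_eq0; apply/eqP/row_matrixP => i.
rewrite row0; apply: trmx_inj; rewrite trmx0; apply: h.
apply: trmx_inj; rewrite trmx_mul trmxK trmx0.
by rewrite -row_mul mulmx_ker row0.
Qed.

Lemma invmx_l1 A (c : R) : (forall x, l1 x <= c * l1 (A *m x)) ->
  A \in unitmx /\ forall y, l1 (invmx A *m y) <= c * l1 y.
Proof.
move=> h; have uA : A \in unitmx.
  apply: unitmx_ker0 => x Ax; apply: l1_eq0; rewrite (le_trans (h x))// Ax.
  by rewrite /l1 big1 ?mulr0// => i _; rewrite mxE normr0.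
split=> // y; have := h (invmx A *m y).
by rewrite mulmxA mulmxV// mul1mx.
Qed.

(** If A is close to G, then A is injective with inverse bounded by twice the
    bound for G, and A^-1 - G^-1 = - A^-1 (A - G) G^-1. *)
Lemma invmx_perturb G (e : R) : G \in unitmx -> 0 < e ->
  exists2 dl : R, 0 < dl & forall A, (forall i j, `|A i j - G i j| <= dl) ->
    A \in unitmx /\ forall y, l1 (invmx A *m y - invmx G *m y) <= e * l1 y.
Proof.
move=> uG e0.
(* adding 1 keeps C and D positive also in dimension 0 *)
pose C := \sum_i \sum_j `|invmx G i j| + 1.
have C1 : 1 <= C by rewrite lerDr; apply: sumr_ge0 => i _; exact: sumr_ge0.
have C0 : 0 < C by rewrite (lt_le_trans ltr01).
have invC i j : `|invmx G i j| <= C.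
  rewrite /C (bigD1 i)//= (bigD1 j)//= -!addrA lerDl !addr_ge0//.
  - exact: sumr_ge0.
  - by apply: sumr_ge0 => k _; exact: sumr_ge0.
pose D : R := d%:R + 1.
have D1 : 1 <= D by rewrite lerDr ler0n.
have D0 : 0 < D by rewrite (lt_le_trans ltr01).
pose c := D * C; have c0 : 0 < c by rewrite mulr_gt0.
have invG y : l1 (invmx G *m y) <= c * l1 y.
  rewrite (le_trans (l1_mulmx y invC))// ler_wpM2r ?l1_ge0// ler_wpM2r ?(ltW C0)//.
  by rewrite /D lerDl.
pose dl := Num.min (2 * c * D)^-1 (e / (2 * c * c * D)).
have dl0 : 0 < dl.
  by rewrite lt_min invr_gt0 divr_gt0 ?mulr_gt0.
exists dl => // A AG.
have BA x : l1 ((A - G) *m x) <= D * dl * l1 x.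
  apply: (@le_trans _ _ (d%:R * dl * l1 x)).
    by apply: l1_mulmx => i j; rewrite !mxE.
  by rewrite ler_wpM2r ?l1_ge0// ler_wpM2r ?(ltW dl0)// /D lerDl.
have cDdl : c * (D * dl) <= 2^-1.
  have : dl <= (2 * c * D)^-1 by rewrite /dl ge_min lexx.
  rewrite -(ler_pM2l (mulr_gt0 c0 D0)) => h; rewrite mulrA (le_trans h)//.
  by rewrite le_eqVlt; apply/orP; left; apply/eqP; field; rewrite !gt_eqF.
have hA x : l1 x <= 2 * c * l1 (A *m x).
  have xE : x = invmx G *m (A *m x) - invmx G *m ((A - G) *m x).
    by rewrite -mulmxBr -mulmxBl opprB addrCA subrr addr0 mulmxA mulVmx// mul1mx.
  have h1 := invG (A *m x).
  have h2 : l1 (invmx G *m ((A - G) *m x)) <= 2^-1 * l1 x.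
    rewrite (le_trans (invG _))//.
    apply: (@le_trans _ _ (c * (D * dl * l1 x))); first by rewrite ler_wpM2l ?(ltW c0).
    by rewrite mulrA ler_wpM2r ?l1_ge0.
  have := l1B (invmx G *m (A *m x)) (invmx G *m ((A - G) *m x)); rewrite -xE; lra.
have [uA invA] := invmx_l1 hA; split => // y.
have -> : invmx A *m y - invmx G *m y = - (invmx A *m ((A - G) *m (invmx G *m y))).
  rewrite mulmxBl mulmxBr !mulmxA mulVmx// mul1mx -(mulmxA _ G) mulmxV// mulmx1.
  by rewrite opprB.
rewrite l1N (le_trans (invA _))//.
apply: (@le_trans _ _ (2 * c * (D * dl * (c * l1 y)))).
  have c20 : 0 <= 2 * c by rewrite mulr_ge0// ltW.
  have Dd0 : 0 <= D * dl by rewrite mulr_ge0// ltW.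
  by apply: ler_wpM2l => //; rewrite (le_trans (BA _))// ler_wpM2l.
have : dl <= e / (2 * c * c * D) by rewrite /dl ge_min lexx orbT.
rewrite ler_pdivlMr ?mulr_gt0// => h.
have -> : 2 * c * (D * dl * (c * l1 y)) = dl * (2 * c * c * D) * l1 y by ring.
by rewrite ler_wpM2r// l1_ge0.
Qed.

(** With x the j-th column of the inverse, k (x, x) <= (x, (A + k) x) = x_j,
    which bounds x_j and then all the entries of x by 1 / k. *)
Lemma resolvent_bound A (k : R) : psd A -> 0 < k ->
  A + k%:M \in unitmx /\ forall i j, `|invmx (A + k%:M) i j| <= k^-1.
Proof.
move=> [sA A0] k0.
have dotxx x : 0 <= dot x x by rewrite dotE; apply: sumr_ge0 => i _; rewrite -expr2 sqr_ge0.
have q x : k * dot x x <= dot x ((A + k%:M) *m x).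
  by rewrite mulmxDl mul_scalar_mx dotDr dotZr lerDr -quadE; exact: A0.
have dotx i x : x i 0 ^+ 2 <= dot x x.
  rewrite dotE (bigD1 i)//= expr2 lerDl; apply: sumr_ge0 => j _.
  by rewrite -expr2 sqr_ge0.
have u : A + k%:M \in unitmx.
  apply: unitmx_ker0 => x Ax; have := q x.
  rewrite Ax [dot x 0]dotC dot0l => h.
  apply/matrixP => i j; rewrite ord1 mxE; apply/eqP.
  rewrite -sqrf_eq0 eq_le sqr_ge0 andbT (le_trans (dotx i x))//.
  by rewrite -(ler_pM2l k0) mulr0.
split=> // i j.
pose x : 'cV[R]_d := invmx (A + k%:M) *m delta_mx j 0.
have xE i' : x i' 0 = invmx (A + k%:M) i' j.
  by rewrite /x -colE mxE.
have := q x; rewrite /x mulmxA mulmxV// mul1mx -/x dotC dot_delta => h.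
have kj : `|x j 0| <= k^-1.
  have h2 : k * x j 0 ^+ 2 <= x j 0.
    by rewrite (le_trans _ h)// ler_wpM2l ?(ltW k0).
  have xj0 : 0 <= x j 0 by rewrite (le_trans _ h2)// mulr_ge0 ?sqr_ge0// ltW.
  rewrite ger0_norm//; have [->|xn] := eqVneq (x j 0) 0; first by rewrite invr_ge0 ltW.
  have xp : 0 < x j 0 by rewrite lt_neqAle eq_sym xn.
  move: h2; rewrite expr2 mulrA -[leRHS]mul1r ler_pM2r//.
  by rewrite mulrC -ler_pdivlMr// mul1r.
have ki0 : 0 <= k^-1 by rewrite invr_ge0 ltW.
rewrite -xE -ler_sqr ?nnegrE// real_normK ?num_real//.
rewrite (le_trans (dotx i x))// -(ler_pM2l k0) (le_trans h)//.
rewrite (le_trans (ler_norm _))// (le_trans kj)//.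
by rewrite expr2 mulrA divff ?gt_eqF// mul1r.
Qed.

Lemma quad_diff_le G x y : G^T = G -> (forall i j, `|G i j| <= 1) ->
  `|quad G x - quad G y| <= l1 (x - y) * (d%:R * l1 (x - y)) + 2 * (l1 (x - y) * l1 (G *m y)).
Proof.
move=> sG G1.
have -> : quad G x - quad G y = dot (x - y) (G *m (x - y)) + 2 * dot (x - y) (G *m y).
  rewrite -quadE quadB// dotDl dotNl (dot_mul_sym x y sG) -!quadE; ring.
rewrite (le_trans (ler_normD _ _))// lerD//.
  rewrite (le_trans (dot_l1 _ _))// ler_wpM2l ?l1_ge0//.
  by have := l1_mulmx (x - y) G1; rewrite mulr1.
by rewrite normrM ger0_norm// ler_wpM2l// dot_l1.
Qed.

End matrix_bounds.

(** * Random matrices and regressors *)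

Section geometric_decay.
Context {R : realType}.

(** The exponent 6 beats the power 4 in [vanishing_mean] and makes the
    probabilities summable. *)
Lemma geometric_decay (q : R) : 0 < q < 1 -> exists2 C : R, 0 <= C &
  forall m, (0 < m)%N -> q ^+ m <= C / m%:R ^+ 6.
Proof.
move=> /andP[q0 q1]; pose c := - ln q.
have c0 : 0 < c by rewrite oppr_gt0 ln_lt0// q0.
have qE : q = expR (- c) by rewrite opprK lnK// posrE.
exists (6`!%:R / c ^+ 6); first by rewrite divr_ge0// exprn_ge0// ltW.
move=> m m0; have m0' : 0 < m%:R :> R by rewrite ltr0n.
have mc : 0 <= m%:R * c by rewrite mulr_ge0// ltW.
have := expR_ge1Dxn 5 mc => h.
have qm : q ^+ m * expR (m%:R * c) = 1.
  by rewrite qE -expRM_natl mulrN expRN mulVf// gt_eqF// expR_gt0.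
have h6 : (m%:R * c) ^+ 6 <= expR (m%:R * c) * 6`!%:R.
  by rewrite -ler_pdivrMr ?ltr0n ?fact_gt0// (le_trans _ h)// lerDr.
rewrite !ler_pdivlMr ?exprn_gt0// -mulrA -exprMn.
apply: (@le_trans _ _ (q ^+ m * (expR (m%:R * c) * 6`!%:R))).
  by rewrite ler_wpM2l// exprn_ge0// ltW.
by rewrite mulrA qm mul1r.
Qed.

End geometric_decay.

Section measurable_inverse.
Context {R : realType}.

Lemma measurable_inv : measurable_fun setT (fun x : R => x^-1).
Proof.
have o : open [set x : R | x != 0] by exact: open_neq.
have m1 : measurable [set x : R | x != 0] by exact: open_measurable.
have -> : [set: R] = [set x : R | x != 0] `|` [set 0].
  apply/seteqP; split => // x _ /=.
  by have [->|x0] := eqVneq x 0; [right|left].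
apply/measurable_funU => //; split.
  apply: open_continuous_measurable_fun => // x; rewrite inE/= => x0.
  exact: inv_continuous.
exact: measurable_fun_set1.
Qed.

Context {dO : measure_display} {Omega : measurableType dO} {n : nat}.

Lemma bmeas_det k (A : Omega -> 'M[R]_k) : (forall i j, bmeas (fun omega => A omega i j)) ->
  bmeas (fun omega => \det (A omega)).
Proof.
move=> bA; rewrite /determinant; apply: bmeas_sum => s.
by apply: bmeasM; [exact: bmeas_cst|apply: bmeas_prod => i; exact: bA].
Qed.

(** By Cramer's rule the entries of the inverse are quotients of polynomials in
    the entries of the matrix. *)
Lemma measurable_invmx k (A : Omega -> 'M[R]_k) i j :
  (forall i j, bmeas (fun omega => A omega i j)) ->
  (forall omega, A omega \in unitmx) ->
  measurable_fun setT (fun omega => invmx (A omega) i j).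
Proof.
move=> bA uA.
rewrite (_ : (fun omega => _) = (fun omega => (\det (A omega))^-1 *
    ((-1) ^+ (j + i) * \det (row' j (col' i (A omega)))))); last first.
  by apply/funext => omega; rewrite /invmx uA !mxE.
apply: measurable_funM.
  exact: (measurableT_comp measurable_inv (bmeas_det bA).1).
apply: measurable_funM; first exact: measurable_cst.
have b : forall i' j', bmeas (fun omega => (row' j (col' i (A omega))) i' j').
  by move=> i' j'; under eq_fun do rewrite !mxE; exact: bA.
exact: (bmeas_det b).1.
Qed.

End measurable_inverse.

Section regressors.
Context {R : realType} {J : nat}.
Implicit Types (w : 'I_J -> R * R -> R).
Notation sq := (unit_square R).

Lemma Fvec_entry (i : 'I_J.+1) : (forall w x, Fvec w x i 0 = 1) \/
  exists j, forall w x, Fvec w x i 0 = w j x.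
Proof.
have [k -> | k ->] := @split_ordP 1 J i.
  by left => w x; apply: (etrans (col_mxEu (1%:M : 'M[R]_1) (\col_(j < J) w j x) k 0)); rewrite ord1 mxE.
by right; exists k => w x; apply: (etrans (col_mxEd (1%:M : 'M[R]_1) (\col_(j < J) w j x) k 0)); rewrite mxE.
Qed.

(** The regressors with the agents extended by zero outside the square, hence
    globally measurable. *)
Definition regr w x : 'cV[R]_J.+1 := Fvec (fun j => sqext (w j)) x.

Lemma regrE w x : sq x -> regr w x = Fvec w x.
Proof.
move=> sx; apply/matrixP => i j; rewrite ord1 /regr.
by have [h|[k h]] := Fvec_entry i; rewrite !h// sqextE.
Qed.

Lemma bmeas_regr w i : (forall j, graphon (w j)) -> bmeas (fun x => regr w x i 0).
Proof.
move=> hw; rewrite /regr; have [h|[k h]] := Fvec_entry i.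
  by under eq_fun do rewrite h; exact: bmeas_cst.
by under eq_fun do rewrite h; exact: bmeas_graphon.
Qed.

Lemma regr_le1 w i x : (forall j, graphon (w j)) -> `|regr w x i 0| <= 1.
Proof.
move=> hw; rewrite /regr; have [h|[k h]] := Fvec_entry i; rewrite h ?normr1//.
rewrite /sqext patchE; case: ifPn => [/set_mem sx|_]; last by rewrite normr0.
by have [_ /(_ _ sx)/andP[w0 w1] _] := hw k; rewrite ger0_norm.
Qed.

Lemma bmeas_dot_regr w a : (forall j, graphon (w j)) -> bmeas (fun x => dot a (regr w x)).
Proof.
move=> hw; under eq_fun do rewrite dotE.
by apply: bmeas_sum => i; apply: bmeasZ; exact: bmeas_regr.
Qed.

Lemma Fvec_neq0 w x : Fvec w x != 0.
Proof.
apply/eqP => /matrixP/(_ (lshift J (0 : 'I_1)) 0); rewrite [RHS]mxE => h.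
have := etrans (esym (col_mxEu (1%:M : 'M[R]_1) (\col_(j < J) w j x) 0 0)) h.
by rewrite !mxE eqxx => /eqP; rewrite oner_eq0.
Qed.

End regressors.

Lemma near_eq_cvgr (R : realType) (u v : nat -> R) (l : R) :
  (\forall m \near \oo, u m = v m) -> v m @[m --> \oo] --> l -> u m @[m --> \oo] --> l.
Proof.
move=> uv /cvgrPdist_le vl; apply/cvgrPdist_le => e e0.
by apply: filterS2 uv (vl e e0) => m ->.
Qed.

Lemma ae_square_sub (R : realType) (Q Q' : R * R -> Prop) :
  (forall x, unit_square R x -> Q x -> Q' x) ->
  {ae lebesgue2 R, forall x, unit_square R x -> Q x} ->
  {ae lebesgue2 R, forall x, unit_square R x -> Q' x}.
Proof.
by move=> QQ'; apply: negligibleS => x nh h; apply: nh => sx; exact/QQ'/h.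
Qed.

(** * Normal probabilities of centred intervals *)

Section normal_intervals.
Context {R : realType}.
Implicit Types (a b r s v : R).

Notation itvset i := ([set` i] : set (measurableTypeR R)).

(** Compare characteristic functions. With c = -1 this is the symmetry of the
    normal law, with c = sqrt v the reduction to variance one. *)
Lemma normal_dist_scale v c (A : set (measurableTypeR R)) : 0 <= v -> measurable A ->
  normal_dist v ((fun x => c * x) @^-1` A) = normal_dist (c ^+ 2 * v) A.
Proof.
move=> v0 mA; have cv0 : 0 <= c ^+ 2 * v by rewrite mulr_ge0 ?sqr_ge0.
have mc : measurable_fun setT ((fun x => c * x) : measurableTypeR R -> measurableTypeR R).
  by apply: measurable_funM; [exact: measurable_cst|exact: measurable_id].
have [N [NA NE]] := law_exists (normal_dist v) mc; rewrite -NA.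
have [h1 h2] : (forall t, Ex N (fun x => cos (t * x)) =
      Ex (normal_dist (c ^+ 2 * v)) (fun x => cos (t * x))) /\
    (forall t, Ex N (fun x => sin (t * x)) =
      Ex (normal_dist (c ^+ 2 * v)) (fun x => sin (t * x))).
  split=> t; have [n1 n2] := normal_dist_cf t cv0; have [c1 c2] := normal_dist_cf (t * c) v0.
  - rewrite (NE _ (bmeas_cosM t)) n1; under eq_fun do rewrite mulrA; rewrite c1.
    by congr expR; ring.
  - by rewrite (NE _ (bmeas_sinM t)) n2; under eq_fun do rewrite mulrA; rewrite c2.
exact: probability_unique h1 h2 _ mA.
Qed.

Notation mu := (normal_dist (1 : R)).
Notation m A := (fine (mu A)).

Lemma std_normalE A : mu A = normal_prob 0 1 A.
Proof. by rewrite normal_distE /normal_law oner_eq0 sqrtr1. Qed.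

Lemma std_normalUI (A B : set (measurableTypeR R)) : measurable A -> measurable B ->
  m (A `|` B) + m (A `&` B) = m A + m B.
Proof.
move=> mA mB; have mI : measurable (A `&` B) by exact: measurableI.
rewrite measureUfinl//; last by rewrite (le_lt_trans (probability_le1 _ _)) ?ltry.
by rewrite fineB ?fineD ?fin_numD ?fin_num_measure// subrK.
Qed.

Lemma std_normal_ge0 A : 0 <= m A.
Proof. by rewrite fine_ge0// measure_ge0. Qed.

Lemma std_normal_itv_le a b : a <= b -> m (itvset `[a, b]) <= normal_peak 1 * (b - a).
Proof.
move=> ab; rewrite -lee_fin -fineP_indic; last exact: measurable_itv.
rewrite std_normalE /normal_prob.
apply: (@le_trans _ _ (\int[@lebesgue_measure R]_(x in `[a, b]) (normal_peak 1)%:E)%E).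
  apply: ge0_le_integral => //.
  - by move=> x _; rewrite lee_fin normal_pdf_ge0.
  - by apply/measurable_EFinP; apply: measurable_funTS; exact: measurable_normal_pdf.
  - by move=> x _; rewrite lee_fin normal_pdf_ub.
rewrite integral_cst//= lebesgue_measure_itv/= lte_fin.
case: ltP => [_|ba]; first by rewrite -EFinB -EFinM.
by rewrite mule0 lee_fin mulr_ge0 ?normal_peak_ge0// subr_ge0.
Qed.

Lemma std_normal_itv_gt0 a b : a < b -> 0 < m (itvset `[a, b]).
Proof.
move=> ab; pose K := Num.max `|a| `|b|; pose c := normal_pdf 0 1 K.
have c0 : 0 < c by rewrite /c normal_pdf_expR// mulr_gt0 ?expR_gt0// normal_peak_gt0.
have hc x : a <= x <= b -> c <= normal_pdf 0 1 x.
  move=> /andP[ax xb]; rewrite /c normal_pdf_expR// ler_wpM2l ?normal_peak_ge0// ler_expR.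
  rewrite !mulNr lerN2 ler_wpM2l ?invr_ge0 ?mulr_ge0 ?sqr_ge0//.
  have xK : `|x| <= K.
    rewrite ler_norml; apply/andP; split.
      rewrite lerNl (le_trans (_ : - x <= - a)) ?lerN2// /K le_max.
      by rewrite (le_trans (ler_norm _)) ?normrN ?lexx.
    by rewrite (le_trans xb)// /K le_max (ler_norm b) orbT.
  by rewrite -(real_normK (num_real x)) ler_sqr ?nnegrE// (le_trans (normr_ge0 x)).
apply: (@lt_le_trans _ _ (c * (b - a))); first by rewrite mulr_gt0// subr_gt0.
rewrite -lee_fin -fineP_indic; last exact: measurable_itv.
rewrite std_normalE /normal_prob.
apply: (@le_trans _ _ (\int[@lebesgue_measure R]_(x in `[a, b]) c%:E)%E).
  by rewrite integral_cst//= lebesgue_measure_itv/= lte_fin ab -EFinB -EFinM.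
apply: ge0_le_integral => //.
- by move=> x _; rewrite lee_fin ltW.
- by apply/measurable_EFinP; apply: measurable_funTS; exact: measurable_normal_pdf.
Qed.

Definition Phi x := m (itvset `]-oo, x]).
Definition std_centred r := m (itvset `[- r, r]).

Lemma Phi_lipschitz a b : a <= b -> Phi b <= Phi a + normal_peak 1 * (b - a).
Proof.
move=> ab; apply: (@le_trans _ _ (Phi a + m (itvset `[a, b]))).
  apply: le_trans (fine_probabilityU_le mu (measurable_itv _) (measurable_itv _)).
  apply: fine_probability_le; [exact: measurable_itv|by apply: measurableU; exact: measurable_itv|].
  move=> x /=; rewrite !in_itv/= => xb.
  by have [xa|ax] := leP x a; [left|right; rewrite (ltW ax)].
by rewrite lerD2l std_normal_itv_le.
Qed.

Lemma Phi_mono a b : a <= b -> Phi a <= Phi b.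
Proof.
move=> ab; apply: fine_probability_le; try exact: measurable_itv.
by move=> x /=; rewrite !in_itv/= => /le_trans; apply.
Qed.

(** By symmetry the half-lines up to r and from - r on have the same mass; they
    cover the line and meet in the centred interval. *)
Lemma Phi_std_centred r : 0 <= r -> 2 * Phi r = 1 + std_centred r.
Proof.
move=> r0.
have mB : measurable (itvset `[- r, +oo[) by exact: measurable_itv.
have mA : measurable (itvset `]-oo, r]) by exact: measurable_itv.
have symm : m (itvset `[- r, +oo[) = Phi r.
  have := @normal_dist_scale 1 (-1) _ ler01 mA.
  rewrite sqrrN expr1n mulr1 /Phi => <-; congr (fine (mu _)).
  by apply/seteqP; split => x /=; rewrite !in_itv/= mulN1r andbT lerNl.
have := std_normalUI mA mB; rewrite symm -/(Phi r).
have -> : itvset `]-oo, r] `|` itvset `[- r, +oo[ = setT.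
  apply/seteqP; split => // x _ /=; rewrite !in_itv/= andbT.
  by have [xr|rx] := leP x r; [left|right; rewrite (le_trans _ (ltW rx))// lerNl (le_trans _ r0)// oppr_le0].
have -> : itvset `]-oo, r] `&` itvset `[- r, +oo[ = itvset `[- r, r].
  apply/seteqP; split => x /=; rewrite !in_itv/= andbT.
    by move=> [-> ->].
  by move=> /andP[-> ->].
rewrite -/(std_centred r) (probability_setT mu) /=; lra.
Qed.

Lemma std_centred0 : std_centred 0 = 0.
Proof.
apply/eqP; rewrite eq_le std_normal_ge0 andbT.
by have := @std_normal_itv_le 0 0 (lexx 0); rewrite subrr mulr0 /std_centred oppr0.
Qed.

Lemma std_centred_lipschitz r s : 0 <= r -> r <= s -> std_centred s <= std_centred r + 2 * normal_peak 1 * (s - r).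
Proof.
move=> r0 rs; have := Phi_lipschitz rs.
have := Phi_std_centred r0; have := Phi_std_centred (le_trans r0 rs); lra.
Qed.

Lemma std_centred_lt r s : 0 <= r -> r < s -> std_centred r < std_centred s.
Proof.
move=> r0 rs; pose t := (r + s) / 2.
have rt : r < t by rewrite /t; lra.
have ts : t < s by rewrite /t; lra.
have m1 : measurable (itvset `[- r, r]) by exact: measurable_itv.
have m2 : measurable (itvset `[t, s]) by exact: measurable_itv.
have := std_normalUI m1 m2.
have -> : itvset `[- r, r] `&` itvset `[t, s] = set0.
  apply/seteqP; split => // x /=; rewrite !in_itv/= => -[/andP[_ xr] /andP[tx _]].
  by have := lt_le_trans rt (le_trans tx xr); rewrite ltxx.
rewrite measure0 addr0 => h; have := std_normal_itv_gt0 ts.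
have : m (itvset `[- r, r] `|` itvset `[t, s]) <= std_centred s.
  apply: fine_probability_le; [exact: measurableU|exact: measurable_itv|].
  by move=> x /= []; rewrite !in_itv/= => /andP[x1 x2]; apply/andP; split; lra.
by rewrite h -/(std_centred r); lra.
Qed.

Lemma Phi_tail e : 0 < e -> exists x, 1 - e <= Phi x.
Proof.
move=> e0.
have [N [NA _]] := law_exists mu (@measurable_const_cV R).
have [L L0 hL] := box_tight N e0; exists L.
have mB : measurable (~` box L : set (@borel_cV R 1)).
  by apply: measurableC; exact: measurable_box.
have mpre : measurable (@const_cV R @^-1` (~` box L)).
  by rewrite -[X in measurable X]setTI; exact: measurable_const_cV.
have : 1 <= Phi L + fine (N (~` box L)).
  rewrite NA; apply: le_trans (fine_probabilityU_le mu (measurable_itv _) mpre).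
  rewrite -[X in X <= _]/(fine 1%E) -(probability_setT mu).
  apply: fine_probability_le => //; first by apply: measurableU => //; exact: measurable_itv.
  move=> x _ /=; rewrite in_itv/=; have [xL|Lx] := leP x L; [by left|right].
  move=> /(_ 0); rewrite /const_cV mxE => h.
  by have := lt_le_trans Lx (le_trans (ler_norm _) h); rewrite ltxx.
by move=> h; rewrite lerBlDr (le_trans h)// lerD2l.
Qed.

(** Phi is continuous, so the infimum that defines the quantile satisfies Phi z
    = p; p > 1 / 2 makes it positive. *)
Lemma normal_quantileP p : 2^-1 < p < 1 ->
  0 < normal_quantile p /\ std_centred (normal_quantile p) = 2 * p - 1.
Proof.
move=> /andP[p2 p1]; rewrite /normal_quantile.
set E := [set x | _]; set z := inf E.
have EE x : E x <-> p <= Phi x.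
  rewrite /E/= -lee_fin /Phi -fineP_indic; last exact: measurable_itv.
  by rewrite std_normalE.
have K0 : 0 < normal_peak (1 : R) by rewrite normal_peak_gt0.
have Phi0 : Phi 0 = 2^-1 by have := Phi_std_centred (lexx 0); rewrite std_centred0; lra.
have E0 : lbound E 0.
  move=> x /EE px; rewrite leNgt; apply/negP => x0.
  by have := Phi_mono (ltW x0); rewrite Phi0; lra.
have En0 : E !=set0.
  have [|x hx] := @Phi_tail (1 - p); first by rewrite subr_gt0.
  by exists x; apply/EE; rewrite (le_trans _ hx)//; lra.
have Einf : has_inf E by split => //; exists 0.
have z0 : 0 <= z by exact: lb_le_inf.
have Phiz : Phi z = p.
  apply/eqP; rewrite eq_le; apply/andP; split; rewrite leNgt; apply/negP => h.
  - pose y := z - (Phi z - p) / normal_peak 1.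
    have yz : y < z by rewrite /y ltrBlDr ltrDl divr_gt0// subr_gt0.
    have : E y.
      apply/EE; have := Phi_lipschitz (ltW yz).
      rewrite (_ : normal_peak 1 * _ = Phi z - p); first by lra.
      by rewrite /y; field; rewrite gt_eqF.
    by move=> /(ge_inf (ex_intro _ 0 E0)); rewrite leNgt yz.
  - pose e := (p - Phi z) / normal_peak 1.
    have e0 : 0 < e by rewrite divr_gt0// subr_gt0.
    have [x /EE Ex xz] := inf_adherent e0 Einf.
    have zx : z <= x by apply: ge_inf; [exists 0|exact/EE].
    have := Phi_lipschitz zx.
    have : normal_peak 1 * (x - z) < normal_peak 1 * e by rewrite ltr_pM2l// ltrBlDl.
    rewrite (_ : normal_peak 1 * e = p - Phi z); first by lra.
    by rewrite /e; field; rewrite gt_eqF.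
split; last by have := Phi_std_centred z0; rewrite Phiz; lra.
rewrite lt_neqAle z0 andbT; apply/negP => /eqP z00.
by move: Phiz; rewrite -z00 Phi0 => h; move: p2; rewrite h ltxx.
Qed.

Definition centred_prob v r := fine (normal_dist v (itvset `[- r, r])).

Lemma centred_prob_gt0 v r : 0 < v -> centred_prob v r = std_centred (r / Num.sqrt v).
Proof.
move=> v0; have s0 : 0 < Num.sqrt v by rewrite sqrtr_gt0.
rewrite /centred_prob /std_centred.
have := @normal_dist_scale 1 (Num.sqrt v) (itvset `[- r, r]) ler01 (measurable_itv _).
rewrite sqr_sqrtr ?(ltW v0)// mulr1 => <-; congr (fine (mu _)).
apply/seteqP; split => x /=; rewrite !in_itv/=.
  by move=> /andP[x1 x2]; rewrite -mulNr ler_pdivrMr// ler_pdivlMr// mulrC x1 x2.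
by rewrite -mulNr ler_pdivrMr// ler_pdivlMr// mulrC.
Qed.

Lemma centred_prob0 r : 0 <= r -> centred_prob 0 r = 1.
Proof.
move=> r0; rewrite /centred_prob normal_distE /normal_law eqxx diracE mem_set//=.
by rewrite in_itv/= r0 oppr_le0 r0.
Qed.

(** For v > 0 the density is bounded; for v = 0 the point mass at 0 gives
    probability one to all these intervals, because W > 0. *)
Lemma centred_prob_continuous v W e : 0 <= v -> 0 < W -> 0 < e ->
  exists eta, [/\ 0 < eta, 2 * eta < W,
    centred_prob v (W + 2 * eta) <= centred_prob v W + e &
    centred_prob v W - e <= centred_prob v (W - 2 * eta)].
Proof.
move=> v0 W0 e0; have [v00|vn] := eqVneq v 0.
  exists (W / 4); rewrite v00; split; [by rewrite divr_gt0|lra| |];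
    rewrite !centred_prob0; lra.
have {v0 vn} v0 : 0 < v by rewrite lt_neqAle eq_sym vn.
have s0 : 0 < Num.sqrt v by rewrite sqrtr_gt0.
pose K := 4 * normal_peak 1 / Num.sqrt v.
have K0 : 0 < K by rewrite divr_gt0// mulr_gt0// normal_peak_gt0.
pose eta := Num.min (W / 4) (e / K).
have eta0 : 0 < eta by rewrite lt_min; apply/andP; split; rewrite divr_gt0.
have eW : eta <= W / 4 by rewrite ge_min lexx.
have eK : K * eta <= e.
  by rewrite mulrC -ler_pdivlMr// ge_min lexx orbT.
have lip r s : 0 <= r -> r <= s -> s - r <= 2 * eta -> centred_prob v s <= centred_prob v r + e.
  move=> r0 rs h; rewrite !centred_prob_gt0//.
  have := @std_centred_lipschitz (r / Num.sqrt v) (s / Num.sqrt v).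
  rewrite divr_ge0 ?(ltW s0)// ler_pM2r ?invr_gt0// => /(_ erefl rs).
  move=> h2; apply: (le_trans h2); rewrite lerD2l (le_trans _ eK)//.
  rewrite -mulrBl (_ : K * eta = 2 * normal_peak 1 * (2 * eta / Num.sqrt v)).
    rewrite ler_wpM2l ?mulr_ge0 ?normal_peak_ge0// ler_wpM2r ?invr_ge0 ?(ltW s0)//.
  by rewrite /K; field; rewrite gt_eqF.
exists eta; split => //; first by lra.
- by apply: lip; [exact: ltW|lra|lra].
- by rewrite lerBlDr; apply: lip; lra.
Qed.

(** For v > 0 the interval is [- z sqrt (q / v), z sqrt (q / v)] in standard
    units, with z the quantile, and its probability increases strictly with the
    radius. For v = 0 both sides hold. *)
Lemma centred_prob_quantile p v q : 2^-1 < p < 1 -> 0 <= v -> 0 < q ->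
  (2 * p - 1 <= centred_prob v (normal_quantile p * Num.sqrt q)) <-> v <= q.
Proof.
move=> hp v0 q0; have [z0 Hz] := normal_quantileP hp.
have sq0 : 0 < Num.sqrt q by rewrite sqrtr_gt0.
have [->|vn] := eqVneq v 0.
  rewrite centred_prob0; last by rewrite mulr_ge0// ltW.
  by split => _; [exact: ltW|case/andP: hp => _ p1; lra].
have {v0 vn} v0 : 0 < v by rewrite lt_neqAle eq_sym vn.
have s0 : 0 < Num.sqrt v by rewrite sqrtr_gt0.
set z := normal_quantile p in z0 Hz *.
rewrite centred_prob_gt0// -Hz -(@ler_sqrt _ v q) ?(ltW q0)//.
have zz : (z <= z * Num.sqrt q / Num.sqrt v) = (Num.sqrt v <= Num.sqrt q).
  by rewrite ler_pdivlMr// ler_pM2l.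
rewrite -zz; split => h; last first.
  move: h; rewrite le_eqVlt => /predU1P[<-//|h].
  by apply/ltW/std_centred_lt => //; exact: ltW.
rewrite leNgt; apply/negP => h2.
have := std_centred_lt _ h2; rewrite divr_ge0 ?mulr_ge0 ?(ltW z0) ?(ltW sq0) ?(ltW s0)//.
by move=> /(_ erefl); rewrite ltNge h.
Qed.

End normal_intervals.

(** * The population matrices *)

(** Expand the square and use linearity. *)
Lemma quad_weighted_gram d (T : measurableType d) (R : realType) (P : probability T R) (n : nat)
    (A : 'M[R]_n) (h : T -> R) (f : 'I_n -> T -> R) a : bmeas h -> (forall i, bmeas (f i)) ->
  (forall i j, A i j = Ex P (fun t => h t * (f i t * f j t))) ->
  quad A a = Ex P (fun t => h t * (\sum_i a i 0 * f i t) ^+ 2).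
Proof.
move=> bh bf AE; rewrite quadE dotE.
have bff i j : bmeas (fun t => h t * (f i t * f j t)) by apply: bmeasM => //; exact: bmeasM.
transitivity (Ex P (fun t => \sum_i \sum_j (a i 0 * a j 0) * (h t * (f i t * f j t)))).
  rewrite Ex_sum; last by move=> i; apply: bmeas_sum => j; exact: bmeasZ.
  apply: eq_bigr => i _; rewrite Ex_sum; last by move=> j; exact: bmeasZ.
  rewrite mxE mulr_sumr; apply: eq_bigr => j _.
  by rewrite ExZ ?AE//; ring.
congr Ex; apply/funext => t; rewrite expr2 mulr_suml mulr_sumr; apply: eq_bigr => i _.
by rewrite !mulr_sumr; apply: eq_bigr => j _; ring.
Qed.

Lemma quad_gram d (T : measurableType d) (R : realType) (P : probability T R) (n : nat)
    (A : 'M[R]_n) (f : 'I_n -> T -> R) a : (forall i, bmeas (f i)) ->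
  (forall i j, A i j = Ex P (fun t => f i t * f j t)) ->
  quad A a = Ex P (fun t => (\sum_i a i 0 * f i t) ^+ 2).
Proof.
move=> bf AE; rewrite (@quad_weighted_gram _ _ _ P _ _ (fun=> 1) f)//.
- by congr Ex; apply/funext => t; rewrite mul1r.
- exact: bmeas_cst.
- by move=> i j; rewrite AE; congr Ex; apply/funext => t; rewrite mul1r.
Qed.

Section estimator.
Context {R : realType} {disp : measure_display} {Omega : measurableType disp}.
Variable P : probability Omega R.
Context {J : nat}.
Variables (w : 'I_J -> R * R -> R) (wstar : R * R -> R).
Variables (U V : nat -> {RV P >-> R}) (Y : nat -> {RV P >-> bool}).
Hypothesis hw : forall j, graphon (w j).
Hypothesis hindep : lin_indep_L2 w.
Hypothesis hwstar : graphon wstar.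
Hypothesis hdesign : independent_dyad_design wstar U V Y.

Notation sq := (unit_square R).
Notation X := (obs U V Y).
Notation EX := (EX P X).
Notation G := (Gmat w).
Notation b0 := (beta_circ w wstar).
Notation M := (Mmat w wstar).
Notation regr := (regr w).
Notation RRB := (R * R * bool)%type.

Let mX := measurable_obs U V Y.
Let indX := mutually_independent_obs hdesign.

Lemma bmeas_fst (g : R * R -> R) : bmeas g -> bmeas (fun z : RRB => g z.1).
Proof. by move=> bg; apply: (bmeas_comp measurable_fst bg). Qed.

Lemma bmeas_resp : bmeas (fun z : RRB => (z.2)%:R : R).
Proof.
have b : bmeas (fun b : bool => b%:R : R).
  by split; [|exists 1 => -[]; rewrite ?normr1 ?normr0].
by apply: (bmeas_comp measurable_snd b).
Qed.

Lemma EX_square (g : R * R -> R) : bmeas g ->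
  EX (fun z => g z.1) = \int[lebesgue2 R]_(x in sq) g x.
Proof. by move=> bg; rewrite -(Ex_UV hwstar hdesign 0%N bg). Qed.

Lemma EX_resp (g : R * R -> R) : bmeas g ->
  EX (fun z => g z.1 * (z.2)%:R) = \int[lebesgue2 R]_(x in sq) (g x * wstar x).
Proof.
move=> bg; have bgy : bmeas (fun z : RRB => g z.1 * (z.2)%:R).
  by apply: bmeasM; [exact: bmeas_fst|exact: bmeas_resp].
rewrite [LHS](Ex_obs hwstar hdesign 0%N bgy); apply: eq_Rintegral => x _ /=.
by rewrite mulr1 !mulr0 addr0 mulrC.
Qed.

Lemma bmeas_regrM i j : bmeas (fun x => regr x i 0 * regr x j 0).
Proof. by apply: bmeasM; exact: bmeas_regr. Qed.

Lemma GmatE i j : G i j = EX (fun z => regr z.1 i 0 * regr z.1 j 0).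
Proof.
rewrite (EX_square (bmeas_regrM i j)) mxE; apply: eq_Rintegral => x /set_mem sx.
by rewrite regrE.
Qed.

Lemma Gmat_sym : G^T = G.
Proof.
by apply/matrixP => i j; rewrite mxE !GmatE; congr Ex; apply/funext => omega; rewrite mulrC.
Qed.

Lemma Gmat_le1 i j : `|G i j| <= 1.
Proof.
rewrite GmatE; apply: Ex_normle.
  by apply: (bmeas_X mX) (bmeas_fst (bmeas_regrM i j)).
move=> omega; rewrite normrM -[leRHS]mulr1; apply: ler_pM => //; exact: regr_le1.
Qed.

Lemma quad_Gmat a : quad G a = EX (fun z => dot a (regr z.1) ^+ 2).
Proof.
rewrite (quad_gram a (f := fun i omega => regr (X 0%N omega).1 i 0) _ GmatE).
  by congr Ex; apply/funext => omega; rewrite dotE.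
by move=> i; apply: (bmeas_X mX 0 (bmeas_fst (bmeas_regr i hw))).
Qed.

Lemma Gmat_ge0 a : 0 <= quad G a.
Proof. by rewrite quad_Gmat; apply: Ex_ge0 => omega; exact: sqr_ge0. Qed.

(** A combination of the regressors with zero second moment vanishes almost
    everywhere, which linear independence excludes. *)
Lemma Gmat_definite a : quad G a = 0 -> a = 0.
Proof.
rewrite quad_Gmat (EX_square (g := fun x => dot a (regr x) ^+ 2)); last first.
  by apply: bmeasX; exact: bmeas_dot_regr.
move=> h; apply: hindep.
have bg : bmeas (fun x => dot a (regr x)) by exact: bmeas_dot_regr.
have bg2 := bmeasX 2 bg.
pose f (x : R * R) : \bar R := (dot a (regr x) ^+ 2)%:E.
have mg2 : measurable_fun sq f.
  by apply/measurable_EFinP; apply: measurable_funTS; exact: bg2.1.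
have h0 : (\int[lebesgue2 R]_(x in sq) `|f x| = 0)%E.
  transitivity ((\int[lebesgue2 R]_(x in sq) (dot a (regr x) ^+ 2))%:E).
    rewrite /Rintegral fineK.
      by apply: eq_integral => x _; rewrite /f/= ger0_norm ?sqr_ge0.
    have := square_integrable hdesign bg2; apply: integrable_fin_num; exact: measurable_unit_square.
  by rewrite h.
have key := @ae_eq_integral_abs _ _ R (lebesgue2 R) sq measurable_unit_square f mg2.
move/key: h0 => {key}.
apply: filterS => x hx sx; move: (hx sx) => /= -[/eqP].
by rewrite sqrf_eq0 regrE// => /eqP.
Qed.

Lemma Gmat_unit : G \in unitmx.
Proof.
apply: unitmx_ker0 => x Gx; apply: Gmat_definite.
by rewrite quadE Gx dotC dot0l.
Qed.

Lemma Gmat_gt0 a : a != 0 -> 0 < quad G a.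
Proof.
by move=> a0; rewrite lt_neqAle Gmat_ge0 andbT eq_sym; apply: contra_neq a0; exact: Gmat_definite.
Qed.

(** The estimating function of least squares: a regressor times the residual of
    the projection on the regressors. *)
Definition score i (z : RRB) : R := regr z.1 i 0 * ((z.2)%:R - dot b0 (regr z.1)).

Lemma bmeas_score i : bmeas (score i).
Proof.
apply: bmeasM; first exact: (bmeas_fst (bmeas_regr i hw)).
apply: bmeasB; first exact: bmeas_resp.
exact: (bmeas_fst (bmeas_dot_regr b0 hw)).
Qed.

Lemma Gmat_beta_circ i : (G *m b0) i 0 = \int[lebesgue2 R]_(x in sq) (regr x i 0 * wstar x).
Proof.
rewrite /beta_circ mulmxA mulmxV ?Gmat_unit// mul1mx mxE.
by apply: eq_Rintegral => x /set_mem sx; rewrite regrE.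
Qed.

(** beta_circ solves the normal equations of the population. *)
Lemma EX_score i : EX (score i) = 0.
Proof.
have br := bmeas_regr i hw; have bd := bmeas_dot_regr b0 hw.
transitivity (EX (fun z => regr z.1 i 0 * (z.2)%:R) -
    EX (fun z => regr z.1 i 0 * dot b0 (regr z.1))).
  rewrite -ExB; last 2 first.
  - apply: (bmeas_X mX 0 (g := fun z : RRB => regr z.1 i 0 * (z.2)%:R)).
    by apply: bmeasM; [exact: (bmeas_fst br)|exact: bmeas_resp].
  - exact: (bmeas_X mX 0 (bmeas_fst (bmeasM br bd))).
  by congr Ex; apply/funext => omega; rewrite /score mulrBr.
rewrite (EX_resp br) -Gmat_beta_circ mxE.
apply/eqP; rewrite subr_eq0; apply/eqP.
transitivity (\sum_j EX (fun z => b0 j 0 * (regr z.1 i 0 * regr z.1 j 0))).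
  apply: eq_bigr => j _; rewrite GmatE mulrC -ExZ//.
  by apply: (bmeas_X mX 0 (bmeas_fst (bmeas_regrM i j))).
rewrite -Ex_sum.
  congr Ex; apply/funext => omega; rewrite dotE mulr_sumr.
  by apply: eq_bigr => j _; ring.
by move=> j; apply: bmeasZ; apply: (bmeas_X mX 0 (bmeas_fst (bmeas_regrM i j))).
Qed.

(** Given (U, V) = x, the squared residual has mean sigma2 x: Bernoulli variance
    plus squared bias. *)
Lemma MmatE i j : M i j = EX (fun z => score i z * score j z).
Proof.
rewrite [RHS](Ex_obs hwstar hdesign 0%N (bmeasM (bmeas_score i) (bmeas_score j))) mxE.
apply: eq_Rintegral => x /set_mem sx.
rewrite /score /sigma2 /w_circ /comb !regrE//=; ring.
Qed.

Lemma Mmat_sym : M^T = M.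
Proof.
by apply/matrixP => i j; rewrite mxE !MmatE; congr Ex; apply/funext => omega; rewrite mulrC.
Qed.

Lemma quad_Mmat a : quad M a = EX (fun z => (\sum_i a i 0 * score i z) ^+ 2).
Proof.
apply: (quad_gram a (f := fun i omega => score i (X 0%N omega)) _ MmatE).
by move=> i; apply: (bmeas_X mX 0 (bmeas_score i)).
Qed.

Lemma Mmat_ge0 a : 0 <= quad M a.
Proof. by rewrite quad_Mmat; apply: Ex_ge0 => omega; exact: sqr_ge0. Qed.

(** The sandwich covariance of the limit law. *)
Definition asym_var := invmx G *m M *m invmx G.

Lemma invG_sym : (invmx G)^T = invmx G.
Proof. by rewrite trmx_inv Gmat_sym. Qed.

Lemma quad_asym_var a : quad asym_var a = quad M (invmx G *m a).
Proof. by rewrite /quad trmx_mul invG_sym /asym_var !mulmxA. Qed.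

Lemma psd_asym_var : psd asym_var.
Proof.
split; first by rewrite /asym_var !trmx_mul invG_sym Mmat_sym mulmxA.
by move=> a; rewrite quad_asym_var Mmat_ge0.
Qed.

Lemma quad_invG l : quad (invmx G) l = quad G (invmx G *m l).
Proof. by rewrite !quadE (mulmxA G) mulmxV ?Gmat_unit// mul1mx dotC. Qed.

Lemma quad_invG_gt0 l : l != 0 -> 0 < quad (invmx G) l.
Proof.
move=> l0; rewrite quad_invG; apply: Gmat_gt0; apply: contra_neq l0 => h.
by rewrite -(mul1mx l) -(mulmxV Gmat_unit) -mulmxA h mulmx0.
Qed.

(** * The estimator and its error *)

Variables (nu tau : R).
Hypotheses (nu0 : 0 < nu) (tau0 : 0 < tau).

Notation Sum := (Sum X).
Notation kappa := (kappa nu tau).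

Definition gram_dev i j (z : RRB) : R := regr z.1 i 0 * regr z.1 j 0 - G i j.

Lemma bmeas_gram_dev i j : bmeas (gram_dev i j).
Proof. by apply: bmeasB; [exact: (bmeas_fst (bmeas_regrM i j))|exact: bmeas_cst]. Qed.

Lemma EX_gram_dev i j : EX (gram_dev i j) = 0.
Proof.
rewrite [LHS]ExB; last 2 first.
- exact: (bmeas_X mX 0 (bmeas_fst (bmeas_regrM i j))).
- exact: bmeas_cst.
by rewrite Ex_cst GmatE subrr.
Qed.

Definition shrunk_gram m omega : 'M[R]_J.+1 := Ghat w U V m omega + (kappa m)%:M.
Notation A := shrunk_gram.

Lemma Fs_regr s omega : Fs w U V s omega = regr (X s omega).1.
Proof. by rewrite /Fs regrE//; case: hdesign => sqP _ _ _; exact: sqP. Qed.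

Lemma Ghat_entry m omega i j : Ghat w U V m omega i j =
  m%:R^-1 * \sum_(s < m) regr (X s omega).1 i 0 * regr (X s omega).1 j 0.
Proof.
rewrite /Ghat mxE summxE; congr (_ * _); apply: eq_bigr => s _.
by rewrite mxE big_ord1 [X in _ * X]mxE Fs_regr.
Qed.

Lemma Ghat_dev m omega i j : (0 < m)%N ->
  Ghat w U V m omega i j = G i j + Sum (gram_dev i j) m omega / m%:R.
Proof.
move=> m0; rewrite Ghat_entry /Sum /gram_dev sumrB sumr_const card_ord -mulr_natr.
by field; rewrite pnatr_eq0 -lt0n.
Qed.

Lemma psd_Ghat m omega : psd (Ghat w U V m omega).
Proof.
split; first by apply/matrixP => i j; rewrite mxE !Ghat_entry; congr (_ * _);
  apply: eq_bigr => s _; rewrite mulrC.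
move=> a; rewrite quadE dotE.
have -> : \sum_i a i 0 * (Ghat w U V m omega *m a) i 0 =
    m%:R^-1 * \sum_(s < m) dot a (regr (X s omega).1) ^+ 2.
  under eq_bigr => i _.
    rewrite mxE; under eq_bigr do rewrite Ghat_entry.
    rewrite (_ : _ * _ = \sum_j \sum_(s < m) m%:R^-1 *
      ((a i 0 * regr (X s omega).1 i 0) * (a j 0 * regr (X s omega).1 j 0))); last first.
      rewrite mulr_sumr; apply: eq_bigr => j _; rewrite -mulr_sumr.
      rewrite mulrC -!mulrA; congr (_ * _); rewrite mulr_suml.
      by apply: eq_bigr => s _; ring.
    over.
  rewrite mulr_sumr.
  under eq_bigr do rewrite exchange_big/=.
  rewrite exchange_big/=; apply: eq_bigr => s _.
  rewrite expr2 dotE mulr_suml mulr_sumr; apply: eq_bigr => i _.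
  by rewrite mulr_sumr mulr_sumr.
by apply: mulr_ge0; [rewrite invr_ge0|apply: sumr_ge0 => s _; exact: sqr_ge0].
Qed.

Lemma kappa_gt0 m : (0 < m)%N -> 0 < kappa m.
Proof. by move=> m0; rewrite divr_gt0// mulr_gt0 ?ltr0n// exprn_gt0. Qed.

Lemma shrunk_gram_inv m omega : (0 < m)%N ->
  A m omega \in unitmx /\ forall i j, `|invmx (A m omega) i j| <= (kappa m)^-1.
Proof. by move=> m0; apply: resolvent_bound; [exact: psd_Ghat|exact: kappa_gt0]. Qed.

(** The normalised sum of the scores, to which the central limit theorem
    applies. *)
Definition clt_sum m omega : 'cV[R]_J.+1 :=
  \col_i (Sum (score i) m omega / Num.sqrt m%:R).
Notation S := clt_sum.

(** This equals nu / (sqrt m tau^2): the bias caused by shrinkage, at the scale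
    of the fluctuations. *)
Definition ridge_bias m : R := Num.sqrt m%:R * kappa m.
Notation rho := ridge_bias.

Definition err m omega : 'cV[R]_J.+1 :=
  Num.sqrt m%:R *: (betahat w U V Y nu tau m omega - b0).

Lemma err0 omega : err 0 omega = 0.
Proof. by rewrite /err sqrtr0 scale0r. Qed.

(** The normal equations of the sample: subtracting the shrunk Gram matrix times
    beta_circ from the right-hand side leaves the sum of the scores minus the
    ridge term. *)
Lemma errE m omega : (0 < m)%N ->
  err m omega = invmx (A m omega) *m (S m omega - rho m *: b0).
Proof.
move=> m0; have [uA _] := shrunk_gram_inv omega m0.
rewrite /err /betahat -/(A m omega).
rewrite -{1}(mul1mx b0) -(mulVmx uA) -mulmxA -mulmxBr scalemxAr; congr (_ *m _).
rewrite scalerBr /A mulmxDl mul_scalar_mx scalerDr [_ *: (kappa m *: _)]scalerA -/(rho m) opprD addrA.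
congr (_ - _); apply/matrixP => i k; rewrite ord1 !mxE summxE.
have m0' : 0 < m%:R :> R by rewrite ltr0n.
set q : R := Num.sqrt m%:R; have q0 : 0 < q by rewrite sqrtr_gt0.
have qq : m%:R = q * q by rewrite -expr2 sqr_sqrtr// ltW.
under [X in _ - _ * X]eq_bigr do rewrite Ghat_entry -mulrA mulr_suml mulr_sumr.
rewrite exchange_big/= [X in _ - _ * X](_ : _ =
    m%:R^-1 * \sum_(s < m) (regr (X s omega).1 i 0 * dot b0 (regr (X s omega).1))); last first.
  rewrite mulr_sumr; apply: eq_bigr => s _; rewrite -mulr_sumr dotE.
  by congr (_ * _); rewrite mulr_sumr; apply: eq_bigr => j _; ring.
rewrite -mulrBr -mulrBr -sumrB qq /Sum invfM !mulrA divff ?gt_eqF// mul1r mulrC.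
congr (_ / _); apply: eq_bigr => s _.
by rewrite mxE Fs_regr /score /=; ring.
Qed.

(** * The rare event of a bad Gram matrix *)

Lemma bmeas_S m i : bmeas (fun omega => S m omega i 0).
Proof.
under eq_fun do rewrite mxE.
by apply: bmeasM; [exact: (bmeas_Sum mX m (bmeas_score i))|exact: bmeas_cst].
Qed.

Lemma bmeas_shrunk_gram m i j : bmeas (fun omega => A m omega i j).
Proof.
under eq_fun do rewrite mxE Ghat_entry.
apply: bmeasD; last exact: bmeas_cst.
apply: bmeasZ; apply: bmeas_sum => s; exact: (bmeas_X mX s (bmeas_fst (bmeas_regrM i j))).
Qed.

Lemma bmeas_inv_shrunk_gram m i j : (0 < m)%N ->
  bmeas (fun omega => invmx (A m omega) i j).
Proof.
move=> m0; split.
  apply: measurable_invmx; first by move=> i' j'; exact: bmeas_shrunk_gram.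
  by move=> omega; case: (shrunk_gram_inv omega m0).
by exists (kappa m)^-1 => omega; case: (shrunk_gram_inv omega m0).
Qed.

Lemma bmeas_err m i : bmeas (fun omega => err m omega i 0).
Proof.
have [->|m0] := posnP m.
  by under eq_fun do rewrite err0 mxE; exact: bmeas_cst.
under eq_fun do rewrite errE// mxE.
apply: bmeas_sum => j; apply: bmeasM; first exact: bmeas_inv_shrunk_gram.
under eq_fun do rewrite mxE; apply: bmeasD; first exact: bmeas_S.
exact: bmeas_cst.
Qed.

Lemma bmeas_dotX (D : Omega -> 'cV[R]_J.+1) a : (forall i, bmeas (fun omega => D omega i 0)) ->
  bmeas (fun omega => dot a (D omega)).
Proof.
by move=> bD; under eq_fun do rewrite dotE; apply: bmeas_sum => i; apply: bmeasZ.
Qed.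

Lemma bmeas_mulmxX (B : 'M[R]_J.+1) (D : Omega -> 'cV[R]_J.+1) i :
  (forall i, bmeas (fun omega => D omega i 0)) ->
  bmeas (fun omega => (B *m D omega) i 0).
Proof.
by move=> bD; under eq_fun do rewrite mxE; apply: bmeas_sum => j; apply: bmeasZ.
Qed.

Lemma bmeas_quadX (B : 'M[R]_J.+1) (D : Omega -> 'cV[R]_J.+1) :
  (forall i, bmeas (fun omega => D omega i 0)) -> bmeas (fun omega => quad B (D omega)).
Proof.
move=> bD; under eq_fun do rewrite quadE dotE.
by apply: bmeas_sum => i; apply: bmeasM => //; exact: bmeas_mulmxX.
Qed.

Lemma bmeas_l1X (D : Omega -> 'cV[R]_J.+1) :
  (forall i, bmeas (fun omega => D omega i 0)) -> bmeas (fun omega => l1 (D omega)).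
Proof. by move=> bD; apply: bmeas_sum => i; apply: bmeas_norm. Qed.

(** The total deviation of the empirical Gram matrix is at least dl; off this
    event every entry of Ghat is within dl of the entry of G. *)
Definition bad dl m : set Omega :=
  [set omega | m%:R * dl <= \sum_i \sum_j `|Sum (gram_dev i j) m omega|].

Lemma bmeas_total_dev m :
  bmeas (fun omega => \sum_i \sum_j `|Sum (gram_dev i j) m omega|).
Proof.
apply: bmeas_sum => i; apply: bmeas_sum => j; apply: bmeas_norm.
exact: (bmeas_Sum mX m (bmeas_gram_dev i j)).
Qed.

Lemma measurable_bad dl m : measurable (bad dl m).
Proof.
by apply: measurable_le_set; [exact: measurable_cst|exact: (bmeas_total_dev m).1].
Qed.

(** Hoeffding's inequality for each entry and a union bound. *)
Lemma bad_rare dl : 0 < dl ->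
  exists2 C, 0 <= C & forall m, (0 < m)%N -> fine (P (bad dl m)) <= C / m%:R ^+ 6.
Proof.
move=> dl0; pose n : R := J.+1%:R; have n0 : 0 < n by rewrite ltr0n.
(* n^2 entries: if all deviations are below e, their sum is below dl *)
pose e := dl / n ^+ 2; have e0 : 0 < e by rewrite divr_gt0 ?exprn_gt0.
have pair i j : exists C : R, 0 <= C /\ forall m, (0 < m)%N ->
    fine (P [set omega | m%:R * e <= `|Sum (gram_dev i j) m omega|]) <= C / m%:R ^+ 6.
  have [q q01 hq] := hoeffding_abs mX indX (Ex_obs_id hwstar hdesign)
    (bmeas_gram_dev i j) (EX_gram_dev i j) e0.
  have [C C0 hC] := geometric_decay q01; exists (2 * C); split; first by rewrite mulr_ge0.
  by move=> m m0; rewrite (le_trans (hq m))// -mulrA ler_wpM2l// hC.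
have mpair m i j : measurable [set omega | m%:R * e <= `|Sum (gram_dev i j) m omega|].
  apply: measurable_le_set; first exact: measurable_cst.
  by apply: (bmeas_norm (bmeas_Sum mX m (bmeas_gram_dev i j))).1.
have [C hC] := choice (fun p : 'I_J.+1 * 'I_J.+1 => pair p.1 p.2).
exists (\sum_i \sum_j C (i, j)).
  by apply: sumr_ge0 => i _; apply: sumr_ge0 => j _; case: (hC (i, j)).
move=> m m0.
pose f i j : Omega -> R := \1_[set omega | m%:R * e <= `|Sum (gram_dev i j) m omega|].
have bf i j : bmeas (f i j) by exact: bmeas_indic.
have f0 i j x : 0 <= f i j x by rewrite /f indicE ler0n.
apply: (@le_trans _ _ (Ex P (fun omega => \sum_i \sum_j f i j omega))).
  apply: probability_le_Ex; first exact: measurable_bad.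
  - by apply: bmeas_sum => i; apply: bmeas_sum => j.
  - by move=> x; apply: sumr_ge0 => i _; apply: sumr_ge0.
  move=> omega hbad.
  have [[i [j hij]]|no] := pselect (exists i j, m%:R * e <= `|Sum (gram_dev i j) m omega|).
    rewrite (bigD1 i)//= (bigD1 j)//= /f indicE mem_set//= -addrA lerDl.
    by rewrite addr_ge0//; apply: sumr_ge0 => *; rewrite ?sumr_ge0.
  exfalso; move: hbad; rewrite /bad/= leNgt => /negP; apply.
  have small i j : `|Sum (gram_dev i j) m omega| < m%:R * e.
    by rewrite ltNge; apply/negP => h; apply: no; exists i, j.
  have -> : m%:R * dl = \sum_(i < J.+1) \sum_(j < J.+1) m%:R * e.
    rewrite !sumr_const card_ord -[RHS]mulr_natr -[X in _ = X * _]mulr_natr -/n /e.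
    by field; rewrite gt_eqF.
  apply: ltr_sum; first by apply/hasP; exists ord0 => //; rewrite mem_index_enum.
  move=> i _; apply: ltr_sum => //.
  by apply/hasP; exists ord0 => //; rewrite mem_index_enum.
rewrite Ex_sum; last by move=> i; apply: bmeas_sum => j.
rewrite mulr_suml; apply: ler_sum => i _; rewrite Ex_sum//.
rewrite mulr_suml; apply: ler_sum => j _; rewrite Ex_indic//.
by have [_ /(_ m m0)] := hC (i, j).
Qed.

Lemma kappa_small e : 0 < e -> \forall m \near \oo, kappa m <= e.
Proof.
move=> e0; near=> m; have m0 : 0 < m%:R :> R by rewrite ltr0n; near: m; exact: nbhs_infty_gt.
rewrite /Defs.kappa ler_pdivrMr ?mulr_gt0 ?exprn_gt0// mulrCA -ler_pdivrMr ?mulr_gt0 ?exprn_gt0//.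
by near: m; exact: nbhs_infty_ger.
Unshelve. all: by end_near. Qed.

Lemma ridge_bias_small c e : 0 <= c -> 0 < e -> \forall m \near \oo, rho m * c <= e.
Proof.
move=> c0 e0; near=> m; have m0 : 0 < m%:R :> R by rewrite ltr0n; near: m; exact: nbhs_infty_gt.
set q : R := Num.sqrt m%:R; have q0 : 0 < q by rewrite sqrtr_gt0.
have qq : m%:R = q * q by rewrite -expr2 sqr_sqrtr// ltW.
rewrite /ridge_bias /Defs.kappa -/q qq.
have -> : q * (nu / (q * q * tau ^+ 2)) * c = nu * c / tau ^+ 2 / q.
  by field; rewrite !gt_eqF.
have a0 : 0 <= nu * c / tau ^+ 2 by rewrite divr_ge0 ?mulr_ge0 ?sqr_ge0// ltW.
rewrite ler_pdivrMr// -ler_pdivrMl//.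
have a1 : 0 <= e^-1 * (nu * c / tau ^+ 2) by rewrite mulr_ge0// invr_ge0 ltW.
rewrite -ler_sqr ?nnegrE ?(ltW q0)//.
rewrite [leRHS]expr2 -qq; near: m; exact: nbhs_infty_ger.
Unshelve. all: by end_near. Qed.

Lemma inv_shrunk_gram_close e : 0 < e -> exists2 dl, 0 < dl &
  \forall m \near \oo, forall omega, ~ bad dl m omega ->
    forall y, l1 (invmx (A m omega) *m y - invmx G *m y) <= e * l1 y.
Proof.
move=> e0; have [dl0 dl00 h] := invmx_perturb Gmat_unit e0.
have dl20 : 0 < dl0 / 2 by rewrite divr_gt0.
exists (dl0 / 2) => //; near=> m => omega nbad y.
have m0 : (0 < m)%N by near: m; exact: nbhs_infty_gt.
have m0' : 0 < m%:R :> R by rewrite ltr0n.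
have [//|_ +] := h (A m omega); last exact.
move=> i j; rewrite mxE Ghat_dev//.
have -> : G i j + Sum (gram_dev i j) m omega / m%:R + (kappa m)%:M i j - G i j =
    Sum (gram_dev i j) m omega / m%:R + (kappa m)%:M i j by ring.
rewrite (le_trans (ler_normD _ _))// [leRHS](_ : _ = dl0 / 2 + dl0 / 2); last by field.
apply: lerD.
  rewrite normrM normfV (ger0_norm (ltW m0')) ler_pdivrMr// mulrC.
  have : \sum_i \sum_j `|Sum (gram_dev i j) m omega| <= m%:R * (dl0 / 2).
    by rewrite ltW// ltNge; apply/negP.
  apply: le_trans; rewrite (bigD1 i)//= (bigD1 j)//= -addrA lerDl.
  by rewrite addr_ge0//; apply: sumr_ge0 => *; rewrite ?sumr_ge0.
rewrite mxE; have k0 := ltW (kappa_gt0 m0).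
apply: (@le_trans _ _ (kappa m)).
  by case: (i == j); rewrite ?mulr1n ?mulr0n ?normr0// ger0_norm.
by near: m; exact: kappa_small.
Unshelve. all: by end_near. Qed.

(** * Moments and size of the error *)

Lemma rho_ge0 m : 0 <= rho m.
Proof.
have [->|m0] := posnP m; first by rewrite /ridge_bias sqrtr0 mul0r.
by rewrite mulr_ge0// ltW// kappa_gt0.
Qed.

(** The error differs from G^-1 S by the perturbation of the inverse, of
    relative size e, and by the ridge bias, which tends to 0. *)
Lemma err_close e : 0 < e -> exists2 dl, 0 < dl &
  \forall m \near \oo, forall omega, ~ bad dl m omega ->
    l1 (err m omega - invmx G *m S m omega) <= e * (l1 (S m omega) + 1).
Proof.
move=> e0; have e20 : 0 < e / 2 by rewrite divr_gt0.
have [dl dl0 hdl] := inv_shrunk_gram_close e20; exists dl => //.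
near=> m => omega nbad.
have m0 : (0 < m)%N by near: m; exact: nbhs_infty_gt.
have h1 : rho m * l1 b0 <= 1.
  by near: m; apply: ridge_bias_small; [exact: l1_ge0|exact: ltr01].
have h2 : rho m * l1 (invmx G *m b0) <= e / 2.
  by near: m; apply: ridge_bias_small => //; exact: l1_ge0.
have close : forall omega, ~ bad dl m omega ->
    forall y, l1 (invmx (A m omega) *m y - invmx G *m y) <= e / 2 * l1 y.
  by near: m.
rewrite errE//; set y := S m omega - rho m *: b0.
have -> : invmx (A m omega) *m y - invmx G *m S m omega =
    (invmx (A m omega) *m y - invmx G *m y) - rho m *: (invmx G *m b0).
  have -> : invmx G *m S m omega = invmx G *m y + rho m *: (invmx G *m b0).
    by rewrite mulmxBr -scalemxAr subrK.
  by rewrite opprD addrA.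
rewrite (le_trans (l1B _ _))// l1Z (ger0_norm (rho_ge0 m)).
have hy : l1 y <= l1 (S m omega) + 1.
  by rewrite (le_trans (l1B _ _))// lerD2l l1Z (ger0_norm (rho_ge0 m)).
have := close omega nbad y; have := l1_ge0 (S m omega).
have : e / 2 * l1 y <= e / 2 * (l1 (S m omega) + 1) by rewrite ler_wpM2l// ltW.
move: h2; set u := l1 (_ - _); set v := rho m * l1 _; set s := l1 (S m omega).
move=> h2 h3 s0 h4; have : 0 <= e / 2 * s by rewrite mulr_ge0// ltW.
rewrite (_ : e * (s + 1) = e / 2 * (s + 1) + (e / 2 * s + e / 2)); last by field.
by move=> h5; apply: lerD; [exact: le_trans h4 h3|rewrite (le_trans h2)// lerDr].
Unshelve. all: by end_near. Qed.

Lemma Ex_SM m i j : (0 < m)%N -> Ex P (fun omega => S m omega i 0 * S m omega j 0) = M i j.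
Proof.
move=> m0; have m0' : 0 < m%:R :> R by rewrite ltr0n.
have q0 : 0 < Num.sqrt m%:R :> R by rewrite sqrtr_gt0.
transitivity (Ex P (fun omega => m%:R^-1 * (Sum (score i) m omega * Sum (score j) m omega))).
  congr Ex; apply/funext => omega; rewrite !mxE.
  have -> : m%:R^-1 = (Num.sqrt m%:R)^-1 * (Num.sqrt m%:R)^-1 :> R.
    by rewrite -invfM -expr2 sqr_sqrtr// ltW.
  by ring.
rewrite ExZ; last by apply: bmeasM; exact: (bmeas_Sum mX m (bmeas_score _)).
rewrite (Ex_SumM mX indX (Ex_obs_id hwstar hdesign) m (bmeas_score i) (bmeas_score j)
  (EX_score i) (EX_score j)) -MmatE.
by rewrite mulrA mulVf ?mul1r// gt_eqF.
Qed.

Lemma bmeas_weight m : bmeas (fun omega => (l1 (S m omega) + 1) ^+ 2).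
Proof.
by apply: bmeasX; apply: bmeasD; [exact: bmeas_l1X (bmeas_S m)|exact: bmeas_cst].
Qed.

(** A bound, uniform in m, for the mean of the weight (l1 (S m) + 1)^2. *)
Definition weight_bound : R := 2 * (J.+1%:R * \sum_i M i i) + 2.

Lemma weight_bound_ge0 : 0 <= weight_bound.
Proof.
rewrite addr_ge0// mulr_ge0// mulr_ge0//; apply: sumr_ge0 => i _; rewrite MmatE.
by apply: Ex_ge0 => omega; rewrite -expr2 sqr_ge0.
Qed.

Lemma Ex_weight m : (0 < m)%N ->
  Ex P (fun omega => (l1 (S m omega) + 1) ^+ 2) <= weight_bound.
Proof.
move=> m0; have bSS i : bmeas (fun omega => S m omega i 0 ^+ 2).
  by apply: bmeasX; exact: bmeas_S.
apply: (@le_trans _ _ (Ex P (fun omega => 2 * (J.+1%:R * \sum_i S m omega i 0 ^+ 2) + 2))).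
  apply: Ex_le; first exact: bmeas_weight.
    apply: bmeasD; last exact: bmeas_cst.
    by apply: bmeasZ; apply: bmeasZ; exact: bmeas_sum.
  move=> omega; have := l1_sq_le (S m omega); have := sqr_ge0 (l1 (S m omega) - 1).
  set s := l1 _; set q := _ * \sum_i _; rewrite !expr2; nra.
rewrite ExD; last 2 first.
- by apply: bmeasZ; apply: bmeasZ; exact: bmeas_sum.
- exact: bmeas_cst.
rewrite Ex_cst ExZ; last by apply: bmeasZ; exact: bmeas_sum.
rewrite ExZ; last exact: bmeas_sum.
rewrite Ex_sum// /weight_bound.
by under eq_bigr do rewrite (Ex_SM _ _ m0).
Qed.

Lemma l1_S_le : exists2 K, 0 <= K & forall m omega, (0 < m)%N -> l1 (S m omega) <= K * m%:R.
Proof.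
have bs i : exists K : R, forall z, `|score i z| <= K by case: (bmeas_score i).
have [K hK] := choice bs; pose K1 := \sum_i `|K i|.
exists K1; first exact: sumr_ge0.
move=> m omega m0; have m0' : 0 < m%:R :> R by rewrite ltr0n.
rewrite /K1 mulr_suml; apply: ler_sum => i _; rewrite mxE normrM normfV.
set q : R := Num.sqrt m%:R; have q1 : 1 <= q by rewrite -[leLHS]sqrtr1 ler_wsqrtr// ler1n.
have q0 : 0 < q by rewrite (lt_le_trans ltr01).
rewrite (ger0_norm (ltW q0)) ler_pdivrMr//.
apply: (@le_trans _ _ (`|K i| * m%:R)).
  rewrite (le_trans (ler_norm_sum _ _ _))// mulr_natr -[X in _ *+ X]card_ord -sumr_const.
  by apply: ler_sum => s _; rewrite (le_trans (hK i _))// ler_norm.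
by rewrite ler_peMr// mulr_ge0.
Qed.

(** Shrinkage bounds the entries of the inverse by m tau^2 / nu, whatever the
    sample. *)
Lemma err_le : exists2 K, 0 <= K & forall m omega, (0 < m)%N ->
  l1 (err m omega) <= K * m%:R ^+ 2.
Proof.
have [K K0 hK] := l1_S_le; pose c := nu / tau ^+ 2 * l1 b0.
have c0 : 0 <= c by rewrite mulr_ge0 ?l1_ge0// divr_ge0 ?sqr_ge0// ltW.
have t0 : 0 < tau ^+ 2 by rewrite exprn_gt0.
exists (J.+1%:R * (tau ^+ 2 / nu) * (K + c)).
  by rewrite mulr_ge0 ?addr_ge0// mulr_ge0// divr_ge0// ltW.
move=> m omega m0; have m0' : 0 < m%:R :> R by rewrite ltr0n.
have m1 : 1 <= m%:R :> R by rewrite ler1n.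
rewrite errE//; have [_ hA] := shrunk_gram_inv omega m0.
rewrite (le_trans (l1_mulmx _ hA))//.
have -> : (kappa m)^-1 = m%:R * (tau ^+ 2 / nu).
  by rewrite /Defs.kappa; field; rewrite !gt_eqF.
have hS : l1 (S m omega - rho m *: b0) <= (K + c) * m%:R.
  rewrite (le_trans (l1B _ _))// mulrDl lerD// ?hK// l1Z (ger0_norm (rho_ge0 m)).
  rewrite /c [leRHS]mulrAC ler_wpM2r ?l1_ge0// /ridge_bias /Defs.kappa.
  set q : R := Num.sqrt m%:R; have q1 : 1 <= q by rewrite -[leLHS]sqrtr1 ler_wsqrtr.
  have qq : m%:R = q * q by rewrite -expr2 sqr_sqrtr// ltW.
  have q0 : 0 < q by rewrite (lt_le_trans ltr01).
  rewrite [leLHS](_ : _ = nu / tau ^+ 2 * q^-1); last first.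
    by rewrite qq; field; rewrite !gt_eqF.
  rewrite ler_wpM2l ?divr_ge0 ?(ltW t0) ?(ltW nu0)//.
  by rewrite (le_trans _ m1)// invf_le1.
apply: (@le_trans _ _ (J.+1%:R * (m%:R * (tau ^+ 2 / nu)) * ((K + c) * m%:R))).
  by rewrite ler_wpM2l// mulr_ge0// mulr_ge0 ?(ltW m0')// divr_ge0// ltW.
by rewrite expr2 le_eqVlt; apply/orP; left; apply/eqP; ring.
Qed.

(** A quantity that is small compared with the weight off the bad event
    contributes little because the weight has bounded mean; on the bad event its
    size m^4 is beaten by the probability, of order m^-6. *)
Lemma vanishing_mean (Z : nat -> Omega -> R) C :
  (forall m, bmeas (Z m)) ->
  (forall m omega, (0 < m)%N -> `|Z m omega| <= C * m%:R ^+ 4) ->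
  (forall e, 0 < e -> exists2 dl, 0 < dl & \forall m \near \oo, forall omega,
     ~ bad dl m omega -> `|Z m omega| <= e * (l1 (S m omega) + 1) ^+ 2) ->
  Ex P (Z m) @[m --> \oo] --> 0.
Proof.
move=> bZ ZC small; apply/cvgrPdist_le => e e0.
pose e1 := e / (2 * (weight_bound + 1)).
have W0 : 0 < weight_bound + 1 by rewrite ltr_wpDl ?weight_bound_ge0.
have e10 : 0 < e1 by rewrite divr_gt0// mulr_gt0.
have [dl dl0 hdl] := small _ e10; have [B B0 hB] := bad_rare dl0.
pose C1 := `|C| + 1; have C10 : 0 < C1 by rewrite ltr_wpDl.
near=> m; have m0 : (0 < m)%N by near: m; exact: nbhs_infty_gt.
have m0' : 0 < m%:R :> R by rewrite ltr0n.
have m1 : 1 <= m%:R :> R by rewrite ler1n.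
have close : forall omega, ~ bad dl m omega ->
    `|Z m omega| <= e1 * (l1 (S m omega) + 1) ^+ 2 by near: m.
rewrite sub0r normrN (le_trans (Ex_norm P (bZ m)))//.
have bi : bmeas (\1_(bad dl m) : Omega -> R) by apply: bmeas_indic; exact: measurable_bad.
apply: (@le_trans _ _ (Ex P (fun omega => e1 * (l1 (S m omega) + 1) ^+ 2 +
    (C1 * m%:R ^+ 4) * \1_(bad dl m) omega))).
  apply: Ex_le; first exact: bmeas_norm.
    by apply: bmeasD; apply: bmeasZ => //; exact: bmeas_weight.
  move=> omega; have wt : 0 <= e1 * (l1 (S m omega) + 1) ^+ 2.
    by rewrite mulr_ge0 ?sqr_ge0// ltW.
  rewrite indicE; case: (boolP (omega \in _)) => [_|/negP nb]; last first.
    by rewrite mulr0 addr0 close// => hb; apply: nb; exact/mem_set.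
  rewrite mulr1 -[leLHS]add0r lerD// (le_trans (ZC m omega m0))//.
  by rewrite ler_wpM2r ?exprn_ge0 ?(ltW m0')// /C1 (le_trans (ler_norm _))// lerDl.
rewrite ExD; [|by apply: bmeasZ; exact: bmeas_weight|exact: bmeasZ].
rewrite ExZ; last exact: bmeas_weight.
rewrite ExZ// Ex_indic; last exact: measurable_bad.
have h1 : e1 * Ex P (fun omega => (l1 (S m omega) + 1) ^+ 2) <= e / 2.
  apply: (@le_trans _ _ (e1 * (weight_bound + 1))).
    by rewrite ler_wpM2l ?(ltW e10)// (le_trans (Ex_weight m0))// lerDl.
  by rewrite /e1 le_eqVlt; apply/orP; left; apply/eqP; field; rewrite gt_eqF.
have h2 : C1 * m%:R ^+ 4 * fine (P (bad dl m)) <= e / 2.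
  apply: (@le_trans _ _ (C1 * m%:R ^+ 4 * (B / m%:R ^+ 6))).
    by rewrite ler_wpM2l ?hB// mulr_ge0 ?exprn_ge0 ?(ltW C10)// ltW.
  rewrite [leLHS](_ : _ = (C1 * B / m%:R) / m%:R); last by field; rewrite gt_eqF.
  apply: (@le_trans _ _ (C1 * B / m%:R)).
    rewrite ler_pdivrMr// ler_peMr// divr_ge0 ?(ltW m0')// mulr_ge0// ltW//.
  rewrite ler_pdivrMr// -ler_pdivrMl ?divr_gt0//.
  by near: m; exact: nbhs_infty_ger.
by rewrite [leRHS](_ : _ = e / 2 + e / 2); [exact: lerD|field].
Unshelve. all: by end_near. Qed.

(** * Asymptotic normality *)

Lemma bad_small dl e : 0 < dl -> 0 < e -> \forall m \near \oo, fine (P (bad dl m)) <= e.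
Proof.
move=> dl0 e0; have [B B0 hB] := bad_rare dl0; near=> m.
have m0 : (0 < m)%N by near: m; exact: nbhs_infty_gt.
have m0' : 0 < m%:R :> R by rewrite ltr0n.
rewrite (le_trans (hB m m0))// ler_pdivrMr ?exprn_gt0//.
apply: (@le_trans _ _ (e * m%:R)); last first.
  by rewrite ler_wpM2l ?(ltW e0)// exprS ler_peMr ?(ltW m0')// exprn_ege1// ler1n.
by rewrite -ler_pdivrMl//; near: m; exact: nbhs_infty_ger.
Unshelve. all: by end_near. Qed.

Lemma invG_l1 : exists2 c, 0 <= c & forall y, l1 (invmx G *m y) <= c * l1 y.
Proof.
pose c := \sum_i \sum_j `|invmx G i j|.
have c0 : 0 <= c by apply: sumr_ge0 => i _; exact: sumr_ge0.
exists (J.+1%:R * c); first by rewrite mulr_ge0.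
move=> y; apply: l1_mulmx => i j.
rewrite /c (bigD1 i)//= (bigD1 j)//= -addrA lerDl addr_ge0//; first exact: sumr_ge0.
by apply: sumr_ge0 => k _; exact: sumr_ge0.
Qed.

(** Needed for h = cos and h = sin, to replace the error by G^-1 S in
    characteristic functions. *)
Lemma trig_err_close (h : R -> R) t : continuous h -> (forall x, `|h x| <= 1) ->
  (forall x y, `|h x - h y| <= `|x - y|) ->
  Ex P (fun omega => h (dot t (err m omega)) - h (dot t (invmx G *m S m omega)))
    @[m --> \oo] --> 0.
Proof.
move=> ch h1 hl.
have bD1 m : bmeas (fun omega => dot t (err m omega)) by exact: bmeas_dotX (bmeas_err m).
have bD2 m : bmeas (fun omega => dot t (invmx G *m S m omega)).
  by apply: bmeas_dotX => i; exact: bmeas_mulmxX (bmeas_S m).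
apply: (@vanishing_mean _ 2).
- by move=> m; apply: bmeasB; apply: bmeas_comp_cont.
- move=> m omega m0; rewrite (le_trans (ler_normB _ _))//.
  apply: (@le_trans _ _ 2); first by rewrite [leRHS](_ : _ = 1 + 1)// lerD.
  by rewrite ler_peMr// exprn_ege1// ler1n.
move=> e e0; pose e1 := e / (l1 t + 1).
have t0 : 0 < l1 t + 1 by rewrite ltr_wpDl ?l1_ge0.
have [dl dl0 hdl] := err_close (divr_gt0 e0 t0); exists dl => //.
apply: filterS hdl => m hm omega nb; rewrite (le_trans (hl _ _))//.
have -> : dot t (err m omega) - dot t (invmx G *m S m omega) =
    dot t (err m omega - invmx G *m S m omega) by rewrite dotDr dotNr.
rewrite (le_trans (dot_l1 _ _))//.
have s1 : 1 <= l1 (S m omega) + 1 by rewrite lerDr l1_ge0.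
apply: (@le_trans _ _ ((l1 t + 1) * (e / (l1 t + 1) * (l1 (S m omega) + 1)))).
  by apply: ler_pM; rewrite ?l1_ge0 ?hm// lerDl.
rewrite mulrA [_ * (e / _)](_ : _ = e); last by field; rewrite gt_eqF.
by rewrite ler_wpM2l ?(ltW e0)// expr2 ler_peMr// (le_trans ler01).
Qed.

Lemma inv_sqrt_cvg0 (C : R) : C / Num.sqrt m%:R @[m --> \oo] --> 0.
Proof.
apply/cvgrPdist_le => e e0; near=> m.
have m0 : 0 < m%:R :> R by rewrite ltr0n; near: m; exact: nbhs_infty_gt.
rewrite sub0r normrN normrM normfV (ger0_norm (sqrtr_ge0 _)).
rewrite ler_pdivrMr ?sqrtr_gt0// -ler_pdivrMl//.
rewrite -ler_sqr ?nnegrE ?sqrtr_ge0 ?mulr_ge0 ?invr_ge0 ?(ltW e0)// sqr_sqrtr ?(ltW m0)//.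
by near: m; exact: nbhs_infty_ger.
Unshelve. all: by end_near. Qed.

Definition lin_score (a : 'cV[R]_J.+1) (z : RRB) : R := \sum_i a i 0 * score i z.

Lemma bmeas_lin_score a : bmeas (lin_score a).
Proof. by apply: bmeas_sum => i; apply: bmeasZ; exact: bmeas_score. Qed.

Lemma EX_lin_score a : EX (lin_score a) = 0.
Proof.
have b i : bmeas (fun omega => score i (X 0%N omega)) := bmeas_X mX 0 (bmeas_score i).
rewrite [LHS]Ex_sum; last by move=> i; exact: bmeasZ.
by rewrite big1// => i _; rewrite ExZ// [Ex _ _]EX_score mulr0.
Qed.

Lemma dot_clt_sum a m omega :
  dot a (S m omega) = Sum (lin_score a) m omega / Num.sqrt m%:R.
Proof.
rewrite dotE /Sum /lin_score exchange_big/= mulr_suml.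
by apply: eq_bigr => i _; rewrite mxE -mulr_sumr mulrA.
Qed.

(** A linear functional of G^-1 S is a normalised sum of i.i.d. scores with
    variance quad asym_var t. *)
Lemma cf_clt_sum t :
  Ex P (fun omega => cos (dot t (invmx G *m S m omega))) @[m --> \oo] -->
    expR (- (quad asym_var t / 2)) /\
  Ex P (fun omega => sin (dot t (invmx G *m S m omega))) @[m --> \oo] --> 0.
Proof.
have dE m omega : dot t (invmx G *m S m omega) =
    Sum (lin_score (invmx G *m t)) m omega / Num.sqrt m%:R.
  by rewrite -dot_clt_sum (dot_mul_sym _ _ invG_sym) dotC.
have [C hC] := cf_clt mX indX (Ex_obs_id hwstar hdesign) (bmeas_lin_score (invmx G *m t))
  (EX_lin_score _).
have qE : EX (fun z => lin_score (invmx G *m t) z ^+ 2) = quad asym_var t.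
  by rewrite quad_asym_var quad_Mmat.
split; apply/cvgrPdist_le => e e0; near=> m;
  have m0 : (0 < m)%N by [near: m; exact: nbhs_infty_gt];
  have [h1 h2] := hC m m0;
  have hm : `|C / Num.sqrt m%:R| <= e by
    [near: m; have /cvgrPdist_le/(_ _ e0) := inv_sqrt_cvg0 C;
     apply: filterS => m; rewrite sub0r normrN].
- under [X in Ex P X]eq_fun do rewrite dE; rewrite distrC -qE (le_trans h1)//.
  by rewrite (le_trans (ler_norm _)).
- under [X in Ex P X]eq_fun do rewrite dE; rewrite sub0r normrN (le_trans h2)//.
  by rewrite (le_trans (ler_norm _)).
Unshelve. all: by end_near. Qed.

Lemma cf_err t :
  Ex P (fun omega => cos (dot t (err m omega))) @[m --> \oo] -->
    expR (- (quad asym_var t / 2)) /\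
  Ex P (fun omega => sin (dot t (err m omega))) @[m --> \oo] --> 0.
Proof.
have [c1 c2] := cf_clt_sum t.
have bD1 m : bmeas (fun omega => dot t (err m omega)) by exact: bmeas_dotX (bmeas_err m).
have bD2 m : bmeas (fun omega => dot t (invmx G *m S m omega)).
  by apply: bmeas_dotX => i; exact: bmeas_mulmxX (bmeas_S m).
have transfer (h : R -> R) (l : R) : continuous h -> (forall x, `|h x| <= 1) ->
    (forall x y, `|h x - h y| <= `|x - y|) ->
    Ex P (fun omega => h (dot t (invmx G *m S m omega))) @[m --> \oo] --> l ->
    Ex P (fun omega => h (dot t (err m omega))) @[m --> \oo] --> l.
  move=> ch h1 hl cl; have cd := trig_err_close t ch h1 hl.
  rewrite (_ : (fun m => Ex P (fun omega => h (dot t (err m omega)))) = (fun m =>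
    Ex P (fun omega => h (dot t (err m omega)) - h (dot t (invmx G *m S m omega))) +
    Ex P (fun omega => h (dot t (invmx G *m S m omega))))).
    by rewrite -[l]add0r; exact: cvgD.
  by apply/funext => m; rewrite ExB ?subrK//; apply: bmeas_comp_cont.
split.
- apply: transfer c1; [exact: continuous_cos|exact: cos_max|move=> x y].
  rewrite -[leRHS]mul1r; apply: (@mvt_norm _ cos (fun z => - sin z)) => z.
  by move=> _; rewrite normrN sin_max.
- apply: transfer c2; [exact: continuous_sin|exact: sin_max|move=> x y].
  rewrite -[leRHS]mul1r; apply: (@mvt_norm _ sin cos) => z.
  by move=> _; rewrite cos_max.
Qed.

Lemma measurable_err m : measurable_fun setT (err m : Omega -> @borel_cV R J.+1).
Proof. by apply: measurable_cV => i; exact: (bmeas_err m i).1. Qed.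

(** Off the bad event the error is at most a multiple of l1 S + 1, which has a
    bounded second moment. *)
Lemma err_tight e : 0 < e -> exists L : R,
  \forall m \near \oo, fine (P [set omega | ~ box L (err m omega)]) <= e.
Proof.
move=> e0; have e20 : 0 < e / 2 by rewrite divr_gt0.
have [c c0 hc] := invG_l1; have [dl dl0 hdl] := err_close ltr01.
pose k := (c + 1) ^+ 2 * weight_bound.
have k0 : 0 <= k by rewrite mulr_ge0 ?sqr_ge0 ?weight_bound_ge0.
(* Markov's inequality bounds the tail by k / L^2 <= k / L <= e / 2 *)
pose L := 1 + k / (e / 2).
have L1 : 1 <= L by rewrite lerDl divr_ge0// ltW.
have L0 : 0 < L by rewrite (lt_le_trans ltr01).
exists L; near=> m; have m0 : (0 < m)%N by near: m; exact: nbhs_infty_gt.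
have close : forall omega, ~ bad dl m omega ->
    l1 (err m omega - invmx G *m S m omega) <= 1 * (l1 (S m omega) + 1) by near: m.
have hbad : fine (P (bad dl m)) <= e / 2 by near: m; exact: bad_small.
have bi : bmeas (\1_(bad dl m) : Omega -> R) by apply: bmeas_indic; exact: measurable_bad.
have mbox : measurable [set omega | ~ box L (err m omega)].
  rewrite -[X in measurable X]setTI.
  have mB : measurable (~` box L : set (@borel_cV R J.+1)).
    by apply: measurableC; exact: measurable_box.
  exact: (measurable_err m measurableT mB).
apply: (@le_trans _ _ (Ex P (fun omega => \1_(bad dl m) omega +
    ((c + 1) / L) ^+ 2 * (l1 (S m omega) + 1) ^+ 2))).
  apply: probability_le_Ex => //.
  - by apply: bmeasD => //; apply: bmeasZ; exact: bmeas_weight.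
  - by move=> x; apply: addr_ge0; [rewrite indicE|apply: mulr_ge0; exact: sqr_ge0].
  move=> omega nbox; rewrite indicE; case: (boolP (omega \in _)) => [_|/negP nb].
    by rewrite lerDl; apply: mulr_ge0; exact: sqr_ge0.
  rewrite add0r -exprMn; have nb' : ~ bad dl m omega by move=> h; apply: nb; exact/mem_set.
  have hL : L <= (c + 1) * (l1 (S m omega) + 1).
    rewrite leNgt; apply/negP => hL; apply: nbox => i.
    rewrite (le_trans (coord_le_l1 _ _))// (le_trans _ (ltW hL))//.
    rewrite -[err m omega](subrK (invmx G *m S m omega)) (le_trans (l1D _ _))//.
    rewrite mulrDl addrC lerD// ?close//.
    by rewrite (le_trans (hc _))// ler_wpM2l// lerDl.
  by rewrite -mulrA mulrCA exprn_ege1// mulrC ler_pdivlMr// mul1r.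
rewrite ExD//; last by apply: bmeasZ; exact: bmeas_weight.
rewrite ExZ; last exact: bmeas_weight.
rewrite Ex_indic; last exact: measurable_bad.
rewrite [leRHS](_ : _ = e / 2 + e / 2); last by field.
apply: lerD => //; apply: (@le_trans _ _ (((c + 1) / L) ^+ 2 * weight_bound)).
  by rewrite ler_wpM2l ?sqr_ge0// Ex_weight.
rewrite exprMn mulrAC -/k exprVn ler_pdivrMr ?exprn_gt0//.
have kL : k <= e / 2 * L.
  rewrite /L mulrDr mulr1 [X in _ + X](_ : _ = k); last by field; rewrite gt_eqF.
  by rewrite lerDr ltW.
by rewrite (le_trans kL)// ler_wpM2l ?(ltW e20)// expr2 ler_peMr// ltW.
Unshelve. all: by end_near. Qed.

(** Levy's theorem, with the limits of the characteristic functions from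
    [cf_err]. *)
Theorem clt_err : exists N : probability (@borel_cV R J.+1) R,
  is_mvnormal N 0 asym_var /\
  forall f : 'cV[R]_J.+1 -> R, continuous f -> (exists K, forall x, `|f x| <= K) ->
    Ex P (fun omega => f (err m omega)) @[m --> \oo] --> Ex N f.
Proof.
have [N hN] := normal_cf_exists psd_asym_var; exists N.
split; first exact: normal_cf_mvnormal psd_asym_var hN.
apply: levy => //.
- exact: measurable_err.
- by move=> t; have [-> _] := hN t; exact: (cf_err t).1.
- by move=> t; have [_ ->] := hN t; exact: (cf_err t).2.
- exact: err_tight.
Qed.

(** * Risk and posterior covariance *)

(** The function sigma2, extended from the square to a globally measurable
    function. *)
Definition noise (x : R * R) : R :=
  sqext wstar x * (1 - sqext wstar x) + (sqext wstar x - dot b0 (regr x)) ^+ 2.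

Lemma noiseE x : sq x -> noise x = sigma2 w wstar x.
Proof. by move=> sx; rewrite /noise /sigma2 /w_circ /comb sqextE// regrE. Qed.

Lemma bmeas_noise : bmeas noise.
Proof.
have bw := bmeas_graphon hwstar.
apply: bmeasD; first by apply: bmeasM => //; apply: bmeasB => //; exact: bmeas_cst.
by apply: bmeasX; apply: bmeasB => //; exact: bmeas_dot_regr.
Qed.

Lemma integral_noise (g : R * R -> R) : bmeas g ->
  \int[lebesgue2 R]_(x in sq) (sigma2 w wstar x * g x) = EX (fun z => noise z.1 * g z.1).
Proof.
move=> bg; rewrite (EX_square (g := fun x => noise x * g x)); last exact: bmeasM bmeas_noise bg.
by apply: eq_Rintegral => x /set_mem sx; rewrite noiseE.
Qed.

Lemma Mmat_noise i j :
  M i j = EX (fun z => noise z.1 * (regr z.1 i 0 * regr z.1 j 0)).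
Proof.
rewrite -(integral_noise (bmeas_regrM i j)) mxE.
by apply: eq_Rintegral => x /set_mem sx; rewrite regrE.
Qed.

(** Expanding the quadratic form under the integral identifies c(wstar) as the
    trace of G^-1 M. *)
Lemma cstarE : cstar w wstar = \sum_i \sum_j invmx G i j * M i j.
Proof.
have bq : bmeas (fun x => quad (invmx G) (regr x)).
  under eq_fun do rewrite quadE dotE; apply: bmeas_sum => i.
  apply: bmeasM; first exact: bmeas_regr.
  under eq_fun do rewrite mxE; apply: bmeas_sum => j; apply: bmeasZ.
  exact: bmeas_regr.
transitivity (\int[lebesgue2 R]_(x in sq) (sigma2 w wstar x * quad (invmx G) (regr x))).
  by apply: eq_Rintegral => x /set_mem sx; rewrite regrE.
have bb i j : bmeas (fun omega => noise (X 0%N omega).1 *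
    (regr (X 0%N omega).1 i 0 * regr (X 0%N omega).1 j 0)).
  exact: (bmeas_X mX 0 (bmeas_fst (bmeasM bmeas_noise (bmeas_regrM i j)))).
rewrite (integral_noise bq).
transitivity (Ex P (fun omega => \sum_i \sum_j invmx G i j * (noise (X 0%N omega).1 *
    (regr (X 0%N omega).1 i 0 * regr (X 0%N omega).1 j 0)))).
  congr Ex; apply/funext => omega; rewrite quadE dotE mulr_sumr.
  apply: eq_bigr => i _; rewrite [(_ *m _) i 0]mxE !mulr_sumr; apply: eq_bigr => j _; ring.
rewrite Ex_sum; last by move=> i; apply: bmeas_sum => j; exact: bmeasZ.
apply: eq_bigr => i _; rewrite Ex_sum; last by move=> j; exact: bmeasZ.
by apply: eq_bigr => j _; rewrite ExZ// Mmat_noise.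
Qed.

Lemma quad_Gmat_le x : `|quad G x| <= J.+1%:R * l1 x ^+ 2.
Proof.
rewrite quadE (le_trans (dot_l1 _ _))//.
apply: (@le_trans _ _ (l1 x * (J.+1%:R * 1 * l1 x))).
  by rewrite ler_wpM2l ?l1_ge0// l1_mulmx//; exact: Gmat_le1.
by rewrite le_eqVlt; apply/orP; left; apply/eqP; ring.
Qed.

Lemma Ex_quad_clt_sum m : (0 < m)%N ->
  Ex P (fun omega => quad G (invmx G *m S m omega)) = cstar w wstar.
Proof.
move=> m0; rewrite cstarE.
have bb i j : bmeas (fun omega => S m omega i 0 * S m omega j 0).
  by apply: bmeasM; exact: bmeas_S.
transitivity (Ex P (fun omega => \sum_i \sum_j invmx G i j * (S m omega i 0 * S m omega j 0))).
  congr Ex; apply/funext => omega; rewrite -quad_invG quadE dotE.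
  apply: eq_bigr => i _; rewrite [(_ *m _) i 0]mxE mulr_sumr; apply: eq_bigr => j _; ring.
rewrite Ex_sum; last by move=> i; apply: bmeas_sum => j; exact: bmeasZ.
apply: eq_bigr => i _; rewrite Ex_sum; last by move=> j; exact: bmeasZ.
by apply: eq_bigr => j _; rewrite ExZ// Ex_SM.
Qed.

(** By [vanishing_mean] the error can be replaced by G^-1 S, at which the form G
    has mean c(wstar) for every m > 0. *)
Lemma risk_err : Ex P (fun omega => quad G (err m omega)) @[m --> \oo] --> cstar w wstar.
Proof.
have bq1 m : bmeas (fun omega => quad G (err m omega)) by exact: bmeas_quadX (bmeas_err m).
have bq2 m : bmeas (fun omega => quad G (invmx G *m S m omega)).
  by apply: bmeas_quadX => i; exact: bmeas_mulmxX (bmeas_S m).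
have [K1 K10 h1] := err_le; have [K2 K20 h2] := l1_S_le; have [c c0 hc] := invG_l1.
have diff0 : Ex P (fun omega => quad G (err m omega) - quad G (invmx G *m S m omega))
    @[m --> \oo] --> 0.
  apply: (@vanishing_mean _ (J.+1%:R * K1 ^+ 2 + J.+1%:R * (c * K2) ^+ 2)).
  - by move=> m; exact: bmeasB.
  - move=> m omega m0; have m0' : 0 <= m%:R :> R by [].
    have m1 : 1 <= m%:R :> R by rewrite ler1n.
    rewrite (le_trans (ler_normB _ _))// mulrDl; apply: lerD.
      rewrite (le_trans (quad_Gmat_le _))// -mulrA ler_wpM2l//.
      rewrite (_ : _ * _ = (K1 * m%:R ^+ 2) ^+ 2); last by ring.
      by rewrite ler_sqr ?nnegrE ?l1_ge0 ?mulr_ge0 ?exprn_ge0// h1.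
    rewrite (le_trans (quad_Gmat_le _))// -mulrA ler_wpM2l//.
    rewrite (_ : _ * _ = (c * K2 * m%:R ^+ 2) ^+ 2); last by ring.
    rewrite ler_sqr ?nnegrE ?l1_ge0 ?mulr_ge0 ?exprn_ge0//.
    rewrite (le_trans (hc _))// -mulrA ler_wpM2l// (le_trans (h2 _ _ m0))//.
    by rewrite ler_wpM2l// expr2 ler_peMr.
  move=> e e0; pose n : R := J.+1%:R; have n0 : 0 < n by rewrite ltr0n.
  pose e1 := Num.min 1 (e / (n + 2)).
  have e10 : 0 < e1 by rewrite lt_min ltr01 divr_gt0// addr_gt0.
  have [dl dl0 hdl] := err_close e10; exists dl => //.
  apply: filterS hdl => m hm omega nb; have := hm omega nb.
  set u := err m omega - _ => hu.
  rewrite (le_trans (quad_diff_le _ _ Gmat_sym Gmat_le1))// -/u.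
  rewrite mulmxA mulmxV ?Gmat_unit// mul1mx.
  set s := l1 (S m omega) + 1 in hu *.
  have s0 : 0 <= s by rewrite addr_ge0 ?l1_ge0.
  have es0 : 0 <= e1 * s by rewrite mulr_ge0 ?(ltW e10).
  have hS : l1 (S m omega) <= s by rewrite lerDl.
  apply: (@le_trans _ _ (e1 * s * (n * (e1 * s)) + 2 * (e1 * s * s))).
    apply: lerD; first by apply: ler_pM; rewrite ?l1_ge0 ?mulr_ge0 ?l1_ge0// ler_wpM2l// ltW.
    by rewrite ler_wpM2l//; apply: ler_pM; rewrite ?l1_ge0.
  rewrite (_ : _ + _ = e1 * (n * e1 + 2) * s ^+ 2); last by ring.
  rewrite ler_wpM2r ?sqr_ge0//.
  have e11 : e1 <= 1 by rewrite ge_min lexx.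
  apply: (@le_trans _ _ (e1 * (n + 2))).
    by rewrite ler_wpM2l ?(ltW e10)// lerD2r ger_pMr.
  by rewrite -ler_pdivlMr ?addr_gt0// ge_min lexx orbT.
have lim0 : Ex P (fun omega => quad G (invmx G *m S m omega)) @[m --> \oo] --> cstar w wstar.
  by apply: cvg_near_cst; near=> m; apply: Ex_quad_clt_sum; near: m; exact: nbhs_infty_gt.
rewrite (_ : (fun m => Ex P (fun omega => quad G (err m omega))) = (fun m =>
  Ex P (fun omega => quad G (err m omega) - quad G (invmx G *m S m omega)) +
  Ex P (fun omega => quad G (invmx G *m S m omega)))).
  by rewrite -[cstar _ _]add0r; exact: cvgD.
by apply/funext => m; rewrite ExB// subrK.
Unshelve. all: by end_near. Qed.

Lemma L2norm_comb (a : 'cV[R]_J.+1) (f : R * R -> R) : (forall x, f x = comb w a x) ->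
  L2norm f ^+ 2 = quad G a.
Proof.
move=> fE; have q0 := Gmat_ge0 a.
have b2 : bmeas (fun x => dot a (regr x) ^+ 2) by apply: bmeasX; exact: bmeas_dot_regr.
have key : (\int[lebesgue2 R]_x
    (`| patch (fun=> 0%E) sq (EFin \o f) x | `^ 2) = (quad G a)%:E)%E.
  transitivity (\int[lebesgue2 R]_(x in sq) (dot a (regr x) ^+ 2)%:E)%E.
    rewrite [RHS]integral_mkcond; apply: eq_integral => x _.
    rewrite !patchE; case: ifPn => [/set_mem sx|_].
      transitivity (`|dot a (regr x)|%:E `^ 2)%E; first by rewrite /= fE /comb regrE.
      by rewrite poweR_EFin powR_mulrn// real_normK// num_real.
    change ((`|0%:E| : \bar R) `^ 2 = 0%:E :> \bar R)%E.
    by rewrite abse0 poweR_EFin powR0// pnatr_eq0.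
  rewrite quad_Gmat (EX_square b2) /Rintegral fineK//.
  by have := square_integrable hdesign b2; apply: integrable_fin_num; exact: measurable_unit_square.
rewrite /L2norm unlock key poweR_EFin /= powR12_sqrt// sqr_sqrtr//.
Qed.

Theorem risk_cvg : ((m%:R)%:E *
     'E_P[fun omega =>
        (L2norm (what w U V Y nu tau m omega \- w_circ w wstar) ^+ 2)%R])%E
     @[m --> \oo] --> (cstar w wstar)%:E.
Proof.
have fE : \forall m \near \oo, ((m%:R)%:E * 'E_P[fun omega =>
    (L2norm (what w U V Y nu tau m omega \- w_circ w wstar) ^+ 2)%R] =
    (Ex P (fun omega => quad G (err m omega)))%:E)%E.
  near=> m; have m0 : 0 < m%:R :> R by rewrite ltr0n; near: m; exact: nbhs_infty_gt.
  have bq : bmeas (fun omega => m%:R^-1 * quad G (err m omega)).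
    by apply: bmeasZ; exact: bmeas_quadX (bmeas_err m).
  rewrite (_ : (fun omega => _) = (fun omega => m%:R^-1 * quad G (err m omega))); last first.
    apply/funext => omega; rewrite (@L2norm_comb (betahat w U V Y nu tau m omega - b0)).
      by rewrite /err quadZ sqr_sqrtr ?(ltW m0)// mulrA mulVf ?mul1r// gt_eqF.
    by move=> x; rewrite /= /what /w_circ /comb dotDl dotNl.
  rewrite expectationE// ExZ; last exact: bmeas_quadX (bmeas_err m).
  by rewrite -EFinM mulrA mulfV ?mul1r// gt_eqF.
apply: cvg_EFin; first by apply: filterS fE => m ->.
apply: near_eq_cvgr risk_err; by apply: filterS fE => m /= ->.
Unshelve. all: by end_near. Qed.

Lemma bad_monotone dl dl' m : dl <= dl' -> bad dl' m `<=` bad dl m.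
Proof. by move=> h omega /=; apply: le_trans; rewrite ler_wpM2l. Qed.

(** The Borel-Cantelli lemma. *)
Lemma bad_limsup dl : 0 < dl -> P (lim_sup_set (bad dl)) = 0%E.
Proof.
move=> dl0; apply: lim_sup_set_cvg0; first exact: measurable_bad.
have [C C0 hC] := bad_rare dl0.
(* compare 1 / x^6 with the telescoping 2 (1 / x - 1 / (x + 1)) *)
have part n : \sum_(0 <= m < n.+1) fine (P (bad dl m)) <= 1 + 2 * C * (1 - n.+1%:R^-1).
  elim: n => [|n ih].
    rewrite big_nat1 invr1 subrr mulr0 addr0 -lee_fin fineK ?fin_num_measure ?probability_le1//;
      exact: measurable_bad.
  rewrite big_nat_recr//=; have := hC n.+1 isT; move: ih.
  set s := \sum_(_ <= _ < _) _; set p := fine _.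
  rewrite -[n.+2%:R]natr1; set x : R := n.+1%:R; have x1 : 1 <= x by rewrite ler1n.
  have x0 : 0 < x by rewrite (lt_le_trans ltr01).
  have h : C / x ^+ 6 <= 2 * C * (x^-1 - (x + 1)^-1).
    rewrite (_ : 2 * C * _ = C * (2 / (x * (x + 1)))); last first.
      by field; rewrite !gt_eqF// addr_gt0.
    rewrite ler_wpM2l// -[2 / _]invf_div lef_pV2 ?posrE ?divr_gt0 ?mulr_gt0 ?addr_gt0 ?exprn_gt0//.
    rewrite ler_pdivrMr//; apply: (@le_trans _ _ (x ^+ 2 * 2)).
      by rewrite expr2 -mulrA ler_wpM2l ?(ltW x0)// mulr_natr mulr2n lerD2l.
    by rewrite ler_wpM2r// ler_weXn2l.
  move: h; set t := C / x ^+ 6; set y := (x + 1)^-1; set z := x^-1.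
  by move=> h h1 h2; lra.
apply: (@le_lt_trans _ _ (1 + 2 * C)%:E); last exact: ltry.
apply: lime_le; first by apply: is_cvg_nneseries => n _ _; exact: measure_ge0.
near=> n; have n0 : (0 < n)%N by near: n; exact: nbhs_infty_gt.
rewrite -(prednK n0); rewrite (eq_bigr (fun i => (fine (P (bad dl i)))%:E)); last first.
  by move=> i _; apply: fineP_indic; exact: measurable_bad.
rewrite sumEFin lee_fin (le_trans (part _))// lerD2l.
by rewrite -[leRHS]mulr1 ler_wpM2l ?mulr_ge0// gerBl invr_ge0.
Unshelve. all: by end_near. Qed.

(** Almost surely, for every k only finitely many of the bad events of threshold
    1 / (k + 1) occur. *)
Theorem Sigmahat_cvg : {ae P, forall omega,
     m%:R *: Sigmahat w U V nu tau m omega @[m --> \oo] --> nu *: invmx G}.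
Proof.
have : {ae P, forall omega, forall k, ~ lim_sup_set (bad k.+1%:R^-1) omega}.
  apply/ae_foralln => k; exists (lim_sup_set (bad k.+1%:R^-1)); split.
  - apply: bigcap_measurable; first by exists 0%N.
    by move=> n _; apply: bigcup_measurable => m _; exact: measurable_bad.
  - by apply: bad_limsup; rewrite invr_gt0 ltr0n.
  - by move=> omega /= /contrapT.
apply: filterS => omega hk; apply/cvg_ballP => e e0.
have e20 : 0 < e / (2 * nu) by rewrite divr_gt0// mulr_gt0.
have [dl dl0 hdl] := inv_shrunk_gram_close e20.
have [k hkd] : exists k, k.+1%:R^-1 <= dl.
  have [n _ hn] := near_infty_natSinv_lt (PosNum dl0).
  by exists n; rewrite ltW//; apply: (hn n); rewrite /= leqnn.
have nbad : \forall m \near \oo, ~ bad dl m omega.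
  have := hk k; rewrite /lim_sup_set => /existsNP[n /not_implyP[_ hn]].
  exists n => // m /= nm hb; apply: hn; exists m => //.
  exact: bad_monotone hkd _ hb.
near=> m; have m0 : (0 < m)%N by near: m; exact: nbhs_infty_gt.
have m0' : 0 < m%:R :> R by rewrite ltr0n.
have close : forall omega, ~ bad dl m omega ->
    forall y, l1 (invmx (A m omega) *m y - invmx G *m y) <= e / (2 * nu) * l1 y by near: m.
have nb : ~ bad dl m omega by near: m.
split => // i j; rewrite /ball/= !mxE mulrA mulrCA divff ?gt_eqF// mulr1 -mulrBr.
have := close omega nb (delta_mx j 0); rewrite -!colE.
have -> : l1 (delta_mx j 0 : 'cV[R]_J.+1) = 1.
  rewrite /l1 (bigD1 j)//= mxE !eqxx normr1 big1 ?addr0// => i' ij.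
  by rewrite mxE (negbTE ij) normr0.
rewrite mulr1 => h; have := le_trans (coord_le_l1 _ i) h; rewrite !mxE => hij.
rewrite normrM (ger0_norm (ltW nu0)) distrC.
apply: (@le_lt_trans _ _ (nu * (e / (2 * nu)))); first by rewrite ler_wpM2l// ltW.
rewrite (_ : nu * _ = e / 2); last by field; rewrite gt_eqF.
by rewrite ltr_pdivrMr// ltr_pMr// ltr1n.
Unshelve. all: by end_near. Qed.

(** * Coverage of the credible intervals *)

(** The form nu G - M at a is the integral of (nu - sigma2) (a, F)^2. *)
Lemma loewner_of_noise : {ae lebesgue2 R, forall x, sq x -> noise x <= nu} ->
  loewner_le M (nu *: G).
Proof.
move=> hae; split; first by rewrite linearB linearZ/= Gmat_sym Mmat_sym.
move=> a; have bg := bmeas_dot_regr a hw; have bg2 := bmeasX 2 bg.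
have -> : quad (nu *: G - M) a = nu * quad G a - quad M a.
  by rewrite !quadE mulmxBl -scalemxAl dotDr dotNr dotZr.
have -> : quad M a = \int[lebesgue2 R]_(x in sq) (noise x * dot a (regr x) ^+ 2).
  rewrite -(EX_square (bmeasM bmeas_noise bg2)).
  rewrite (quad_weighted_gram a (f := fun i omega => regr (X 0%N omega).1 i 0) _ _ Mmat_noise).
  - by congr Ex; apply/funext => omega; rewrite dotE.
  - exact: (bmeas_X mX 0 (bmeas_fst bmeas_noise)).
  - by move=> i; apply: (bmeas_X mX 0 (bmeas_fst (bmeas_regr i hw))).
have -> : nu * quad G a = \int[lebesgue2 R]_(x in sq) (nu * dot a (regr x) ^+ 2).
  rewrite -(EX_square (bmeasZ nu bg2)) quad_Gmat; symmetry; apply: ExZ.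
  exact: (bmeas_X mX 0 (bmeas_fst bg2)).
have bn := bmeasM bmeas_noise bg2; have bnu := bmeasZ nu bg2.
rewrite subr_ge0 /Rintegral; apply: fine_le.
- by have := square_integrable hdesign bn; apply: integrable_fin_num; exact: measurable_unit_square.
- by have := square_integrable hdesign bnu; apply: integrable_fin_num; exact: measurable_unit_square.
have mn : measurable_fun sq (fun x => (noise x * dot a (regr x) ^+ 2)%:E).
  by apply/measurable_EFinP; apply: measurable_funTS; exact: bn.1.
have mnu : measurable_fun sq (fun x => (nu * dot a (regr x) ^+ 2)%:E).
  by apply/measurable_EFinP; apply: measurable_funTS; exact: bnu.1.
apply: ae_ge0_le_integral => //.
- exact: measurable_unit_square.
- move=> x sx; rewrite lee_fin mulr_ge0 ?sqr_ge0//.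
  rewrite /noise sqextE// addr_ge0 ?sqr_ge0//; case: hwstar => _ /(_ _ sx)/andP[w0 w1] _.
  by rewrite mulr_ge0// subr_ge0.
- by move=> x _; rewrite lee_fin mulr_ge0 ?sqr_ge0// ltW.
apply: (ae_square_sub _ hae) => x sx h.
by rewrite lee_fin ler_wpM2r ?sqr_ge0.
Qed.

Lemma loewner_of_Linfty : (Linfty_norm (sigma2 w wstar) <= nu%:E)%E -> loewner_le M (nu *: G).
Proof.
have pos : (0 < lebesgue2 R setT)%E.
  apply: (@lt_le_trans _ _ (lebesgue2 R sq)).
    by rewrite (lebesgue2_unit_square hdesign) lte_fin.
  by apply: le_measure; rewrite ?inE//; exact: measurable_unit_square.
rewrite /Linfty_norm unlock /= pos => /ess_sup_inf.ess_supP hess; apply: loewner_of_noise.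
apply: filterS hess => x /= + sx; rewrite patchE mem_set//= lee_fin noiseE//.
exact: le_trans (ler_norm _).
Qed.

(** If wstar is a combination of the regressors, the projection recovers it, so
    that sigma2 = wstar (1 - wstar) <= 1 / 4 almost everywhere. *)
Lemma loewner_of_in_H : in_H w wstar -> nu = 4^-1 -> loewner_le M (nu *: G).
Proof.
move=> [beta hb] nu4; have bd := bmeas_dot_regr beta hw; have bw := bmeas_graphon hwstar.
have b0E : b0 = beta.
  have eqG : G *m b0 = G *m beta.
    apply/matrixP => i j; rewrite ord1 Gmat_beta_circ.
    have -> : (G *m beta) i 0 = EX (fun z => regr z.1 i 0 * dot beta (regr z.1)).
      have br := bmeas_regrM i.
      rewrite mxE; transitivity (\sum_j EX (fun z => beta j 0 * (regr z.1 i 0 * regr z.1 j 0))).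
        apply: eq_bigr => k _; rewrite GmatE mulrC -ExZ//.
        by apply: (bmeas_X mX 0 (bmeas_fst (bmeas_regrM i k))).
      rewrite -Ex_sum.
        congr Ex; apply/funext => omega; rewrite dotE mulr_sumr.
        by apply: eq_bigr => k _; ring.
      by move=> k; apply: bmeasZ; apply: (bmeas_X mX 0 (bmeas_fst (bmeas_regrM i k))).
    rewrite (EX_square (bmeasM (bmeas_regr i hw) bd)).
    transitivity (\int[lebesgue2 R]_(x in sq) (regr x i 0 * sqext wstar x)).
      by apply: eq_Rintegral => x /set_mem sx; rewrite sqextE.
    rewrite /Rintegral; congr fine; apply: ae_eq_integral.
    - exact: measurable_unit_square.
    - apply/measurable_EFinP; apply: measurable_funTS.
      exact: (bmeasM (bmeas_regr i hw) bw).1.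
    - apply/measurable_EFinP; apply: measurable_funTS.
      exact: (bmeasM (bmeas_regr i hw) bd).1.
    by apply: (ae_square_sub _ hb) => x sx h; rewrite /= sqextE// h /comb regrE.
  by rewrite -[b0]mul1mx -(mulVmx Gmat_unit) -mulmxA eqG mulmxA mulVmx ?Gmat_unit// mul1mx.
apply: loewner_of_noise; apply: (ae_square_sub _ hb) => x sx h.
rewrite /noise sqextE// b0E regrE// h /comb nu4.
set t := dot beta _; have := sqr_ge0 (t - 2^-1); rewrite subrr expr0n addr0 !expr2; lra.
Qed.

Section coverage.
Variables (alpha : R) (l : 'cV[R]_J.+1).
Hypotheses (halpha : 0 < alpha < 1) (l0 : l != 0).

Notation z := (normal_quantile (1 - alpha / 2)).
Notation vl := (quad asym_var l).
Notation ql := (nu * quad (invmx G) l).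

Definition halfwidth m omega : R := z * Num.sqrt (nu * quad (invmx (A m omega)) l).
Definition limit_halfwidth : R := z * Num.sqrt ql.
Notation W := limit_halfwidth.

Lemma level_range : 2^-1 < 1 - alpha / 2 < 1.
Proof. by case/andP: halpha => a0 a1; apply/andP; split; lra. Qed.

Lemma quantile_gt0 : 0 < z.
Proof. by have [] := normal_quantileP level_range. Qed.

Lemma ql_gt0 : 0 < ql.
Proof. by rewrite mulr_gt0// quad_invG_gt0. Qed.

Lemma limit_halfwidth_gt0 : 0 < W.
Proof. by rewrite mulr_gt0 ?quantile_gt0// sqrtr_gt0 ql_gt0. Qed.

(** At the scale sqrt m, the interval covers the target when the error in the
    direction l is at most the half-width. *)
Definition covered m : set Omega := [set omega | `|dot l (err m omega)| <= halfwidth m omega].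

Lemma coverage_err m : (0 < m)%N ->
  coverage w U V Y nu tau wstar alpha l m = fine (P (covered m)).
Proof.
move=> m0; have m0' : 0 < m%:R :> R by rewrite ltr0n.
rewrite /coverage; congr (fine (P _)); apply/seteqP; rewrite /covered.
have q0 : 0 < Num.sqrt m%:R :> R by rewrite sqrtr_gt0.
have key omega : credible_interval w U V Y nu tau alpha l m omega (dot l b0) <->
    `|dot l (err m omega)| <= halfwidth m omega.
  rewrite /credible_interval /= in_itv/= /err dotZr normrM (ger0_norm (ltW q0)).
  have -> : halfwidth m omega = Num.sqrt m%:R *
      (z * Num.sqrt (quad (Sigmahat w U V nu tau m omega) l)).
    rewrite mulrCA -sqrtrM ?(ltW m0')// /halfwidth /Sigmahat !quadE -scalemxAl dotZr mulrA.
    by rewrite -/(A m omega) (_ : m%:R * (nu / m%:R) = nu)//; field; rewrite gt_eqF.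
  rewrite ler_pM2l// dotDr dotNr ler_norml.
  set c := dot l (betahat _ _ _ _ _ _ _ _); set h := z * _; set b := dot l b0.
  by split => /andP[h1 h2]; apply/andP; split; lra.
by split => omega /= /key.
Qed.

Lemma sqrt_close (a b : R) : 0 < b -> `|Num.sqrt a - Num.sqrt b| <= `|a - b| / Num.sqrt b.
Proof.
move=> b_gt0; have s0 : 0 < Num.sqrt b by rewrite sqrtr_gt0.
rewrite ler_pdivlMr//; have [a0|a0] := leP 0 a.
  have -> : a - b = (Num.sqrt a - Num.sqrt b) * (Num.sqrt a + Num.sqrt b).
    by rewrite -subr_sqr !sqr_sqrtr// ltW.
  by rewrite normrM ler_wpM2l// (@ger0_norm _ (Num.sqrt a + _)) ?lerDr ?addr_ge0 ?sqrtr_ge0.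
rewrite ltr0_sqrtr// sub0r normrN ger0_norm ?sqrtr_ge0// -expr2 sqr_sqrtr ?(ltW b_gt0)//.
by rewrite ler_normr; apply/orP; right; lra.
Qed.

(** The half-width is a continuous function of the inverse of the shrunk Gram
    matrix. *)
Lemma halfwidth_close eta : 0 < eta -> exists2 dl, 0 < dl &
  \forall m \near \oo, forall omega, ~ bad dl m omega -> `|halfwidth m omega - W| <= eta.
Proof.
move=> eta0; have z0 := quantile_gt0; have q0 := ql_gt0.
have s0 : 0 < Num.sqrt ql by rewrite sqrtr_gt0.
(* the modulus of continuity: |sqrt a - sqrt b| <= |a - b| / sqrt b for b > 0 *)
pose c := z * (nu * (l1 l * l1 l) / Num.sqrt ql).
have c0 : 0 <= c.
  rewrite mulr_ge0 ?(ltW z0)// mulr_ge0 ?invr_ge0 ?(ltW s0)//.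
  by rewrite mulr_ge0 ?(ltW nu0)// mulr_ge0 ?l1_ge0.
have c1 : 0 < c + 1 by rewrite ltr_wpDl.
have [dl dl0 hdl] := inv_shrunk_gram_close (divr_gt0 eta0 c1); exists dl => //.
apply: filterS hdl => m hm omega nb; have := hm omega nb l.
set e1 := eta / (c + 1) => hl; have e10 : 0 < e1 by rewrite divr_gt0.
rewrite /halfwidth /limit_halfwidth -mulrBr normrM (ger0_norm (ltW z0)).
apply: (@le_trans _ _ (z * (nu * (l1 l * (e1 * l1 l)) / Num.sqrt ql))).
  rewrite ler_wpM2l ?(ltW z0)// (le_trans (sqrt_close _ q0))//.
  rewrite ler_wpM2r ?invr_ge0 ?(ltW s0)// -mulrBr normrM (ger0_norm (ltW nu0)).
  rewrite ler_wpM2l ?(ltW nu0)// !quadE -dotNr -dotDr (le_trans (dot_l1 _ _))//.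
  by rewrite ler_wpM2l ?l1_ge0.
rewrite [leLHS](_ : _ = c * e1); last by rewrite /c; ring.
apply: (@le_trans _ _ ((c + 1) * e1)); first by rewrite ler_wpM2r ?(ltW e10)// lerDl.
by rewrite /e1 mulrCA divff ?mulr1// gt_eqF.
Qed.

Lemma measurable_covered m : (0 < m)%N -> measurable (covered m).
Proof.
move=> m0; apply: measurable_le_set.
  by apply: (bmeas_norm (bmeas_dotX l (bmeas_err m))).1.
have bq : bmeas (fun omega => nu * quad (invmx (A m omega)) l).
  apply: bmeasZ; under eq_fun do rewrite quadE dotE.
  apply: bmeas_sum => i; apply: bmeasZ.
  under eq_fun do rewrite mxE; apply: bmeas_sum => j.
  by apply: bmeasM; [exact: bmeas_inv_shrunk_gram|exact: bmeas_cst].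
apply: (bmeasZ z (bmeas_comp_cont (h := Num.sqrt) _ bq)).1.
exact: sqrt_continuous.
Qed.

(** Off the bad event the half-width is within eta of its limit W, so the
    coverage event lies between two events with a deterministic half-width.
    Ramps make these accessible to convergence in law, and the limit law charges
    neither boundary point of the centred interval of radius W. *)
Lemma coverage_cvg :
  coverage w U V Y nu tau wstar alpha l m @[m --> \oo] --> centred_prob vl W.
Proof.
have v0 : 0 <= vl by rewrite quad_asym_var Mmat_ge0.
have [N [Nmv Nlim]] := clt_err.
have Nc r : fine (N [set x : 'cV[R]_J.+1 | `|dot l x| <= r]) = centred_prob vl r.
  have -> : [set x : 'cV[R]_J.+1 | `|dot l x| <= r] =
      [set x : 'cV[R]_J.+1 | (`[- r, r]%classic : set R) (dot l x)].
    by apply/seteqP; split => x /=; rewrite in_itv/= ler_norml.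
  rewrite Nmv; last exact: measurable_itv.
  by rewrite dotC dot0l /centred_prob normal_distE.
have mNc r : measurable ([set x | `|dot l x| <= r] : set (@borel_cV R J.+1)).
  apply: measurable_le_set; last exact: measurable_cst.
  apply: measurableT_comp => //.
  exact: (continuous_measurable_cV (@continuous_dot _ _ l)).
have cont a b : continuous (fun x : 'cV[R]_J.+1 => ramp a b `|dot l x|).
  move=> x; apply: (@continuous_comp _ _ _ (fun x : 'cV[R]_J.+1 => `|dot l x|) (ramp a b)).
    apply: (@continuous_comp _ _ _ (fun x : 'cV[R]_J.+1 => dot l x) (fun y : R => `|y|)).
      exact: continuous_dot.
    exact: norm_continuous.
  exact: ramp_continuous.
have bdd a b : exists K, forall x : 'cV[R]_J.+1, `|ramp a b `|dot l x| | <= K.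
  by exists 1 => x; have /andP[r0 r1] := ramp01 a b `|dot l x|; rewrite ger0_norm.
have bN a b : bmeas (fun x : @borel_cV R J.+1 => ramp a b `|dot l x|).
  by apply: bmeas_cV.
have bE a b m : bmeas (fun omega => ramp a b `|dot l (err m omega)|).
  have := bmeas_norm (bmeas_dotX l (bmeas_err m)) => h.
  by have := bmeas_comp_cont (@ramp_continuous R a b) h.
apply/cvgrPdist_le => e e0; pose e3 := e / 3; have e30 : 0 < e3 by rewrite divr_gt0.
have [eta [eta0 etaW hup hlow]] := centred_prob_continuous v0 limit_halfwidth_gt0 e30.
have [dl dl0 hdl] := halfwidth_close eta0.
have lim1 := Nlim _ (cont (W + eta) eta) (bdd _ _).
have lim2 := Nlim _ (cont (W - 2 * eta) eta) (bdd _ _).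
have {lim1} /cvgrPdist_le/(_ e3 e30) near1 := lim1.
have {lim2} /cvgrPdist_le/(_ e3 e30) near2 := lim2.
near=> m; have m0 : (0 < m)%N by near: m; exact: nbhs_infty_gt.
have hb : fine (P (bad dl m)) <= e3 by near: m; exact: bad_small.
have hw' : forall omega, ~ bad dl m omega -> `|halfwidth m omega - W| <= eta by near: m.
have n1 : `|Ex N (fun x => ramp (W + eta) eta `|dot l x|) -
  Ex P (fun omega => ramp (W + eta) eta `|dot l (err m omega)|)| <= e3 by near: m.
have n2 : `|Ex N (fun x => ramp (W - 2 * eta) eta `|dot l x|) -
  Ex P (fun omega => ramp (W - 2 * eta) eta `|dot l (err m omega)|)| <= e3 by near: m.
have bi : bmeas (\1_(bad dl m) : Omega -> R) by apply: bmeas_indic; exact: measurable_bad.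
have mc := measurable_covered m0.
have bc : bmeas (\1_(covered m) : Omega -> R) by exact: bmeas_indic.
rewrite coverage_err// -(Ex_indic P mc).
have up : Ex P \1_(covered m) <= fine (P (bad dl m)) +
    Ex P (fun omega => ramp (W + eta) eta `|dot l (err m omega)|).
  rewrite -(Ex_indic P (measurable_bad dl m)) -ExD//; apply: Ex_le => //; first exact: bmeasD.
  move=> omega; rewrite !indicE; have /andP[r0 r1] := ramp01 (W + eta) eta `|dot l (err m omega)|.
  case: (boolP (omega \in bad dl m)) => [_|/negP nb].
    by case: (omega \in covered m) => /=; lra.
  case: (boolP (omega \in covered m)) => [/set_mem hc|_] /=; last by rewrite add0r.
  rewrite add0r ramp_ge//; rewrite (le_trans hc)//.
  have := hw' omega (fun h => nb (mem_set h)); rewrite ler_norml => /andP[_]; lra.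
have low : Ex P (fun omega => ramp (W - 2 * eta) eta `|dot l (err m omega)|) <=
    Ex P \1_(covered m) + fine (P (bad dl m)).
  rewrite -(Ex_indic P (measurable_bad dl m)) -ExD//; apply: Ex_le => //; first exact: bmeasD.
  move=> omega; rewrite !indicE.
  have /andP[r0 r1] := ramp01 (W - 2 * eta) eta `|dot l (err m omega)|.
  case: (boolP (omega \in bad dl m)) => [_|/negP nb].
    by case: (omega \in covered m) => /=; lra.
  case: (boolP (omega \in covered m)) => [_|/negP nc] /=; first by rewrite addr0.
  rewrite addr0 ramp_le// leNgt; apply/negP => hlt; apply: nc; apply/mem_set.
  rewrite /covered/= (le_trans (ltW hlt))//.
  have := hw' omega (fun h => nb (mem_set h)); rewrite ler_norml => /andP[+ _]; lra.
have upN : Ex N (fun x => ramp (W + eta) eta `|dot l x|) <= centred_prob vl (W + 2 * eta).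
  rewrite -Nc -(Ex_indic N (mNc _)); apply: Ex_le => //; first exact: bmeas_indic.
  move=> x; have /andP[r0 r1] := ramp01 (W + eta) eta `|dot l x|.
  rewrite indicE; case: (boolP (x \in _)) => [_//|/negP nx] /=.
  rewrite ramp_le// leNgt; apply/negP => hlt; apply: nx; apply/mem_set => /=; lra.
have lowN : centred_prob vl (W - 2 * eta) <= Ex N (fun x => ramp (W - 2 * eta) eta `|dot l x|).
  rewrite -Nc -(Ex_indic N (mNc _)); apply: Ex_le => //; first exact: bmeas_indic.
  move=> x; have /andP[r0 r1] := ramp01 (W - 2 * eta) eta `|dot l x|.
  rewrite indicE; case: (boolP (x \in _)) => [/set_mem/= hx|_//] /=.
  by rewrite ramp_ge.
have e3E : e = e3 + e3 + e3 by rewrite /e3; field.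
move: n1 n2; rewrite !ler_norml => /andP[n1 n1'] /andP[n2 n2'].
move: n1 n1' n2 n2' up low upN lowN hb hup hlow; rewrite e3E.
set EN1 := Ex N _; set EN2 := Ex N _; set EP1 := Ex P (fun omega => _); set EP2 := Ex P (fun omega => _).
set c := Ex P _; set pb := fine _; set c0 := centred_prob _ _; set c1 := centred_prob _ _.
set c2 := centred_prob _ _; clearbody EN1 EN2 EP1 EP2 c pb c0 c1 c2.
by move=> *; apply/andP; split; lra.
Unshelve. all: by end_near. Qed.

(** The limit is the probability that a centred normal variable of variance vl
    lies within z sqrt ql of 0. *)
Lemma limn_coverage :
  1 - alpha <= limn (coverage w U V Y nu tau wstar alpha l) <-> vl <= ql.
Proof.
have -> : limn (coverage w U V Y nu tau wstar alpha l) = centred_prob vl W.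
  by apply: cvg_lim => //; exact: coverage_cvg.
have -> : 1 - alpha = 2 * (1 - alpha / 2) - 1 by field.
apply: centred_prob_quantile; [exact: level_range| |exact: ql_gt0].
by rewrite quad_asym_var Mmat_ge0.
Qed.

End coverage.

(** Substitute l = G a: the comparison of the variances becomes quad M a <= nu
    quad G a. *)
Lemma coverage_iff_loewner alpha : 0 < alpha < 1 ->
  (forall l : 'cV[R]_J.+1, l != 0 ->
     1 - alpha <= limn (coverage w U V Y nu tau wstar alpha l)) <->
  loewner_le M (nu *: G).
Proof.
move=> ha; have quadB' a : quad (nu *: G - M) a = nu * quad G a - quad M a.
  by rewrite !quadE mulmxBl -scalemxAl dotDr dotNr dotZr.
split=> [h|[_ h] l l0].
  split; first by rewrite linearB linearZ/= Gmat_sym Mmat_sym.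
  move=> a; rewrite quadB' subr_ge0; have [->|a0] := eqVneq a 0.
    by rewrite !quadE !mulmx0 dot0l mulr0.
  have Ga : G *m a != 0.
    apply: contra_neq a0 => Ga; apply: Gmat_definite.
    by rewrite quadE Ga dotC dot0l.
  have := (limn_coverage ha Ga).1 (h _ Ga).
  by rewrite quad_asym_var quad_invG (mulmxA (invmx G)) mulVmx ?Gmat_unit// mul1mx.
apply/(limn_coverage ha l0); have := h (invmx G *m l).
by rewrite quadB' subr_ge0 quad_asym_var quad_invG.
Qed.

End estimator.

Unset Implicit Arguments.
Set Strict Implicit.
Set Printing Implicit Defensive.

Theorem propositionS2 (R : realType)
  (disp : measure_display) (Omega : measurableType disp)
  (P : probability Omega R)
  (J : nat) (w : 'I_J -> R * R -> R) (wstar : R * R -> R)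
  (U V : nat -> {RV P >-> R}) (Y : nat -> {RV P >-> bool})
  (nu tau alpha : R)
  (hw : forall j, graphon (w j))
  (hindep : lin_indep_L2 w)
  (hwstar : graphon wstar)
  (hdesign : independent_dyad_design wstar U V Y)
  (hnu : 0 < nu) (htau : 0 < tau) (halpha : 0 < alpha < 1) :
  (exists N : probability (borel_cV J.+1) R,
     is_mvnormal N 0 (invmx (Gmat w) *m Mmat w wstar *m invmx (Gmat w)) /\
     cvg_in_law P
       (fun m omega => Num.sqrt m%:R *:
          (betahat w U V Y nu tau m omega - beta_circ w wstar)) N) /\
  {ae P, forall omega,
     m%:R *: Sigmahat w U V nu tau m omega @[m --> \oo] -->
     nu *: invmx (Gmat w)} /\
  ((m%:R)%:E *
     'E_P[fun omega =>
        (L2norm (what w U V Y nu tau m omega \- w_circ w wstar) ^+ 2)%R])%E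
     @[m --> \oo] --> (cstar w wstar)%:E /\
  (forall l : 'cV[R]_J.+1, l != 0 ->
     cvgn (coverage w U V Y nu tau wstar alpha l)) /\
  (forall u v : R, unit_square R (u, v) ->
     Fvec w (u, v) != 0 /\
     cvgn (coverage w U V Y nu tau wstar alpha (Fvec w (u, v)))) /\
  ((forall l : 'cV[R]_J.+1, l != 0 ->
      1 - alpha <= limn (coverage w U V Y nu tau wstar alpha l)) <->
   loewner_le (Mmat w wstar) (nu *: Gmat w)) /\
  ((Linfty_norm (sigma2 w wstar) <= nu%:E)%E ->
   forall l : 'cV[R]_J.+1, l != 0 ->
     1 - alpha <= limn (coverage w U V Y nu tau wstar alpha l)) /\
  (in_H w wstar -> nu = 4^-1 ->
   forall l : 'cV[R]_J.+1, l != 0 ->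
     1 - alpha <= limn (coverage w U V Y nu tau wstar alpha l)).
Proof.
have cvg_cov l : l != 0 -> cvgn (coverage w U V Y nu tau wstar alpha l).
  move=> l0; apply/cvg_ex; eexists.
  exact: (coverage_cvg hw hindep hwstar hdesign hnu htau halpha l0).
have iffL := coverage_iff_loewner hw hindep hwstar hdesign hnu htau halpha.
split.
  have [N [Nmv Nlim]] := clt_err hw hindep hwstar hdesign hnu htau.
  exists N; split => // f cf bf.
  have bfN : bmeas (f : borel_cV J.+1 -> R) by exact: bmeas_cV.
  rewrite (integralE_Ex N bfN).
  rewrite (_ : (fun m => _) = (fun m => (Ex P (fun omega =>
      f (err w wstar U V Y nu tau m omega)))%:E)); last first.
    apply/funext => m; apply: expectationE.
    by apply: (bmeas_comp (measurable_err hw hdesign hnu htau m)) bfN.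
  apply: cvg_EFin; first by apply: nearW.
  exact: Nlim.
split; first exact: (Sigmahat_cvg hw hindep hwstar hdesign hnu htau).
split; first exact: (risk_cvg hw hindep hwstar hdesign hnu htau).
split; first exact: cvg_cov.
split.
  by move=> u v _; split; [exact: Fvec_neq0|exact: cvg_cov (Fvec_neq0 _ _)].
split; first exact: iffL.
split=> [hL | hH nu4]; apply/iffL.
  exact: (loewner_of_Linfty hw hwstar hdesign hnu hL).
exact: (loewner_of_in_H hw hindep hwstar hdesign hnu hH nu4).
Qed.
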